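(* Let $L_1,\dots,L_n\in H_n(q,\kappa)$ be the Jucys-Murphy elements of the cyclotomic Hecke algebra and put $\mathcal L_i:=f^{-1}(L_i)\in R_n$, where $f:R_n\to H_n(q,\kappa)$ is the Brundan-Kleshchev-Rouquier isomorphism; denote the image of $\mathcal L_i$ in $B_n$ by the same symbol. Then $\{\mathcal L_i: i=1,\dots,n\}$ is a family of JM-elements for $B_n$ with respect to the cellular basis $\mathcal C_n$ (for the order $\lhd$), with content function $c_{\mathfrak s}(i)=q^{\mathrm{res}(\mathfrak s(i))}$. That is: the $\mathcal L_i$ commute, $\mathcal L_i^*=\mathcal L_i$, and for all $\lambda\in\mathrm{Par}^1_{l,n}$, $\mathfrak s,\mathfrak t\in\mathrm{Std}(\lambda)$ and $1\le i\le n$ there are $r_{\mathfrak s\mathfrak v}\in F$ with $$m_{\mathfrak s\mathfrak t}\,\mathcal L_i\equiv q^{\mathrm{res}(\mathfrak t(i))}\,m_{\mathfrak s\mathfrak t}+\sum_{\mathfrak v\in\mathrm{Std}(\lambda),\ \mathfrak v\rhd\mathfrak t}r_{\mathfrak s\mathfrak v}\,m_{\mathfrak s\mathfrak v}\pmod{B_n^\lambda},$$ where $B_n^\lambda$ is the $F$-span of all $m_{\mathfrak a\mathfrak b}$ with $\mathfrak a,\mathfrak b\in\mathrm{Std}(\mu)$, $\mu\in\mathrm{Par}^1_{l,n}$, $\mu\rhd\lambda$.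
   Context: **Combinatorics.** A one-column $l$-multipartition of $n$ is a tuple $\lambda=((1^{a_1}),\dots,(1^{a_l}))$ with integers $a_m\ge 0$, $\sum_m a_m=n$; its diagram is $[\lambda]=\{(r,1,m):1\le m\le l,\ 1\le r\le a_m\}$. $\mathrm{Par}^1_{l,n}$ is the set of all of them. Nodes of $\mathbb N\times\{1\}\times\{1,\dots,l\}$ are totally ordered by: $(r,1,m)\lhd(r',1,m')$ iff $r>r'$, or $r=r'$ and $m>m'$. For finite sets $A,B$ of nodes, $A\unlhd B$ iff $|\{\gamma\in A:\gamma\rhd\gamma_0\}|\le|\{\gamma\in B:\gamma\rhd\gamma_0\}|$ for all nodes $\gamma_0$. $\lambda\unlhd\mu$ iff $[\lambda]\unlhd[\mu]$. A $\lambda$-tableau is a bijection $\mathfrak t:\{1,\dots,n\}\to[\lambda]$; it is standard if its entries increase from top to bottom in every component. $\mathrm{Tab}(\lambda)$, $\mathrm{Std}(\lambda)$: all, resp. standard, $\lambda$-tableaux. For tableaux, $\mathfrak t\unlhd\mathfrak s$ iff $\mathfrak t(\{1,\dots,k\})\unlhd\mathfrak s(\{1,\dots,k\})$ for all $k$. ($\lhd$ denotes the strict orders.) $\mathfrak t^\lambda$ is the $\lambda$-tableau with $\mathfrak t^\lambda(1)\rhd\cdots\rhd\mathfrak t^\lambda(n)$. $S_n$ acts on the right on $\mathrm{Tab}(\lambda)$ by $\mathfrak t w=\mathfrak t\circ w$ (so $\mathfrak t s_k$ interchanges entries $k,k+1$), and $\mathfrak t^\lambda d(\mathfrak t)=\mathfrak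 t$ defines $d(\mathfrak t)\in S_n$. **Algebras.** Fix integers $e,l,n>1$, a field $F$ and a primitive $e$-th root of unity $q\in F\setminus\{1\}$; $I_e=\mathbb Z/e\mathbb Z$; $S_n$ acts on $I_e^n$ by permuting coordinates. Fix $\hat\kappa\in\mathbb Z^l$; $\kappa_m\in I_e$ is the image of $\hat\kappa_m$, also identified with its representative in $\{0,\dots,e-1\}$. $\hat\kappa$ is strongly adjacency-free: (i) $\hat\kappa_{m+1}-\hat\kappa_m\ge n$; (ii) $\kappa_i-\kappa_j\not\equiv 0,\pm1\bmod e$ for $i\ne j$; (iii) $\kappa_1\not\equiv\kappa_l+2\bmod e$; (iv) $\kappa_1<\dots<\kappa_l$. The generalized blob algebra $B_n$ is the unital associative $F$-algebra with generators $\psi_1,\dots,\psi_{n-1},y_1,\dots,y_n,e(\boldsymbol i)$ ($\boldsymbol i\in I_e^n$) and relations: $e(\boldsymbol i)e(\boldsymbol j)=\delta_{\boldsymbol i\boldsymbol j}e(\boldsymbol i)$; $\sum_{\boldsymbol i}e(\boldsymbol i)=1$; $e(\boldsymbol i)=0$ if $i_1\notin\{\kappa_1,\dots,\kappa_l\}$; (†) $e(\boldsymbol i)=0$ if $i_1\in\{\kappa_1,\dots,\kappa_l\}$ and $i_2=i_1+1$; $y_1e(\boldsymbol i)=0$ if $i_1\in\{\kappa_1,\dots,\kappa_l\}$; $y_re(\boldsymbol i)=e(\boldsymbol i)y_r$; $\psi_re(\boldsymbol i)=e(s_r\cdot\boldsymbol i)\psi_r$; $y_ry_s=y_sy_r$;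 $\psi_ry_s=y_s\psi_r$ if $s\ne r,r+1$; $\psi_r\psi_s=\psi_s\psi_r$ if $|r-s|>1$; $\psi_ry_{r+1}e(\boldsymbol i)=(y_r\psi_r-\delta_{i_r,i_{r+1}})e(\boldsymbol i)$; $y_{r+1}\psi_re(\boldsymbol i)=(\psi_ry_r-\delta_{i_r,i_{r+1}})e(\boldsymbol i)$; $\psi_r^2e(\boldsymbol i)$ equals $0$ if $i_r=i_{r+1}$, $e(\boldsymbol i)$ if $i_r\ne i_{r+1},i_{r+1}\pm1$, $(y_{r+1}-y_r)e(\boldsymbol i)$ if $i_{r+1}=i_r+1$, $(y_r-y_{r+1})e(\boldsymbol i)$ if $i_{r+1}=i_r-1$; $\psi_r\psi_{r+1}\psi_re(\boldsymbol i)=(\psi_{r+1}\psi_r\psi_{r+1}+\alpha)e(\boldsymbol i)$ with $\alpha=-1$ if $i_{r+2}=i_r=i_{r+1}-1$, $\alpha=1$ if $i_{r+2}=i_r=i_{r+1}+1$, $\alpha=0$ otherwise. The cyclotomic KLR algebra $R_n$ has the same presentation with relation (†) omitted; so $B_n$ is a quotient of $R_n$. $*$ is the anti-involution (of $R_n$ and $B_n$) fixing all generators. $H_n(q,\kappa)$ is the $F$-algebra with generators $L_1,\dots,L_n,T_1,\dots,T_{n-1}$ and relations $(L_1-q^{\kappa_1})\cdots(L_1-q^{\kappa_l})=0$, $(T_r+1)(T_r-q)=0$, $T_sT_{s+1}T_s=T_{s+1}T_sT_{s+1}$, $L_rL_s=L_sL_r$, $T_rL_r=L_{r+1}(T_r-q+1)$,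 $T_rL_s=L_sT_r$ if $s\ne r,r+1$, $T_rT_s=T_sT_r$ if $|r-s|>1$. The isomorphism of $F$-algebras $f:R_n\to H_n(q,\kappa)$ is that of Brundan-Kleshchev and Rouquier: $f(e(\boldsymbol i))$ is the idempotent projecting onto the simultaneous generalized eigenspace of $L_1,\dots,L_n$ with eigenvalues $q^{i_1},\dots,q^{i_n}$, and $f(y_k)f(e(\boldsymbol i))=(1-q^{-i_k}L_k)f(e(\boldsymbol i))$. By Brundan-Kleshchev, $f^{-1}(L_k)=\sum_{\boldsymbol i\in I_e^n}q^{i_k}(1-y_k)e(\boldsymbol i)$, which may be taken as the definition of $\mathcal L_k$. **The set $\mathcal C_n$.** The residue of $(r,1,m)$ is $\mathrm{res}=\kappa_m+1-r\in I_e$; the residue sequence of $\mathfrak t$ is $(\mathrm{res}(\mathfrak t(1)),\dots,\mathrm{res}(\mathfrak t(n)))$, and $\boldsymbol i^\lambda$ is that of $\mathfrak t^\lambda$. For each $w\in S_n$ a reduced expression $w=s_{i_1}\cdots s_{i_N}$ ($s_k=(k,k+1)$) is chosen once and for all and $\psi_w:=\psi_{i_1}\cdots\psi_{i_N}$. For $\mathfrak s,\mathfrak t\in\mathrm{Tab}(\lambda)$, $m_{\mathfrak s\mathfrak t}:=\psi_{d(\mathfrak s)}^*e(\boldsymbol i^\lambda)\psi_{d(\mathfrak t)}\in B_n$, and $\mathcal C_n:=\{m_{\mathfrak s\mathfrak t}:\lambda\in\mathrm{Par}^1_{l,n},\ \mathfrak s,\mathfrak t\in\mathrm{Std}(\lambda)\}$;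 it is a cellular basis of $B_n$ with poset $(\mathrm{Par}^1_{l,n},\unlhd)$. *)

(* Defs.v *)
From HB Require Import structures.
From mathcomp Require Import all_boot all_order all_algebra perm.
From mathcomp Require Import boolp.
Set Implicit Arguments.
Unset Strict Implicit.
Unset Printing Implicit Defensive.
Import GRing.Theory.
Local Open Scope ring_scope.
Local Open Scope quotient_scope.

(* Associative unital algebras over F, as rings with a central homomorphism
   from F. Unlike the library's [algType], this allows 1 = 0: an algebra given
   by a presentation may collapse. *)
Record algebra (F : fieldType) := Algebra {
  alg_ring :> pzRingType;
  scalar : {rmorphism F -> alg_ring};
  scalarC : forall a x, scalar a * x = x * scalar a
}.

Section Converse.
Context {F : fieldType} (A : algebra F).

Definition conv_scalar (a : F) : A^c := scalar A a.

Fact conv_scalar_zmod : zmod_morphism conv_scalar.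
Proof. exact: (rmorphB (scalar A)). Qed.

Fact conv_scalar_monoid : monoid_morphism conv_scalar.
Proof.
split=> [|a b]; first exact: (rmorph1 (scalar A)).
rewrite /conv_scalar mulrC; exact: (rmorphM (scalar A)).
Qed.

HB.instance Definition _ :=
  GRing.isZmodMorphism.Build F A^c conv_scalar conv_scalar_zmod.
HB.instance Definition _ :=
  GRing.isMonoidMorphism.Build F A^c conv_scalar conv_scalar_monoid.

Definition converse_algebra : algebra F :=
  @Algebra F A^c conv_scalar (fun a x => esym (scalarC a (x : A))).
End Converse.

Section Presented.
Context {F : fieldType} {X : Type}.

Inductive term : Type :=
  | TGen of X
  | TScalar of F
  | TOpp of term
  | TAdd of term & term
  | TMul of term & term.

HB.instance Definition _ := gen_eqMixin term.
HB.instance Definition _ := gen_choiceMixin term.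

Fixpoint eval (A : algebra F) (g : X -> A) (t : term) : A :=
  match t with
  | TGen x => g x
  | TScalar a => scalar A a
  | TOpp t => - eval g t
  | TAdd t u => eval g t + eval g u
  | TMul t u => eval g t * eval g u
  end.

(* A system of relations, read for elements of an arbitrary algebra. *)
Definition relations := forall A : algebra F, (X -> A) -> Prop.

(* [presented R] is the F-algebra with generators X and relations R. Two
   expressions in the generators are identified iff their equality follows from
   R, i.e., holds for all elements satisfying R in all algebras. The universal
   property is [lift], [lift_gen], [lift_unique]; that the generators satisfy R
   is proved below for each system of relations in use. *)
Definition consequence (R : relations) (t u : term) : bool :=
  `[< forall (A : algebra F) (g : X -> A), R A g -> eval g t = eval g u >].

Fact consequence_refl R : reflexive (consequence R).
Proof. by move=> t; apply/asboolP. Qed.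

Fact consequence_sym R : symmetric (consequence R).
Proof.
by move=> t u; apply/asboolP/asboolP => H A g Rg; rewrite (H A g).
Qed.

Fact consequence_trans R : transitive (consequence R).
Proof.
move=> u t v /asboolP tu /asboolP uv; apply/asboolP => A g Rg.
by rewrite (tu A g) ?(uv A g).
Qed.

Canonical consequence_equiv R :=
  EquivRel (consequence R) (consequence_refl R) (@consequence_sym R)
    (@consequence_trans R).

Definition presented (R : relations) : Type := {eq_quot consequence_equiv R}.

HB.instance Definition _ R := Choice.on (presented R).

Definition cls R (t : term) : presented R :=
  \pi_{eq_quot consequence_equiv R} t.
Definition rep R (x : presented R) : term :=
  repr (x : {eq_quot consequence_equiv R}).

Fact repK R : cancel (@rep R) (cls R).
Proof. exact: reprK. Qed.

Section Ops.
Variable R : relations.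
Implicit Types x y z : presented R.

Definition gen (s : X) : presented R := cls R (TGen s).

Lemma cls_eqP t u : cls R t = cls R u <->
  (forall (A : algebra F) (g : X -> A), R g -> eval g t = eval g u).
Proof.
split=> [/(@eqquotP _ (consequence_equiv R)) /asboolP // | H].
by apply/(@eqquotP _ (consequence_equiv R))/asboolP.
Qed.

Definition lift (A : algebra F) (g : X -> A) of R g : presented R -> A :=
  fun x => eval g (rep x).

Lemma lift_cls (A : algebra F) (g : X -> A) (h : R g) t :
  lift h (cls R t) = eval g t.
Proof. by apply: (proj1 (cls_eqP _ _)) h; rewrite repK. Qed.

Lemma lift_gen (A : algebra F) (g : X -> A) (h : R g) s :
  lift h (gen s) = g s.
Proof. exact: lift_cls. Qed.

Lemma lift_inj x y :
  (forall (A : algebra F) (g : X -> A) (h : R g), lift h x = lift h y) ->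
  x = y.
Proof.
move=> H; rewrite -[x]repK -[y]repK; apply/cls_eqP => A g h.
by have := H A g h.
Qed.

Definition pscalar a : presented R := cls R (TScalar a).
Definition popp x : presented R := cls R (TOpp (rep x)).
Definition padd x y : presented R := cls R (TAdd (rep x) (rep y)).
Definition pmul x y : presented R := cls R (TMul (rep x) (rep y)).
Definition pscale (a : F) x : presented R := pmul (pscalar a) x.

Fact liftC (A : algebra F) (g : X -> A) (h : R g) a :
  lift h (pscalar a) = scalar A a.
Proof. exact: lift_cls. Qed.
Fact liftN (A : algebra F) (g : X -> A) (h : R g) x :
  lift h (popp x) = - lift h x.
Proof. exact: lift_cls. Qed.
Fact liftD (A : algebra F) (g : X -> A) (h : R g) x y :
  lift h (padd x y) = lift h x + lift h y.
Proof. exact: lift_cls. Qed.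
Fact liftM (A : algebra F) (g : X -> A) (h : R g) x y :
  lift h (pmul x y) = lift h x * lift h y.
Proof. exact: lift_cls. Qed.
Let liftE := (liftC, liftN, liftD, liftM).

Fact paddA : associative padd.
Proof. by move=> x y z; apply: lift_inj => A g h; rewrite !liftE addrA. Qed.
Fact paddC : commutative padd.
Proof. by move=> x y; apply: lift_inj => A g h; rewrite !liftE addrC. Qed.
Fact padd0 : left_id (pscalar 0) padd.
Proof. by move=> x; apply: lift_inj => A g h; rewrite !liftE rmorph0 add0r. Qed.
Fact paddN : left_inverse (pscalar 0) popp padd.
Proof. by move=> x; apply: lift_inj => A g h; rewrite !liftE rmorph0 addNr. Qed.
Fact pmulA : associative pmul.
Proof. by move=> x y z; apply: lift_inj => A g h; rewrite !liftE mulrA. Qed.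
Fact pmul1l : left_id (pscalar 1) pmul.
Proof. by move=> x; apply: lift_inj => A g h; rewrite !liftE rmorph1 mul1r. Qed.
Fact pmul1r : right_id (pscalar 1) pmul.
Proof. by move=> x; apply: lift_inj => A g h; rewrite !liftE rmorph1 mulr1. Qed.
Fact pmulDl : left_distributive pmul padd.
Proof. by move=> x y z; apply: lift_inj => A g h; rewrite !liftE mulrDl. Qed.
Fact pmulDr : right_distributive pmul padd.
Proof. by move=> x y z; apply: lift_inj => A g h; rewrite !liftE mulrDr. Qed.

HB.instance Definition _ := GRing.isPzRing.Build (presented R)
  paddA paddC padd0 paddN pmulA pmul1l pmul1r pmulDl pmulDr.

Fact pscaleA a b x : pscale a (pscale b x) = pscale (a * b) x.
Proof. by apply: lift_inj => A g h; rewrite !liftE rmorphM mulrA. Qed.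
Fact pscale1 : left_id 1 pscale.
Proof. exact: pmul1l. Qed.
Fact pscaleDr : right_distributive pscale +%R.
Proof. by move=> a x y; apply: pmulDr. Qed.
Fact pscaleDl x : {morph pscale^~ x : a b / a + b}.
Proof.
by move=> a b; apply: lift_inj => A g h; rewrite !liftE rmorphD mulrDl.
Qed.

HB.instance Definition _ := GRing.Zmodule_isLmodule.Build F (presented R)
  pscaleA pscale1 pscaleDr pscaleDl.

Lemma pscalerAl (a : F) x y : a *: (x * y) = (a *: x) * y.
Proof. exact: pmulA. Qed.
Lemma pscalerAr (a : F) x y : a *: (x * y) = x * (a *: y).
Proof.
by apply: lift_inj => A g h; rewrite !liftE !mulrA (scalarC a (lift h x)).
Qed.

Fact pscalar_zmod : zmod_morphism pscalar.
Proof.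
by move=> a b; apply: lift_inj => A g h; rewrite !liftE rmorphB.
Qed.
Fact pscalar_monoid : monoid_morphism pscalar.
Proof.
by split=> // a b; apply: lift_inj => A g h; rewrite !liftE rmorphM.
Qed.
HB.instance Definition _ :=
  GRing.isZmodMorphism.Build F (presented R) pscalar pscalar_zmod.
HB.instance Definition _ :=
  GRing.isMonoidMorphism.Build F (presented R) pscalar pscalar_monoid.

Fact pscalarC a x : pscalar a * x = x * pscalar a.
Proof. by apply: lift_inj => A g h; rewrite !liftE (scalarC a (lift h x)). Qed.

Definition presented_algebra : algebra F := @Algebra F (presented R) pscalar pscalarC.

Section Lift.
Variables (A : algebra F) (g : X -> A) (h : R g).

Fact lift_zmod : zmod_morphism (lift h).
Proof. by move=> x y; rewrite !liftE. Qed.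
Fact lift_monoid : monoid_morphism (lift h).
Proof. by split=> [|x y]; rewrite liftE ?rmorph1. Qed.

HB.instance Definition _ :=
  GRing.isZmodMorphism.Build (presented R) A (lift h) lift_zmod.
HB.instance Definition _ :=
  GRing.isMonoidMorphism.Build (presented R) A (lift h) lift_monoid.

Lemma lift_scale a x : lift h (a *: x) = scalar A a * lift h x.
Proof. by rewrite liftE liftC. Qed.

Lemma lift_unique (f : {rmorphism presented R -> A}) :
  (forall a x, f (a *: x) = scalar A a * f x) -> (forall s, f (gen s) = g s) ->
  f =1 lift h.
Proof.
move=> fZ fg x; rewrite -[x]repK lift_cls; 
elim: (rep x) => [s|a|t IH|t IHt u IHu|t IHt u IHu] /=.
- exact: fg.
- rewrite -[RHS]mulr1 -(rmorph1 f) -fZ; congr (f _).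
  exact/esym/pmul1r.
- rewrite -IH -rmorphN; congr (f _).
  by apply: lift_inj => A' g' h'; rewrite liftN !lift_cls.
- rewrite -IHt -IHu -rmorphD; congr (f _).
  by apply: lift_inj => A' g' h'; rewrite liftD !lift_cls.
- rewrite -IHt -IHu -rmorphM; congr (f _).
  by apply: lift_inj => A' g' h'; rewrite liftM !lift_cls.
Qed.

End Lift.
End Ops.
End Presented.

(* The r-th simple transposition exchanges [lo r] and [hi r]. All index sets
   {1,...,n}, {1,...,l} are shifted to start at 0. *)
Section SimpleTranspositions.
Context {n : nat}.

Definition lo (r : 'I_n.-1) : 'I_n := widen_ord (leq_pred n) r.

Fact hi_subproof (r : 'I_n.-1) : (r.+1 < n)%N.
Proof. by rewrite -ltn_predRL. Qed.

Definition hi (r : 'I_n.-1) : 'I_n := Ordinal (hi_subproof r).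

(* [word_perm [:: r1; ...; rN]] is the composite s_r1 \o ... \o s_rN: products
   in S_n are composites of functions (S_n acts on tableaux by t w = t \o w),
   which is the reverse of the library's product of permutations. *)
Definition word_perm (rs : seq 'I_n.-1) : {perm 'I_n} :=
  foldr (fun r w => w * tperm (lo r) (hi r))%g 1%g rs.

Definition reduced_expression (w : {perm 'I_n}) (rs : seq 'I_n.-1) : Prop :=
  word_perm rs = w /\
  forall rs', word_perm rs' = w -> (size rs <= size rs')%N.

End SimpleTranspositions.

Definition resseq (e n : nat) : Type := {ffun 'I_n -> 'Z_e}.
HB.instance Definition _ e n := Finite.on (resseq e n).

Definition swap e n (r : 'I_n.-1) (i : resseq e n) : resseq e n :=
  [ffun k => i (tperm (lo r) (hi r) k)].

Inductive klr_gen (e n : nat) :=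
  | GenPsi of 'I_n.-1
  | GenY of 'I_n
  | GenE of resseq e n.
Arguments GenPsi {e n}.
Arguments GenY {e n}.
Arguments GenE {e n}.

Section Relations.
Context {F : fieldType} {e l n : nat} (kap : 'I_l -> 'Z_e).
Variables (A : algebra F) (g : klr_gen e n -> A).
Implicit Types (i j : resseq e n) (k m : 'I_n) (r s : 'I_n.-1).
Local Notation psi r := (g (GenPsi r)).
Local Notation y k := (g (GenY k)).
Local Notation idem i := (g (GenE i)).

(* r' = r + 1, so that r, r + 1, r + 2 are [lo r], [hi r], [hi r']. *)
Definition braid_error (r r' : 'I_n.-1) (i : resseq e n) : A :=
  if (i (hi r') == i (lo r)) && (i (lo r) == i (hi r) - 1) then - 1
  else if (i (hi r') == i (lo r)) && (i (lo r) == i (hi r) + 1) then 1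
  else 0.

Record klr_relations : Prop := KlrRelations {
  klr_idem i j : idem i * idem j = if i == j then idem i else 0;
  klr_sum1 : \sum_i idem i = 1;
  klr_first i (k : 'I_n) : k = 0 :> nat ->
    i k \notin codom kap -> idem i = 0;
  klr_y_first i (k : 'I_n) : k = 0 :> nat ->
    i k \in codom kap -> y k * idem i = 0;
  klr_y_e k i : y k * idem i = idem i * y k;
  klr_psi_e r i : psi r * idem i = idem (swap r i) * psi r;
  klr_y_y k m : y k * y m = y m * y k;
  klr_psi_y r k : k != lo r -> k != hi r -> psi r * y k = y k * psi r;
  klr_psi_psi (r s : 'I_n.-1) : (r.+1 < s)%N || (s.+1 < r)%N ->
    psi r * psi s = psi s * psi r;
  klr_psi_yhi r i : psi r * y (hi r) * idem i =
    (y (lo r) * psi r - (i (lo r) == i (hi r))%:R) * idem i;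
  klr_yhi_psi r i : y (hi r) * psi r * idem i =
    (psi r * y (lo r) - (i (lo r) == i (hi r))%:R) * idem i;
  klr_quad_eq r i : i (lo r) = i (hi r) -> psi r ^+ 2 * idem i = 0;
  klr_quad_far r i : i (lo r) != i (hi r) -> i (lo r) != i (hi r) + 1 ->
    i (lo r) != i (hi r) - 1 -> psi r ^+ 2 * idem i = idem i;
  klr_quad_up r i : i (hi r) = i (lo r) + 1 ->
    psi r ^+ 2 * idem i = (y (hi r) - y (lo r)) * idem i;
  klr_quad_down r i : i (hi r) = i (lo r) - 1 ->
    psi r ^+ 2 * idem i = (y (lo r) - y (hi r)) * idem i;
  klr_braid (r r' : 'I_n.-1) i : r' = r.+1 :> nat ->
    psi r * psi r' * psi r * idem i =
    (psi r' * psi r * psi r' + braid_error r r' i) * idem i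
}.

Record blob_relations : Prop := BlobRelations {
  blob_klr : klr_relations;
  blob_dagger i (k k' : 'I_n) : k = 0 :> nat -> k' = 1 :> nat ->
    i k \in codom kap -> i k' = i k + 1 -> idem i = 0
}.

End Relations.

Section SwapTheory.
Context {e n : nat}.
Implicit Types (i : resseq e n) (r : 'I_n.-1).

Lemma lo_neq_hi r : lo r != hi r.
Proof. by rewrite -val_eqE /= neq_ltn ltnSn. Qed.

Lemma swapK r : involutive (@swap e n r).
Proof. by move=> i; apply/ffunP => k; rewrite !ffunE tpermK. Qed.

Lemma swap_lo r i : swap r i (lo r) = i (hi r).
Proof. by rewrite ffunE tpermL. Qed.

Lemma swap_hi r i : swap r i (hi r) = i (lo r).
Proof. by rewrite ffunE tpermR. Qed.

Lemma swap_id r i : i (lo r) = i (hi r) -> swap r i = i.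
Proof.
move=> eq_i; apply/ffunP => k; rewrite ffunE.
by case: tpermP => // ->.
Qed.

Lemma lo_succ r r' : r' = r.+1 :> nat -> lo r' = hi r.
Proof. by move=> eq_r; apply: val_inj. Qed.

Lemma tperm3 (T : finType) (a b c k : T) : a != b -> b != c -> a != c ->
  tperm a b (tperm b c (tperm a b k)) = tperm a c k.
Proof.
move=> ab bc ac; have [->|ka] := eqVneq k a.
  by rewrite !tpermL tpermD.
have [->|kb] := eqVneq k b.
  by rewrite tpermR (@tpermD _ b c a) 1?eq_sym // tpermL tpermD // eq_sym.
have [->|kc] := eqVneq k c.
  by rewrite (@tpermD _ a b c) // !tpermR.
by rewrite !(tpermD, eq_sym _ k).
Qed.

Lemma swap3 r r' i : r' = r.+1 :> nat ->
  swap r (swap r' (swap r i)) = [ffun k => i (tperm (lo r) (hi r') k)].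
Proof.
move=> eq_r; apply/ffunP => k; rewrite !ffunE (lo_succ eq_r) tperm3 //.
- exact: lo_neq_hi.
- by rewrite -(lo_succ eq_r) lo_neq_hi.
- by rewrite -val_eqE /= eq_r neq_ltn ltnS leqnSn.
Qed.

Lemma swap3' r r' i : r' = r.+1 :> nat ->
  swap r' (swap r (swap r' i)) = [ffun k => i (tperm (lo r) (hi r') k)].
Proof.
move=> eq_r; apply/ffunP => k; rewrite !ffunE (lo_succ eq_r).
rewrite (tpermC (lo r) (hi r)) (tpermC (hi r) (hi r')) tperm3 1?tpermC //.
- by rewrite -(lo_succ eq_r) eq_sym lo_neq_hi.
- by rewrite eq_sym lo_neq_hi.
- by rewrite -val_eqE /= eq_r neq_ltn ltnS leqnSn orbT.
Qed.

End SwapTheory.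

Section Algebras.
Variables (F : fieldType) (e l n : nat) (kap : 'I_l -> 'Z_e).

Section Converse.
Variables (A : algebra F) (g : klr_gen e n -> A) (K : klr_relations kap g).

Fact idem_psi r i : g (GenE i) * g (GenPsi r) = g (GenPsi r) * g (GenE (swap r i)).
Proof. by rewrite (klr_psi_e K) swapK. Qed.

Fact idem_psi2 r i : g (GenE i) * (g (GenPsi r) ^+ 2) = g (GenPsi r) ^+ 2 * g (GenE i).
Proof. by rewrite expr2 mulrA idem_psi -mulrA idem_psi swapK mulrA. Qed.

Lemma klr_converse : klr_relations kap (A := converse_algebra A) g.
Proof.
split.
- move=> i j; change (g (GenE j) * g (GenE i) = if i == j then g (GenE i) else 0).
  by rewrite (klr_idem K) eq_sym; case: eqP => // ->.
- exact: (klr_sum1 K).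
- exact: (klr_first K).
- move=> i k k0 ik; change (g (GenE i) * g (GenY k) = 0).
  by rewrite -(klr_y_e K) (klr_y_first K).
- by move=> k i; apply/esym/(klr_y_e K).
- by move=> r i; exact: idem_psi.
- by move=> k m; apply/esym/(klr_y_y K).
- by move=> r k kl kh; apply/esym/(klr_psi_y K).
- by move=> r s rs; apply/esym/(klr_psi_psi K).
- move=> r i.
  change (g (GenE i) * (g (GenY (hi r)) * g (GenPsi r)) =
    g (GenE i) * (g (GenPsi r) * g (GenY (lo r)) - (i (lo r) == i (hi r))%:R)).
  rewrite mulrA -(klr_y_e K) -mulrA idem_psi mulrA (klr_yhi_psi K) swap_lo swap_hi.
  rewrite mulrBl mulrBr [in RHS]mulrA idem_psi -!mulrA (klr_y_e K).
  rewrite [in LHS]eq_sym; case: eqP => [eq_i|_]; last by rewrite mulr0 mul0r.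
  by rewrite swap_id // mul1r mulr1.
- move=> r i.
  change (g (GenE i) * (g (GenPsi r) * g (GenY (hi r))) =
    g (GenE i) * (g (GenY (lo r)) * g (GenPsi r) - (i (lo r) == i (hi r))%:R)).
  rewrite mulrA idem_psi -mulrA -(klr_y_e K) mulrA (klr_psi_yhi K) swap_lo swap_hi.
  rewrite mulrBl mulrBr [in RHS]mulrA -(klr_y_e K) -!mulrA idem_psi.
  rewrite [in LHS]eq_sym; case: eqP => [eq_i|_]; last by rewrite mulr0 mul0r.
  by rewrite swap_id // mul1r mulr1.
- move=> r i eq_i; rewrite -[LHS]/(g (GenE i) * (g (GenPsi r) ^+ 2)) idem_psi2.
  exact: (klr_quad_eq K).
- move=> r i n0 n1 n2; rewrite -[LHS]/(g (GenE i) * (g (GenPsi r) ^+ 2)) idem_psi2.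
  exact: (klr_quad_far K).
- move=> r i eq_i; rewrite -[LHS]/(g (GenE i) * (g (GenPsi r) ^+ 2)) idem_psi2.
  rewrite -[RHS]/(g (GenE i) * (g (GenY (hi r)) - g (GenY (lo r)))).
  by rewrite mulrBr -!(klr_y_e K) -mulrBl (klr_quad_up K).
- move=> r i eq_i; rewrite -[LHS]/(g (GenE i) * (g (GenPsi r) ^+ 2)) idem_psi2.
  rewrite -[RHS]/(g (GenE i) * (g (GenY (lo r)) - g (GenY (hi r)))).
  by rewrite mulrBr -!(klr_y_e K) -mulrBl (klr_quad_down K).
- move=> r r' i eq_r.
  change (g (GenE i) * (g (GenPsi r) * (g (GenPsi r') * g (GenPsi r))) = g (GenE i) *
   (g (GenPsi r') * (g (GenPsi r) * g (GenPsi r')) + braid_error A r r' i)).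
  rewrite mulrDr !mulrA !idem_psi -!(mulrA _ (g (GenE _))) !idem_psi.
  rewrite !mulrA -!(mulrA _ (g (GenE _))) !idem_psi !mulrA.
  rewrite swap3 // swap3' // (klr_braid K) // mulrDl; congr (_ + _).
  rewrite /braid_error !ffunE tpermL tpermR tpermD //; first last.
  - by rewrite -(lo_succ eq_r) eq_sym lo_neq_hi.
  - by rewrite lo_neq_hi.
  rewrite ![i (lo r) == i (hi r')]eq_sym.
  case: (eqVneq (i (hi r')) (i (lo r))) => [eq_i|_] /=; last by rewrite mul0r mulr0.
  rewrite eq_i (_ : [ffun _ => _] = i); last first.
    by apply/ffunP => k; rewrite ffunE; case: tpermP => // ->.
  by case: ifP => _; [|case: ifP => _]; rewrite ?mulrN1 ?mulN1r ?mul1r ?mulr1 ?mul0r ?mulr0.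
Qed.
End Converse.

Lemma blob_converse (A : algebra F) (g : klr_gen e n -> A) :
  blob_relations kap g -> blob_relations kap (A := converse_algebra A) g.
Proof. by case=> K dagger; split=> //; exact: klr_converse. Qed.

Lemma klr_presented (R : @relations F (klr_gen e n)) :
  (forall (A : algebra F) (g : klr_gen e n -> A), R A g ->
    klr_relations kap g) ->
  klr_relations kap (A := presented_algebra R) (gen R).
Proof.
move=> RK.
have Lnat (A : algebra F) g (h : R A g) (b : bool) : lift h b%:R = b%:R.
  by case: b; rewrite ?rmorph0 ?rmorph1.
have Lbraid (A : algebra F) g (h : R A g) r r' i :
    lift h (@braid_error F e n (presented_algebra R) r r' i) =
    @braid_error F e n A r r' i.
  rewrite /braid_error; case: ifP => _; [|case: ifP => _];
    by rewrite ?liftN ?rmorph0 ?rmorph1.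
split=> *; apply: lift_inj => A g h; have K := RK A g h;
  rewrite ?(liftM, liftD, liftN, Lnat, Lbraid, lift_gen) ?rmorph0 /=.
- by rewrite (klr_idem K); case: eqP; rewrite ?lift_gen ?rmorph0.
- rewrite rmorph_sum rmorph1 -(klr_sum1 K).
  by apply: eq_bigr => i _; exact: lift_gen.
- by eapply (klr_first K); eassumption.
- by eapply (klr_y_first K); eassumption.
- exact: (klr_y_e K).
- exact: (klr_psi_e K).
- exact: (klr_y_y K).
- by eapply (klr_psi_y K); eassumption.
- by eapply (klr_psi_psi K); eassumption.
- exact: (klr_psi_yhi K).
- exact: (klr_yhi_psi K).
- by eapply (klr_quad_eq K); eassumption.
- by eapply (klr_quad_far K); eassumption.
- by eapply (klr_quad_up K); eassumption.
- by eapply (klr_quad_down K); eassumption.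
- by eapply (klr_braid K); eassumption.
Qed.


Definition cycKLR_algebra : algebra F :=
  presented_algebra (@klr_relations F e l n kap).
Definition blob_algebra : algebra F :=
  presented_algebra (@blob_relations F e l n kap).

Definition cycKLR : Type := presented (@klr_relations F e l n kap).
Definition blob : Type := presented (@blob_relations F e l n kap).

HB.instance Definition _ := GRing.PzRing.on cycKLR.
HB.instance Definition _ := GRing.Lmodule.on cycKLR.
HB.instance Definition _ := GRing.PzRing.on blob.
HB.instance Definition _ := GRing.Lmodule.on blob.

Definition rgen (s : klr_gen e n) : cycKLR := gen _ s.
Definition bgen (s : klr_gen e n) : blob := gen _ s.

Lemma cycKLR_relations : klr_relations kap (A := cycKLR_algebra) rgen.
Proof. exact: klr_presented. Qed.

Lemma blob_relationsP : blob_relations kap (A := blob_algebra) bgen.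
Proof.
split; first by apply: klr_presented => A g; exact: blob_klr.
move=> i k k' k0 k'1 ik ik'; apply: lift_inj => A g h.
by rewrite lift_gen rmorph0; exact: (blob_dagger h) ik'.
Qed.

Definition to_blob : cycKLR -> blob :=
  lift (R := @klr_relations F e l n kap) (A := blob_algebra) (g := bgen)
    (blob_klr blob_relationsP).

Lemma to_blob_gen s : to_blob (rgen s) = bgen s.
Proof. exact: (lift_gen (R := @klr_relations F e l n kap) (A := blob_algebra)). Qed.

(* The anti-involution fixing the generators: a homomorphism from the algebra
   to its converse. *)
Definition star : blob -> blob :=
  lift (R := @blob_relations F e l n kap) (A := converse_algebra blob_algebra)
    (g := bgen) (blob_converse blob_relationsP).

Lemma star_gen s : star (bgen s) = bgen s.
Proof.
exact: (lift_gen (R := @blob_relations F e l n kap)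
  (A := converse_algebra blob_algebra)).
Qed.

Lemma starD x y : star (x + y) = star x + star y.
Proof.
exact: (liftD (R := @blob_relations F e l n kap)
  (A := converse_algebra blob_algebra)).
Qed.

Lemma starM x y : star (x * y) = star y * star x.
Proof.
exact: (liftM (R := @blob_relations F e l n kap)
  (A := converse_algebra blob_algebra)).
Qed.

Lemma starN x : star (- x) = - star x.
Proof.
exact: (liftN (R := @blob_relations F e l n kap)
  (A := converse_algebra blob_algebra)).
Qed.

Lemma starZ (a : F) x : star (a *: x) = a *: star x.
Proof.
have -> : star (a *: x) = star x * pscalar _ a 
  by exact: (lift_scale (R := @blob_relations F e l n kap)
  (A := converse_algebra blob_algebra)).
exact/esym/pscalarC.
Qed.

Lemma starK : involutive star.
Proof.
move=> x; rewrite -[x]repK; elim: (rep x) => [s|a|t IH|t IHt u IHu|t IHt u IHu].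
- exact: (etrans (congr1 star (star_gen s)) (star_gen s)).
- have starC : star (pscalar _ a) = pscalar _ a 
    by exact: (liftC (R := @blob_relations F e l n kap)
  (A := converse_algebra blob_algebra)).
  exact: (etrans (congr1 star starC) starC).
- have <- : - cls _ t = cls _ (TOpp t) :> blob.
    by apply: lift_inj => A g h; rewrite liftN !lift_cls.
  by rewrite !starN IH.
- have <- : cls _ t + cls _ u = cls _ (TAdd t u) :> blob.
    by apply: lift_inj => A g h; rewrite liftD !lift_cls.
  by rewrite !starD IHt IHu.
- have <- : cls _ t * cls _ u = cls _ (TMul t u) :> blob.
    by apply: lift_inj => A g h; rewrite liftM !lift_cls.
  by rewrite !starM IHt IHu.
Qed.

End Algebras.

Inductive hecke_gen (n : nat) :=
  | HeckeL of 'I_n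
  | HeckeT of 'I_n.-1.
Arguments HeckeL {n}.
Arguments HeckeT {n}.

Section Hecke.
Context {F : fieldType} {e l : nat} (n : nat) (q : F) (kap : 'I_l -> 'Z_e).

Section Relations.
Variables (A : algebra F) (g : hecke_gen n -> A).
Local Notation jm k := (g (HeckeL k)).
Local Notation t r := (g (HeckeT r)).

Record hecke_relations : Prop := HeckeRelations {
  hecke_cyclotomic (k : 'I_n) : k = 0 :> nat ->
    \prod_m (jm k - scalar A (q ^+ kap m)) = 0;
  hecke_quad r : (t r + 1) * (t r - scalar A q) = 0;
  hecke_braid (r r' : 'I_n.-1) : r' = r.+1 :> nat ->
    t r * t r' * t r = t r' * t r * t r';
  hecke_l_l k m : jm k * jm m = jm m * jm k;
  hecke_t_l r : t r * jm (lo r) = jm (hi r) * (t r - scalar A q + 1);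
  hecke_t_l_far r k : k != lo r -> k != hi r -> t r * jm k = jm k * t r;
  hecke_t_t (r s : 'I_n.-1) : (r.+1 < s)%N || (s.+1 < r)%N ->
    t r * t s = t s * t r
}.

End Relations.

Definition hecke_algebra : algebra F := presented_algebra hecke_relations.
Definition hecke : Type := presented hecke_relations.
HB.instance Definition _ := GRing.PzRing.on hecke.
HB.instance Definition _ := GRing.Lmodule.on hecke.

Definition hgen (s : hecke_gen n) : hecke := gen _ s.

Lemma hecke_relationsP : hecke_relations (A := hecke_algebra) hgen.
Proof.
split=> *; apply: lift_inj => A g h; have K := h;
  rewrite ?(liftM, liftD, liftN, liftC, lift_gen) ?rmorph0 ?rmorph1 /=.
- rewrite rmorph_prod; eapply etrans; last first.
    by eapply (hecke_cyclotomic K); eassumption.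
  apply: eq_bigr => m _; apply: (etrans (liftD h _ _)).
  by rewrite liftN liftC lift_gen.
- exact: (hecke_quad K).
- by eapply (hecke_braid K); eassumption.
- exact: (hecke_l_l K).
- exact: (hecke_t_l K).
- by eapply (hecke_t_l_far K); eassumption.
- by eapply (hecke_t_t K); eassumption.
Qed.

(* The isomorphism of Brundan-Kleshchev and Rouquier. The f (e(i)) are
   orthogonal idempotents with sum 1, so [BK_idem] makes f (e(i)) the projection
   onto the simultaneous generalized eigenspace along the other eigenspaces; it is
   stated for left multiplication on the algebra. *)
Record BK_isomorphism (f : {rmorphism cycKLR F n kap -> hecke}) : Prop := {
  BK_scalable : scalable f;
  BK_bijective : bijective f;
  BK_idem (i : resseq e n) (x : hecke) : f (rgen F kap (GenE i)) * x = x <->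
    exists N : nat, forall k : 'I_n,
      (hgen (HeckeL k) - scalar hecke_algebra (q ^+ i k)) ^+ N * x = 0;
  BK_y (k : 'I_n) (i : resseq e n) :
    f (rgen F kap (GenY k)) * f (rgen F kap (GenE i)) =
    (1 - (q ^- i k) *: hgen (HeckeL k)) * f (rgen F kap (GenE i))
}.

(* The preimage of the Jucys-Murphy element L_k under the isomorphism, in closed
   form: [BK_y] gives L_k f(e(i)) = q^{i_k} (1 - f(y_k)) f(e(i)), to be summed
   over i. *)
Definition calL (k : 'I_n) : cycKLR F n kap :=
  \sum_(i : resseq e n) (q ^+ i k) *: ((1 - rgen F kap (GenY k)) * rgen F kap (GenE i)).

End Hecke.

Section Combinatorics.
Variables (l n : nat).

(* The node (r, 1, m) is encoded as (r - 1, m). [box] contains the nodes in the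
   first n rows, hence all diagrams of multipartitions of n. *)
Definition node : Type := nat * 'I_l.
Definition box : Type := 'I_n * 'I_l.
HB.instance Definition _ := Finite.on box.

Definition node_of (g : box) : node := (nat_of_ord g.1, g.2).

Definition node_lt (g g' : node) : bool :=
  (g'.1 < g.1)%N || (g.1 == g'.1) && (g'.2 < g.2)%N.

Definition set_le (A B : {set box}) : Prop := forall g0 : node,
  (#|[set g in A | node_lt g0 (node_of g)]| <=
   #|[set g in B | node_lt g0 (node_of g)]|)%N.

(* a_m <= n is implied by the condition on the sum *)
Definition par : Type :=
  {a : {ffun 'I_l -> 'I_n.+1} | (\sum_m a m == n)%N}.
HB.instance Definition _ := Finite.on par.

Definition diagram (lam : par) : {set box} :=
  [set g : box | (g.1 < val lam g.2)%N].

Definition par_le (lam mu : par) : Prop := set_le (diagram lam) (diagram mu).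
Definition par_lt (lam mu : par) : Prop := par_le lam mu /\ lam <> mu.

Definition tableau : Type := {ffun 'I_n -> box}.
HB.instance Definition _ := Finite.on tableau.

Definition Tab (lam : par) : {set tableau} :=
  [set t : tableau | injectiveb t && (t @: setT == diagram lam)].

Definition Std (lam : par) : {set tableau} :=
  [set t in Tab lam | [forall i : 'I_n, forall j : 'I_n,
    ((t i).2 == (t j).2) && ((t i).1 < (t j).1)%N ==> (i < j)%N]].

(* t({1,...,k}) *)
Definition initial_part (t : tableau) (k : nat) : {set box} :=
  [set t i | i : 'I_n & (i < k)%N].

Definition tab_le (s t : tableau) : Prop :=
  forall k : nat, set_le (initial_part s k) (initial_part t k).
Definition tab_lt (s t : tableau) : Prop := tab_le s t /\ s <> t.

Lemma card_diagram lam : #|diagram lam| = n.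
Proof.
rewrite -sum1_card -[RHS](eqP (valP lam)).
rewrite (eq_bigl (fun g : box => (g.1 < val lam g.2)%N)); last first.
  by move=> g; rewrite inE.
rewrite -(pair_big_dep xpredT
  (fun (r : 'I_n) (m : 'I_l) => (r < val lam m)%N) (fun _ _ => 1%N)) /=.
rewrite (exchange_big_dep xpredT) //=; apply: eq_bigr => m _.
by rewrite (big_ord_narrow (leq_ord (val lam m))) sum1_card card_ord.
Qed.

Definition node_seq (lam : par) : seq box :=
  sort (fun g g' => (g == g') || node_lt (node_of g') (node_of g))
    (enum (diagram lam)).

Fact size_node_seq lam : size (node_seq lam) == n.
Proof. by rewrite size_sort -cardE card_diagram. Qed.

(* The tableau t^lambda. *)
Definition initial_tab (lam : par) : tableau :=
  [ffun k => tnth (Tuple (size_node_seq lam)) k].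

Lemma node_seq_uniq lam : uniq (node_seq lam).
Proof. by rewrite sort_uniq enum_uniq. Qed.

Lemma initial_tabE lam g0 k : initial_tab lam k = nth g0 (node_seq lam) k.
Proof. by rewrite ffunE (tnth_nth g0). Qed.

Lemma initial_tab_Tab lam : initial_tab lam \in Tab lam.
Proof.
have sz := eqP (size_node_seq lam).
have inj : injective (initial_tab lam).
  move=> i j; have [g0 _] : exists g0 : box, True by exists (initial_tab lam i).
  rewrite !(initial_tabE _ g0) => /eqP.
  by rewrite nth_uniq ?sz ?node_seq_uniq // => /eqP /val_inj.
rewrite inE; apply/andP; split; first exact/injectiveP.
rewrite eqEcard card_diagram card_imset // cardsT card_ord leqnn andbT.
apply/subsetP => _ /imsetP[k _ ->].
rewrite ffunE; have := mem_tnth k (Tuple (size_node_seq lam)).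
by rewrite /= mem_sort mem_enum.
Qed.

Lemma initial_tab_decr lam (i j : 'I_n) : (i < j)%N ->
  node_lt (node_of (initial_tab lam j)) (node_of (initial_tab lam i)).
Proof.
move=> ij; set le := fun g g' => (g == g') || node_lt (node_of g') (node_of g).
have sz := eqP (size_node_seq lam).
have lt_total (g g' : box) : g != g' ->
    node_lt (node_of g) (node_of g') || node_lt (node_of g') (node_of g).
  case: g g' => [r m] [r' m']; rewrite /node_lt /= xpair_eqE -!val_eqE /=.
  by case: (ltngtP r r') => //=; case: (ltngtP m m').
have le_total : total le.
  move=> g g'; rewrite /le; case: eqVneq => //= ne.
  by rewrite orbC lt_total.
have le_trans : transitive le.
  move=> g2 g1 g3; rewrite /le; case: eqVneq => [->|_] //= h12.
  case: eqVneq => [<-|_] /=; first by rewrite h12 orbT.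
  move: h12; rewrite /node_lt /node_of /= => h12 h23; apply/orP; right.
  case/orP: h12 => [h12|/andP[/eqP e12 h12]];
    case/orP: h23 => [h23|/andP[/eqP e23 h23]].
  - by rewrite (ltn_trans h12 h23).
  - by rewrite e23 h12.
  - by rewrite -e12 h23.
  - by rewrite e23 e12 eqxx (ltn_trans h12 h23) orbT.
have srt := sort_sorted le_total (enum (diagram lam)).
have [g0 _] : exists g0 : box, True by exists (initial_tab lam i).
rewrite !(initial_tabE _ g0); have := sorted_ltn_nth le_trans g0 srt.
move=> /(_ i j); rewrite !inE !size_sort -cardE card_diagram !ltn_ord.
move=> /(_ isT isT ij) /orP[|//].
by rewrite nth_uniq ?sz ?node_seq_uniq // => /eqP ji; rewrite ji ltnn in ij.
Qed.

(* The permutation d(t) with t = t^lambda \o d(t); see [dpermP]. *)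
Definition dperm (lam : par) (t : tableau) : {perm 'I_n} :=
  odflt 1%g [pick w : {perm 'I_n} | [forall k, t k == initial_tab lam (w k)]].

Lemma dpermP lam t k : t \in Tab lam -> t k = initial_tab lam (dperm lam t k).
Proof.
move=> tT; rewrite /dperm; case: pickP => [w /forallP /(_ k) /eqP // | none].
have := initial_tab_Tab lam; move: tT; rewrite !inE.
move=> /andP[/injectiveP t_inj /eqP t_im] /andP[_ /eqP i_im].
have ex j : exists m, t j == initial_tab lam m.
  have : t j \in initial_tab lam @: setT by rewrite i_im -t_im imset_f.
  by case/imsetP => m _ ->; exists m.
pose w j := xchoose (ex j).
have wE j : t j = initial_tab lam (w j) by apply/eqP/(xchooseP (ex j)).
have w_inj : injective w.
  by move=> i j eq_w; apply: t_inj; rewrite !wE eq_w.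
have := none (perm w_inj); case/forallP => j.
by rewrite permE -wE.
Qed.

End Combinatorics.

Section Residues.
Context {e l n : nat} (kap : 'I_l -> 'Z_e).

Definition res (g : box l n) : 'Z_e := kap g.2 + 1 - (g.1.+1)%:R.

Definition res_seq (t : tableau l n) : resseq e n := [ffun k => res (t k)].

End Residues.

Definition charge (e l : nat) (khat : 'I_l -> int) (m : 'I_l) : 'Z_e :=
  (khat m)%:~R.

Record strongly_adjacency_free (e l n : nat) (khat : 'I_l -> int) : Prop := {
  saf_gap (m m' : 'I_l) : m' = m.+1 :> nat -> n%:Z <= khat m' - khat m;
  saf_far (m m' : 'I_l) : m != m' ->
    charge e khat m - charge e khat m' \notin [:: 0; 1; -1];
  saf_ends (m m' : 'I_l) : m = 0 :> nat -> m'.+1 = l ->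
    charge e khat m != charge e khat m' + 2;
  saf_incr (m m' : 'I_l) : (m < m')%N ->
    (charge e khat m < charge e khat m')%N
}.

Section CellularBasis.
Context {F : fieldType} {e l n : nat} (kap : 'I_l -> 'Z_e).
Variable red : {perm 'I_n} -> seq 'I_n.-1.

Definition psi_perm (w : {perm 'I_n}) : blob F n kap :=
  \prod_(r <- red w) bgen F kap (GenPsi r).

Definition mst (lam : par l n) (s t : tableau l n) : blob F n kap :=
  star (psi_perm (dperm lam s)) *
  bgen F kap (GenE (res_seq kap (initial_tab lam))) *
  psi_perm (dperm lam t).

(* Membership in the span B^lam of the m_ab of shapes mu strictly above lam. *)
Definition in_span_above (lam : par l n) (x : blob F n kap) : Prop :=
  exists c : par l n -> tableau l n -> tableau l n -> F,
    x = \sum_(mu | `[< par_lt lam mu >])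
          \sum_(a in Std mu) \sum_(b in Std mu) c mu a b *: mst mu a b.

End CellularBasis.

Arguments mst {F e l n} kap red lam s t.
Arguments in_span_above {F e l n} kap red lam x.

(* Main.v *)
Require Import Defs.
From mathcomp Require Import all_boot all_order all_algebra perm.
From mathcomp Require Import boolp zify.
Set Implicit Arguments.
Unset Strict Implicit.
Unset Printing Implicit Defensive.
Import GRing.Theory.
Local Open Scope ring_scope.

(** As m_st = m_st e(i) for the residue sequence i of t, multiplying m_st by the
    k-th Jucys-Murphy element gives q^res(t(k)) (m_st - m_st y_k). So the
    triangularity says that m_st y_k is, modulo the span of the m_ab of shapes
    strictly above lambda, a combination of m_sv with v strictly above t.
    Commutativity and invariance under the anti-involution are read off the
    relations. The elements y_k are called dots below.

    Three facts give the triangularity.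

    1. The span I of the m_ab of shapes strictly above lambda is a two-sided
       ideal [above_ideal]. This goes by induction from the top of the dominance
       order: the anti-involution reduces it to right multiplication, and modulo
       the strictly higher shapes the span of the m_st with s fixed is stable
       under right multiplication [spanned_mulr].

    2. Modulo I, dots annihilate e(i^lambda) [dot_in_ideal], and
       e(i^lambda) psi_w for an arbitrary word w is a combination of the
       e(i^lambda) psi_d(v) with v standard and d(v) the product of a subword of
       w [spanned_word]. Moving y_k to the left through psi_d(t) therefore leaves
       only words with a letter of the reduced word of d(t) deleted, and deleting
       letters from a reduced word moves the tableau up: this is the comparison of
       the Bruhat order with dominance [tab_le_subproduct].

    3. Both parts of 2. rest on [swapped_in_ideal]. Arrange the nodes of lambda so
       that a node b comes immediately before the node a just above it in its
       column, where the nodes before this pair precede b and are in reading order,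
       and so are the nodes from a on; then the idempotent of the resulting residue
       sequence lies in I. For a nonstandard tableau some rearrangement of this
       kind occurs along a reduced word of its permutation [nonstandard_in_ideal];
       for dots, the relation psi^2 e = (y - y') e turns a dot on b into a dot
       on a.

    The third fact is combinatorial. A node in row r and column m, counted from
    0, is encoded by the number (r + 1) l + m, so that the reading order is the
    order of numbers, moving down a column adds l, and the codes smaller than l
    form a virtual row above the diagram. Strong adjacency-freeness implies that
    two codes at distance less than l have residues that are neither equal nor
    adjacent [code_res_far], so that strands with such residues cross freely. The
    residue sequences whose idempotent lies in a given ideal are closed under a few
    local moves [in_ideal_closed]. Any set of sequences closed under these moves
    contains a sequence as soon as it contains the row readings of all
    shapes that dominate an admissible placement of its letters in the grid
    [sequences_reduce_to_shapes]. In the interchanged sequence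
    of 3. the letter of b may be placed one step earlier than b, because b no
    longer waits for a; hence every shape dominating this placement lies strictly
    above lambda, and its idempotent is in I. *)

(** * Residue sequences and shapes *)

(* The codes of the nodes are natural numbers with a residue function whose
   properties are those that a strongly adjacency-free charge provides. Finiteness
   of [K] makes the sums over all residues in [sumn_levels] meaningful. *)
Section ResidueSequences.
Variables (K : finNzRingType) (l : nat) (res : nat -> K).
Implicit Types (c d : K) (s mu nu : seq nat) (ps : seq (nat * K)).

(** In the blob algebra the crossing of two adjacent strands with such residues is
    invertible: its square is the identity. *)
Definition far c d := [&& c != d, c != d + 1 & d != c + 1].

Lemma farC c d : far c d = far d c.
Proof. by rewrite /far eq_sym; congr andb; rewrite andbC. Qed.

(** The implications that hold for the set of sequences whose idempotent lies in a
    two-sided ideal of the blob algebra. The first three come from relations away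
    from the boundary; in the last three the idempotent vanishes because of the
    initial letters. *)
Record closed_under_moves (Z : seq K -> Prop) : Prop := ClosedUnderMoves {
  move_far X c d Y : far c d -> Z (X ++ c :: d :: Y) -> Z (X ++ d :: c :: Y);
  move_double X c Y : Z (X ++ c :: c + 1 :: c :: Y) -> Z (X ++ c + 1 :: c :: c :: Y);
  move_braid X c Y : Z (X ++ c - 1 :: c :: c :: Y) -> Z (X ++ c :: c :: c - 1 :: Y) ->
    Z (X ++ c :: c - 1 :: c :: Y);
  move_first c Y : (forall x, (l <= x < l + l)%N -> res x != c) -> Z (c :: Y);
  move_equal c Y : Z (c :: c :: Y);
  move_up x Y : (l <= x < l + l)%N -> Z (res x :: res x + 1 :: Y)
}.

Hypothesis l_gt0 : (0 < l)%N.
Hypothesis two_neq0 : (1 + 1 != 0 :> K).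
Hypothesis res_down : forall x, res (x + l) = res x - 1.
Hypothesis res_far : forall x y, (x < y < x + l)%N -> far (res x) (res y).

Definition with_res x := (x, res x).
Definition count_from c (R : nat) ps := count (fun p => (p.2 == c) && (R <= p.1)%N) ps.
(** The virtual row above the diagram provides every node, including those of the
    first row, with a node above it, at distance [l]. *)
Definition with_row0 s := iota 0 l ++ s.
Definition is_shape s := sorted ltn s /\
  forall x, x \in s -> (l <= x)%N /\ (x - l)%N \in with_row0 s.
Definition addable s x := [&& (l <= x)%N, x \notin s & (x - l)%N \in with_row0 s].
Definition lowest s c A :=
  [/\ addable s A, res A = c & forall x, addable s x -> res x = c -> (x <= A)%N].
(** The node above a node of residue c has residue c + 1. Where the entries of
    residue c + 1 do not outnumber those of residue c one row further down, no room
    is left for a new node of residue c. The condition says that this happens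
    in [ps] everywhere beyond the place of [p], so that a node of this residue can
    only be added at or before that place; see [dominates_addable]. *)
Definition may_follow ps (p : nat * K) := (l <= p.1.+1)%N /\
  forall R, (p.1 < R)%N ->
    (count_from (p.2 + 1)%R (R - l) (map with_res (iota 0 l) ++ ps) <= count_from p.2 R ps)%N.
Definition valid ps := forall ps1 p ps2, ps = ps1 ++ p :: ps2 -> may_follow ps1 p.
(** Dominance tested separately for each residue. This is finer than dominance of
    shapes, and it is preserved by adding the lowest addable nodes of a given
    residue [dominates_lowest]. *)
Definition dominates mu ps :=
  (forall c R, (count_from c R (map with_res mu) <= count_from c R ps)%N) /\
  perm_eq (map res mu) (map snd ps).

Lemma close_codes x y : ~~ far (res x) (res y) -> (x < y)%N -> (x + l <= y)%N.
Proof. by move=> nf xy; rewrite leqNgt; apply: contra nf => yx; apply: res_far; rewrite xy. Qed.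

Lemma res_up x : (l <= x)%N -> res (x - l) = res x + 1.
Proof. by move=> lx; rewrite -{2}(subnK lx) res_down subrK. Qed.

Lemma count_from_cat c R ps1 ps2 :
  count_from c R (ps1 ++ ps2) = (count_from c R ps1 + count_from c R ps2)%N.
Proof. exact: count_cat. Qed.
Lemma count_from_cons c R p ps :
  count_from c R (p :: ps) = (((p.2 == c) && (R <= p.1)) + count_from c R ps)%N.
Proof. by []. Qed.
Lemma count_from_rcons c R p ps :
  count_from c R (rcons ps p) = (count_from c R ps + ((p.2 == c) && (R <= p.1)))%N.
Proof. by rewrite -cats1 count_from_cat count_from_cons addn0. Qed.
Lemma count_from_cons_res c R x s :
  count_from c R (map with_res (x :: s)) =
  (((res x == c) && (R <= x)) + count_from c R (map with_res s))%N.
Proof. by []. Qed.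
Lemma count_from_filter c R s :
  count_from c R (map with_res s) = size [seq x <- s | (res x == c) && (R <= x)%N].
Proof. by rewrite /count_from count_map -size_filter. Qed.
Lemma mem_level c R s x :
  (x \in [seq x <- s | (res x == c) && (R <= x)%N]) =
  [&& res x == c, (R <= x)%N & x \in s].
Proof. by rewrite mem_filter andbA. Qed.
Lemma count_from_perm c R ps1 ps2 : perm_eq ps1 ps2 -> count_from c R ps1 = count_from c R ps2.
Proof. by move/seq.permP; apply. Qed.

Lemma shape_uniq s : is_shape s -> uniq s.
Proof. by case=> s_lt _; apply: (sorted_uniq ltn_trans ltnn). Qed.
Lemma with_row0_uniq s : is_shape s -> uniq (with_row0 s).
Proof.
move=> sh; rewrite cat_uniq iota_uniq shape_uniq // andbT /=.
by apply/hasPn => x /(proj2 sh)[lx _]; rewrite /= mem_iota add0n -leqNgt.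
Qed.

(** Subtracting [l] sends the nodes of residue c from [R] on, together with the
    addable node [A], injectively to nodes of residue c + 1 one row higher. *)
Lemma count_from_addable s A R : is_shape s -> addable s A -> (l <= R <= A)%N ->
  (count_from (res A) R (map with_res s)
     < count_from (res A + 1)%R (R - l) (map with_res (with_row0 s)))%N.
Proof.
move=> sh /and3P[lA As Al] /andP[lR RA]; rewrite !count_from_filter.
set s1 := filter _ _; set s2 := filter _ _.
rewrite -[_.+1]/(size (A :: s1)) -(size_map (fun x => x - l)%N (A :: s1)).
apply: uniq_leq_size => [|_ /mapP[x x1 ->]].
  rewrite map_inj_in_uniq /= ?filter_uniq ?shape_uniq // ?mem_filter ?(negPf As) ?andbF //.
  have ge_l x : x \in A :: s1 -> (l <= x)%N.
    by rewrite inE mem_filter => /orP[/eqP-> // | /andP[_ /(proj2 sh)[]]].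
  by move=> x y /ge_l lx /ge_l ly eq_xy; rewrite -(subnK lx) eq_xy subnK.
move: x1; rewrite inE /s2 mem_level => /predU1P[->|].
  by rewrite res_up // eqxx Al leq_sub2r.
rewrite /s1 mem_level => /and3P[/eqP <- Rx /(proj2 sh)[lx xl]].
by rewrite res_up // eqxx xl leq_sub2r.
Qed.

(** Adding [l] is injective from the nodes of residue c + 1 to places of residue c;
    a place that is not occupied would be addable. *)
Lemma count_from_no_addable s c R : is_shape s -> (l <= R)%N ->
    (forall x, addable s x -> res x = c -> (x < R)%N) ->
  (count_from (c + 1)%R (R - l) (map with_res (with_row0 s)) <= count_from c R (map with_res s))%N.
Proof.
move=> sh lR noadd; rewrite !count_from_filter.
set s1 := filter _ _; set s2 := filter _ _.
rewrite -(size_map (addn^~ l) s1).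
apply: uniq_leq_size => [|_ /mapP[x x1 ->]].
  by rewrite map_inj_uniq ?filter_uniq ?with_row0_uniq //; apply: addIn.
move: x1; rewrite /s1 /s2 !mem_level => /and3P[/eqP rx Rx xs].
have rxl : res (x + l) = c by rewrite res_down rx addrK.
have Rxl : (R <= x + l)%N by lia.
rewrite rxl eqxx Rxl /=; apply/negPn/negP => xl.
have := noadd (x + l)%N; rewrite rxl ltnNge Rxl /addable xl addnK xs leq_addl.
by move=> /(_ isT erefl).
Qed.

Lemma lowestP s c x0 : addable s x0 -> res x0 = c -> exists A, lowest s c A.
Proof.
move=> ax0 rx0; pose P x := addable s x && (res x == c).
have exP : exists x, P x by exists x0; rewrite /P ax0 rx0 eqxx.
have ubP x : P x -> (x <= l + (l + sumn s))%N.
  case/andP=> /and3P[lx _ xl] _; have : (x - l <= l + sumn s)%N.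
    move: xl; rewrite mem_cat mem_iota add0n => /orP[|]; first by lia.
    elim: s {ax0 P exP} => //= y s IH; rewrite inE => /orP[/eqP->|/IH]; lia.
  lia.
case: (ex_maxnP exP ubP) => A /andP[aA /eqP rA] maxA; exists A; split=> // x ax rx.
by apply: maxA; rewrite /P ax rx eqxx.
Qed.

Lemma no_lowest s c x : (forall A, ~ lowest s c A) -> addable s x -> res x <> c.
Proof. by move=> no ax rx; case: (lowestP ax rx) => A; apply: no. Qed.

Lemma dominates_trans mu nu ps :
  dominates mu (map with_res nu) -> dominates nu ps -> dominates mu ps.
Proof.
case=> le1 p1 [le2 p2]; split=> [c R|]; first exact: leq_trans (le1 c R) (le2 c R).
by apply: perm_trans p2; apply: (perm_trans p1); rewrite -map_comp.
Qed.

(** Only the thresholds between the place of [p] and [A] can fail. For these, the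
    nodes of residue c of [mu] are strictly fewer than the nodes of residue c + 1
    one row higher, while in [ps] they are at least as many; and [mu] is compared
    with [ps] in residue c + 1. *)
Lemma dominates_addable mu ps p A : is_shape mu -> dominates mu ps -> may_follow ps p ->
  addable mu A -> res A = p.2 -> dominates (A :: mu) (rcons ps p).
Proof.
move=> sh [le_mu eq_mu] [lp follow] aA rA; split=> [c R|]; last first.
  by rewrite map_rcons perm_sym perm_rcons perm_sym /= rA perm_cons.
have := le_mu c R; rewrite count_from_cons_res count_from_rcons rA.
case: eqVneq => [<-|_]; last by rewrite addn0.
rewrite !andTb.
case: (leqP R p.1) => [_ | pR]; first by rewrite addn1; case: (R <= A)%N => le1; rewrite ?add1n ?add0n; lia.
case: (leqP R A) => [RA _ | _]; last by lia.
have := count_from_addable sh aA (R := R); rewrite RA rA (leq_trans lp) // => /(_ isT).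
have := follow R pR; rewrite /with_row0 map_cat !count_from_cat.
by have := le_mu (p.2 + 1) (R - l)%N; lia.
Qed.

Lemma lowest_may_follow s c A : is_shape s -> lowest s c A ->
  may_follow (map with_res s) (with_res A).
Proof.
move=> sh [aA rA maxA]; split=> [|R RA] /=; first by case/and3P: aA => /leqW.
rewrite -map_cat; apply: count_from_no_addable => //.
  by apply: ltnW; apply: leq_trans RA; case/and3P: aA.
by move=> x ax rx; apply: leq_trans RA; rewrite ltnS maxA // -rA.
Qed.

(** If [nu] had no addable node of residue c, then it would have at least as many
    nodes of residue c as of residue c + 1 (virtual row included), and [mu] strictly
    fewer; but the first numbers agree and [mu] has no more of the second than [nu].
    So there is a lowest one, and [dominates_addable] applies. *)
Lemma dominates_lowest mu nu c A : is_shape mu -> is_shape nu -> dominates mu (map with_res nu) ->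
  lowest mu c A -> exists2 B, lowest nu c B & dominates (A :: mu) (map with_res (B :: nu)).
Proof.
move=> shm shn dmn [aA rA maxA].
have [[B lowB]|noB] := EM (exists B, lowest nu c B).
  exists B => //; have [_ rB _] := lowB.
  have [le1 p1] := dominates_addable shm dmn (lowest_may_follow shn lowB) aA (etrans rA (esym rB)).
  split=> [d R|].
    by apply: leq_trans (le1 d R) _; rewrite count_from_rcons count_from_cons_res addnC.
  by apply: perm_trans p1 _; rewrite map_rcons perm_rcons.
have noadd x : addable nu x -> res x = c -> (x < l)%N.
  by move=> ax rx; have [B lowB] := lowestP ax rx; case: noB; exists B.
have := count_from_no_addable shn (leqnn l) noadd.
have lA : (l <= l <= A)%N by rewrite leqnn; case/and3P: aA.
have := count_from_addable shm aA lA; rewrite rA subnn /with_row0 !map_cat !count_from_cat.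
have cntl s d : is_shape s -> count_from d l (map with_res s) = count_from d 0 (map with_res s).
  move=> sh; rewrite !count_from_filter; congr size; apply: eq_in_filter => x /(proj2 sh)[-> _].
  by [].
have cnt0 : count_from c 0 (map with_res mu) = count_from c 0 (map with_res nu).
  have H s : count_from c 0 (map with_res s) = count_mem c (map res s).
    by rewrite /count_from !count_map; apply: eq_count => x /=; rewrite andbT.
  by rewrite !H; case: dmn => _ /seq.permP->; rewrite -map_comp.
have [le1 _] := dmn; have := le1 (c + 1) 0%N.
rewrite !cntl // cnt0; lia.
Qed.

Lemma valid_rconsE ps p : valid (rcons ps p) -> valid ps /\ may_follow ps p.
Proof.
move=> v; split=> [ps1 q ps2 eq_ps|]; last by apply: (v ps p [::]); rewrite cats1.
by apply: (v ps1 q (rcons ps2 p)); rewrite eq_ps rcons_cat.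
Qed.

Lemma valid_rcons ps p : valid ps -> may_follow ps p -> valid (rcons ps p).
Proof.
move=> val_ps follow ps1 q ps2; case/lastP: ps2 => [|ps2 q'].
  by rewrite cats1 => /rcons_inj[<- <-].
by rewrite -rcons_cons -rcons_cat => /rcons_inj[/val_ps].
Qed.

(** A residue and its successor cannot occur at distance less than [l]. *)
Lemma far_or_apart x y : res x = res y + 1 -> (x + l <= y \/ y + l <= x)%N.
Proof.
move=> rxy; case: (ltngtP x y) => [xy|yx|exy].
- by left; apply: close_codes xy; rewrite /far rxy eqxx /= andbF.
- by right; apply: close_codes yx; rewrite /far rxy eqxx !andbF.
- move: rxy; rewrite exy => /(canLR (addKr _)); rewrite addNr => K1.
  by move: two_neq0; rewrite -K1 addr0 eqxx.
Qed.

(** When all earlier letters are apart from [p], the set counted on the left-hand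
    side in [may_follow] is empty. *)
Definition apart (q p : nat * K) := (q.2 == p.2 + 1) ==> (q.1 + l <= p.1)%N.

Lemma may_follow_apart ps p : (l <= p.1.+1)%N ->
  all (apart^~ p) (map with_res (iota 0 l) ++ ps) -> may_follow ps p.
Proof.
move=> lp /allP ap; split=> // R pR.
suff -> : count_from (p.2 + 1)%R (R - l) (map with_res (iota 0 l) ++ ps) = 0%N by [].
apply/eqP; rewrite -leqn0 leqNgt -has_count; apply/hasPn => q /ap {}ap.
rewrite negb_and -implybE; apply/implyP => q2; rewrite -ltnNge ltn_subRL addnC.
by apply: leq_ltn_trans pR; move: ap; rewrite /apart q2.
Qed.

Lemma valid_extend ps ps' : valid ps -> all (fun p => l <= p.1.+1)%N ps' ->
  allrel apart (map with_res (iota 0 l) ++ ps) ps' -> pairwise apart ps' ->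
  valid (ps ++ ps').
Proof.
move=> val_ps; elim/last_ind: ps' => [|ps' p IH]; first by rewrite cats0.
rewrite -cats1 all_cat allrel_catr pairwise_cat !allrel1r catA cats1 /= !andbT.
move=> /andP[ge_l lp] /andP[ap ap_p] /andP[pw_p pw].
by apply: valid_rcons (IH _ _ _) (may_follow_apart _ _) => //; rewrite catA all_cat ap_p.
Qed.

Lemma valid_apart ps : all (fun p => l <= p.1.+1)%N ps ->
  pairwise apart (map with_res (iota 0 l) ++ ps) -> valid ps.
Proof.
move=> ge_l; rewrite pairwise_cat => /and3P[ap _ pw].
by apply: (@valid_extend [::]) => //; [case | rewrite cats0].
Qed.

Lemma apart_with_res x y : (x < y + l)%N -> apart (with_res x) (with_res y).
Proof.
move=> xy; apply/implyP => /eqP /far_or_apart[//|yx].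
by move: xy; rewrite ltnNge yx.
Qed.

Lemma pairwise_apart s : sorted ltn s -> pairwise apart (map with_res s).
Proof.
rewrite (sorted_pairwise ltn_trans) pairwise_map; apply: sub_pairwise => x y xy.
by apply: apart_with_res; apply: ltn_addr.
Qed.

Lemma valid_sorted s : (forall x, x \in s -> (l <= x)%N) -> sorted ltn s ->
  valid (map with_res s).
Proof.
move=> ge_l s_lt; apply: valid_apart.
  by apply/allP => _ /mapP[x /ge_l lx ->]; apply: leqW.
rewrite pairwise_cat !pairwise_apart ?iota_ltn_sorted // !andbT.
apply/allrelP => _ _ /mapP[x x_l ->] /mapP[y /ge_l ly ->]; apply: apart_with_res.
by move: x_l; rewrite mem_iota; lia.
Qed.

(** The reading in which the node [b = a + l] comes just before the node [a] above
    it. The letter of [b] is placed at [b - 1] instead of [b]: this is admissible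
    because [a], the node that [b] has to follow in a shape, comes later, and it is
    what makes all dominating shapes strictly higher. *)
Definition swapped X a Y :=
  map with_res X ++ ((a + l).-1, res (a + l)) :: map with_res (a :: Y).

Lemma map_swapped X a Y :
  map snd (swapped X a Y) = map res (X ++ (a + l)%N :: a :: Y).
Proof. by rewrite /swapped !map_cat /= -!map_comp. Qed.

Lemma count_from_swapped c R X a Y :
  count_from c R (map with_res (X ++ (a + l)%N :: a :: Y)) =
  (count_from c R (swapped X a Y) + ((c == res (a + l)%N) && (R == a + l)))%N.
Proof.
rewrite /swapped map_cat !count_from_cat !(map_cons with_res (a + l)%N) !count_from_cons.
move: (count_from c R (map with_res X)) (count_from c R (map with_res (a :: Y))) => u v /=.
by rewrite (eq_sym c); case: eqP => _ /=; move: l_gt0; clear; lia.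
Qed.

(** Every pair of letters is apart. The pair ([b], [a]) is, since the residue of
    [b] is not one more than that of [a]; [a] itself is missing from [X]. *)
Lemma swapped_valid X a Y : (forall x, x \in X -> (l <= x < a + l)%N && (x != a)) ->
    (l <= a)%N -> sorted ltn X -> sorted ltn (a :: Y) ->
  valid (swapped X a Y).
Proof.
move=> HX la sX saY.
have HY y : y \in Y -> (a < y)%N.
  by move: saY; rewrite /= (path_sortedE ltn_trans) => /andP[/allP aY _] /aY.
have to_b x : (x < a + l)%N -> x != a ->
    apart (with_res x) ((a + l).-1, res (a + l)).
  move=> xb xa; apply/implyP => /= /eqP /far_or_apart[]; lia.
apply: valid_apart.
  rewrite all_cat /= all_map; apply/and4P; split; rewrite ?all_map.
  - by apply/allP => x /HX /andP[/andP[/leqW lx _] _].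
  - lia.
  - exact: leqW.
  - by apply/allP => y /HY ay /=; lia.
rewrite /swapped !pairwise_cat pairwise_cons !pairwise_apart ?iota_ltn_sorted // !andbT /=.
apply/andP; split.
  rewrite allrel_catr allrel_consr; apply/and3P; split.
  - apply/allrelP => _ _ /mapP[x x_l ->] /mapP[y /HX/andP[/andP[ly _] _] ->]; apply: apart_with_res.
    by move: x_l; rewrite mem_iota; lia.
  - by apply/allP => _ /mapP[x x_l ->]; apply: to_b; move: x_l; rewrite mem_iota; lia.
  - apply/allrelP => _ q /mapP[x x_l ->] /(@mapP _ _ with_res (a :: Y))[y yaY ->].
    have ly : (l <= y)%N by move: yaY; rewrite inE => /predU1P[->|/HY]; lia.
    by apply: apart_with_res; move: x_l; rewrite mem_iota; lia.
rewrite allrel_consr; apply/andP; split.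
  apply/andP; split; first by apply/allP => _ /mapP[x /HX/andP[/andP[_ xb] xa] ->]; apply: to_b.
  apply/allrelP => _ q /mapP[x /HX/andP[/andP[_ xb] _] ->] /(@mapP _ _ with_res (a :: Y))[y yaY ->].
  by apply: apart_with_res; move: yaY; rewrite inE => /predU1P[->|/HY]; lia.
apply/andP; split.
  apply/implyP => /=; rewrite res_down => /eqP /addrI K1.
  by move: two_neq0; rewrite -{1}K1 addNr eqxx.
apply/allP => _ /mapP[y /HY ay ->]; apply/implyP => /= /eqP /far_or_apart; lia.
Qed.

(** The sum of the codes as a sum over thresholds: x is the number of R with
    R < x. *)
Lemma sumn_levels N s : (forall x, x \in s -> (x <= N)%N) ->
  sumn s = (\sum_(R < N) \sum_c count_from c R.+1 (map with_res s))%N.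
Proof.
elim: s => [|x s IH] le_N; first by rewrite big1 // => R _; rewrite big1.
rewrite [sumn _]/= IH => [|y ys]; last by apply: le_N; rewrite inE ys orbT.
have {1}-> : x = (\sum_(R < N) (R < x))%N.
  have xN : (x <= N)%N by apply: le_N; rewrite inE eqxx.
  transitivity (\sum_(R < N | R < x) 1)%N.
    by rewrite (big_ord_narrow xN) sum1_card card_ord.
  by rewrite big_mkcond; apply: eq_bigr => R _; case: (R < x)%N.
rewrite -big_split; apply: eq_bigr => R _.
rewrite [in RHS](eq_bigr _ (fun c _ => count_from_cons_res c R.+1 x s)) big_split /=; congr addn.
rewrite (bigD1 (res x)) //= eqxx big1 ?addn0 // => c xc.
by rewrite eq_sym (negPf xc).
Qed.

(** Dominating shapes have smaller sums of codes, which is the measure for the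
    inductions in [extensions_step]. *)
Lemma sumn_dominates s t :
    (forall c R, count_from c R (map with_res s) <= count_from c R (map with_res t))%N ->
  (sumn s <= sumn t)%N /\
  ((exists c R, count_from c R.+1 (map with_res s) < count_from c R.+1 (map with_res t))%N ->
   (sumn s < sumn t)%N).
Proof.
move=> le_st.
have le_sumn u x : x \in u -> (x <= sumn u)%N.
  by elim: u => //= y u IH; rewrite inE => /predU1P[->|/IH]; lia.
pose N := (sumn s + sumn t)%N.
rewrite !(@sumn_levels N) => [|x /le_sumn|x /le_sumn]; rewrite /N; try lia.
split=> [|[c [R lt_st]]].
  by apply: leq_sum => R _; apply: leq_sum.
have RN : (R < N)%N.
  have : has (fun x => R < x)%N t.
    rewrite has_count; apply: leq_trans (leq_trans _ lt_st) _ => //.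
    by rewrite /count_from count_map; apply: sub_count => x /= /andP[].
  by case/hasP=> x /le_sumn xt Rx; rewrite /N; lia.
rewrite -/N (bigD1 (Ordinal RN)) //= [in ltnRHS](bigD1 (Ordinal RN)) //=.
rewrite -addSn; apply: leq_add; last by apply: leq_sum => i _; apply: leq_sum.
rewrite (bigD1 c) //= [in leqRHS](bigD1 c) //= -addSn.
by apply: leq_add lt_st _; apply: leq_sum.
Qed.

Lemma move_across (Z : seq K -> Prop) (X : seq K) c (B Y : seq K) :
    closed_under_moves Z -> all (far c) B ->
  Z (X ++ c :: B ++ Y) <-> Z (X ++ B ++ c :: Y).
Proof.
move=> closedZ; elim: B X => [|d B IH] X //= /andP[cd /(IH (rcons X d))].
rewrite !cat_rcons => <-; split; apply: move_far => //; by rewrite farC.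
Qed.

Lemma closed_suffix (Z : seq K -> Prop) (T : seq K) :
  closed_under_moves Z -> closed_under_moves (fun u => Z (u ++ T)).
Proof.
case=> R1 R2 R3 R4 R5 R6; split=> [X c d Y|X c Y|X c Y|c Y|c Y|x Y].
- by rewrite -!catA; apply: R1.
- by rewrite -!catA; apply: R2.
- by rewrite -!catA; apply: R3.
- exact: R4.
- exact: R5.
- exact: R6.
Qed.

(** The two statements that are proved by simultaneous induction on the length: for
    placed sequences, and for the row reading of a shape followed by one letter. *)
Definition sequences_reduce k :=
  forall Z ps, closed_under_moves Z -> valid ps -> size ps = k ->
  (forall mu, is_shape mu -> dominates mu ps -> Z (map res mu)) -> Z (map snd ps).

Definition extensions_reduce k :=
  forall Z nu c, closed_under_moves Z -> is_shape nu -> size nu = k ->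
  (forall A mu, lowest nu c A -> is_shape mu -> dominates mu (map with_res (A :: nu)) ->
     Z (map res mu)) ->
  Z (rcons (map res nu) c).

Lemma dominates_size mu ps : dominates mu ps -> size mu = size ps.
Proof. by case=> _ /perm_size; rewrite !size_map. Qed.

(** Strip the last letter [p]. By induction it suffices to treat the row reading of
    a shape dominating the rest, followed by [p]; the lowest place where [p] can be
    added to this shape preserves dominance by [dominates_addable]. *)
Lemma sequences_of_extensions k :
  (forall j, (j < k)%N -> extensions_reduce j) -> sequences_reduce k.
Proof.
elim: k => [|k IH] Q Z ps closedZ val_ps sz_ps H.
  by case: ps sz_ps {val_ps} H => // _ /(_ [::]) H; apply: H; split.
case/lastP: ps sz_ps val_ps H => [//|ps p]; rewrite size_rcons => -[sz_ps].
move=> /valid_rconsE[val_ps follow] H.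
rewrite map_rcons -cats1; apply: (IH _ (fun u => Z (u ++ [:: p.2]))) => //.
- by move=> j jk; apply: Q; apply: ltnW.
- exact: closed_suffix.
move=> nu shn domn; rewrite cats1; apply: (Q k) => //; first by rewrite (dominates_size domn).
move=> A mu [aA rA _] shm domm; apply: H => //.
by apply: (dominates_trans domm); apply: dominates_addable.
Qed.

Lemma split_last (p : pred nat) s : all (predC p) s \/
  exists s1 z s2, [/\ s = s1 ++ z :: s2, p z & all (predC p) s2].
Proof.
elim: s => [|x s [IH|[s1 [z [s2 [-> pz ps2]]]]]]; first by left.
- case px: (p x); last by left; rewrite /= px.
  by right; exists [::], x, s.
- by right; exists (x :: s1), z, s2.
Qed.

Lemma sorted_split s A : sorted ltn s -> A \notin s ->
  exists s1 s2, [/\ s = s1 ++ s2, forall x, x \in s1 -> (x < A)%N,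
    forall x, x \in s2 -> (A < x)%N & sorted ltn (s1 ++ A :: s2)].
Proof.
elim: s => [|x s IH] xs; first by exists [::], [::].
rewrite inE negb_or => /andP[Ax As].
have [s1 [s2 [def_s lt1 lt2 srt]]] := IH (path_sorted xs) As.
have x_lt y : y \in s -> (x < y)%N.
  by move: xs; rewrite /= (path_sortedE ltn_trans) => /andP[/allP xs _] /xs.
case: (ltnP x A) => [xA|]; last first.
  rewrite leq_eqVlt (negPf Ax) /= => lt_Ax; exists [::], (x :: s); split=> //=.
    by move=> y; rewrite inE => /predU1P[->|/x_lt] //; apply: ltn_trans.
  by rewrite lt_Ax.
exists (x :: s1), s2; split=> //=; first by rewrite def_s.
  by move=> y; rewrite inE => /predU1P[->|/lt1].
rewrite (path_sortedE ltn_trans) srt andbT all_cat /= xA /=.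
by move: x_lt; rewrite def_s => x_lt; apply/andP; split; apply/allP => y ys;
  apply: x_lt; rewrite mem_cat ys ?orbT.
Qed.

Lemma shape_insert s s1 s2 A : is_shape s -> addable s A -> s = s1 ++ s2 ->
  sorted ltn (s1 ++ A :: s2) -> is_shape (s1 ++ A :: s2).
Proof.
move=> [_ down] /and3P[lA _ Al] def_s srt; split=> // x.
have mem_ins y : (y \in with_row0 (s1 ++ A :: s2)) = (y == A) || (y \in with_row0 s).
  by rewrite /with_row0 def_s !mem_cat inE; case: (y == A); rewrite ?orbT.
have sub y : y \in with_row0 s -> y \in with_row0 (s1 ++ A :: s2) by rewrite mem_ins => ->; rewrite orbT.
rewrite mem_cat inE orbCA => /predU1P[->|]; first by split=> //; apply: sub.
by rewrite -mem_cat -def_s => /down[lx xl]; split=> //; apply: sub.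
Qed.

Lemma dominates_refl mu nu : perm_eq mu nu -> dominates mu (map with_res nu).
Proof.
move=> pmn; split=> [c R|]; first by rewrite (count_from_perm c R (perm_map with_res pmn)).
by rewrite -map_comp; apply: perm_map.
Qed.

Lemma dominates_swapped mu nu X a Y : dominates mu (swapped X a Y) ->
    perm_eq (X ++ (a + l)%N :: a :: Y) nu ->
  dominates mu (map with_res nu) /\
  (count_from (res (a + l)%N) (a + l) (map with_res mu)
     < count_from (res (a + l)%N) (a + l) (map with_res nu))%N.
Proof.
case=> le_mu eq_mu pnu.
have cntE c R : count_from c R (map with_res nu) =
    (count_from c R (swapped X a Y) + ((c == res (a + l)%N) && (R == a + l)))%N.
  by rewrite -count_from_swapped; apply/esym/count_from_perm/perm_map.
split; last by rewrite cntE !eqxx addn1 ltnS le_mu.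
split=> [c R|]; first by rewrite cntE; apply: leq_trans (le_mu c R) (leq_addr _ _).
by apply: perm_trans eq_mu _; rewrite map_swapped -map_comp; apply: perm_map.
Qed.

Lemma shape_prefix s1 s2 : is_shape (s1 ++ s2) -> is_shape s1.
Proof.
case=> srt down; have : pairwise ltn (s1 ++ s2) by rewrite -sorted_pairwise //; apply: ltn_trans.
rewrite pairwise_cat => /and3P[/allrelP lt12 pw1 _].
split=> [|x x1]; first by rewrite (sorted_pairwise ltn_trans).
have [|lx] := down x; first by rewrite mem_cat x1.
rewrite /with_row0 !mem_cat => /or3P[->|->|/(lt12 x _ x1)]; rewrite ?orbT //.
by rewrite /= ltnNge leq_subr.
Qed.

(** The last letter c is moved to the left until it meets a node z that it cannot
    cross and that lies below the lowest addable place of c. If there is none, then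
    c reaches its place, or the front; a node z of the first row can be taken to the
    front too. Otherwise the residue of z is c or c - 1, and a local move on z, c and
    the node a above z reduces to two kinds of sequences. In one of them z comes
    before a, which leads to strictly higher shapes; in the other, which occurs for
    residue c - 1, c passes over z and takes its place before the nodes from z on. *)
Lemma extensions_step k :
  (forall j, (j < k)%N -> extensions_reduce j) -> extensions_reduce k.
Proof.
move=> Q Z nu0 c0 closedZ shn0 sz0 H0.
have C j : (j <= k)%N -> sequences_reduce j.
  by move=> jk; apply: sequences_of_extensions => i ij; apply: Q; apply: leq_trans jk.
(* [N1] bounds the sum of the codes of [nu] and of its lowest addable node of
   residue [c]; [N2] bounds the sum of the codes of [nu] alone. Passing to a shape
   that dominates [nu] decreases the second and does not increase the first. *)
suff main N1 N2 nu c : is_shape nu -> size nu = k -> (sumn nu < N2)%N ->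
    (forall A, lowest nu c A -> (A + sumn nu < N1)%N) ->
    (forall A mu, lowest nu c A -> is_shape mu -> dominates mu (map with_res (A :: nu)) ->
       Z (map res mu)) ->
    Z (rcons (map res nu) c).
  have [[B lowB]|no] := EM (exists B, lowest nu0 c0 B); last first.
    by apply: (main 0%N (sumn nu0).+1) => // A lowA; case: no; exists A.
  apply: (main (B + sumn nu0).+1 (sumn nu0).+1) => // A [aA rA _].
  by case: lowB => _ _ /(_ A aA rA); rewrite ltnS leq_add2r.
elim/ltn_ind: N1 N2 nu c => N1 IH1; elim/ltn_ind => N2 IH2 nu c shn sz lt2 lt1 H.
(* [B0] is the lowest addable place of residue [c], or 0 when there is none. *)
have [B0 [ub0 cases0]] : exists B0, (forall x, addable nu x -> res x = c -> (x <= B0)%N) /\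
    (lowest nu c B0 \/ B0 = 0%N /\ forall A, ~ lowest nu c A).
  have [[B lowB]|no] := EM (exists B, lowest nu c B).
    by exists B; split; [case: lowB | left].
  exists 0%N; split; last by right; split=> // A lowA; apply: no; exists A.
  by move=> x ax rx; case: no; apply: lowestP ax rx.
(* [z] is the last obstacle on the way of [c] to its place. *)
have [far0 | [pre [z [post [def_nu /andP[nf B0z] far0]]]]] :=
    split_last (fun x => ~~ far c (res x) && (B0 < x)%N) nu.
- have {}far0 x : x \in nu -> (B0 < x)%N -> far c (res x).
    by move=> /(allP far0) /=; rewrite negb_and negbK => /orP[//|/negP].
  case: cases0 => [lowB|[B00 no]].
    have [aB rB _] := lowB; have Bnu : B0 \notin nu by case/and3P: aB.
    have [s1 [s2 [def_nu lt_1 lt_2 srt]]] := sorted_split (proj1 shn) Bnu.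
    have far2 : all (far c) (map res s2).
      apply/allP => _ /mapP[x x2 ->]; apply: far0 (lt_2 x x2).
      by rewrite def_nu mem_cat x2 orbT.
    rewrite -cats1 def_nu map_cat -catA; apply/(move_across _ _ closedZ far2).
    rewrite cats0 -rB -map_cons -map_cat; apply: (H B0) => //.
      exact: shape_insert shn aB def_nu srt.
    by apply: dominates_refl; rewrite def_nu -cat1s perm_catCA.
  have far2 : all (far c) (map res nu).
    apply/allP => _ /mapP[x xn ->]; apply: far0 => //.
    by rewrite B00; have [lx _] := proj2 shn x xn; apply: leq_trans lx.
  rewrite -cats1; apply/(move_across [::] _ closedZ far2); apply: move_first closedZ _ _ _ => x /andP[lx xl].
  apply/eqP => rx; have [xn|xn] := boolP (x \in nu).
    by have := allP far2 _ (map_f res xn); rewrite rx /far eqxx.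
  apply: (no_lowest no) rx; rewrite /addable lx xn mem_cat mem_iota; apply/orP; left; lia.
have pw : pairwise ltn nu by rewrite -sorted_pairwise; [case: shn | apply: ltn_trans].
have := pw; rewrite [in pairwise _ _]def_nu pairwise_cat /=
  => /and3P[/allrelP lt12 pw0 /andP[/allP ltz2 pw2]].
have lt0z x : x \in pre -> (x < z)%N by move=> x0; apply: lt12; rewrite // inE eqxx.
have ltz x : x \in post -> (z < x)%N by move/ltz2.
have ge_l x : x \in nu -> (l <= x)%N by case/(proj2 shn).
have z_nu : z \in nu by rewrite def_nu mem_cat inE eqxx orbT.
have pre_nu x : x \in pre -> x \in nu by rewrite def_nu mem_cat => ->.
have lz := ge_l z z_nu.
have far2 : all (far c) (map res post).
  apply/allP => _ /mapP[x x2 ->]; have /= := allP far0 _ x2.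
  by rewrite negb_and negbK => /orP[//|/negP]; case; apply: ltn_trans (ltz x x2).
(* A node just below [z] would have residue [c]: if present it is a later obstacle,
   and if absent it is addable below [B0]. *)
have nup : res z != c + 1.
  apply/negP => /eqP rz; have rzl : res (z + l) = c by rewrite res_down rz addrK.
  have [zl|zl] := boolP ((z + l)%N \in nu).
    move: zl; rewrite def_nu mem_cat inE => /or3P[/lt0z|/eqP|zl].
    - by move: l_gt0; clear; lia.
    - by move: l_gt0; clear; lia.
    by have := allP far2 _ (map_f res zl); rewrite rzl /far eqxx.
  have := ub0 (z + l)%N; rewrite rzl /addable leq_addl zl addnK mem_cat z_nu orbT.
  by move=> /(_ isT erefl); move: B0z; clear; lia.
have goalE : Z (map res pre ++ res z :: c :: map res post) -> Z (rcons (map res nu) c).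
  rewrite -cats1 def_nu map_cat map_cons -catA cat_cons -!(cat_rcons (res z)) => HZ.
  by apply/(move_across _ _ closedZ far2); rewrite cats0.
have rz : res z = c \/ c = res z + 1.
  move: nf; rewrite /far (negPf nup) andbT negb_and !negbK eq_sym.
  by case/orP => /eqP; [left | right].
apply: goalE.
(* In the first row, everything before [z] is far from [z] and from [c]; both are
   moved to the front, where such a pair of residues is impossible. *)
case: (ltnP z (l + l)) => [zl|lz2].
  have far_z : all (far (res z)) (map res pre).
    apply/allP => _ /mapP[x x0 ->]; rewrite farC; apply: res_far.
    by move: (lt0z x x0) (ge_l x (pre_nu x x0)) zl; clear; lia.
  have far_c : all (far c) (map res pre).
    case: rz => [<- //|->]; apply/allP => _ /mapP[x x0 ->].
    rewrite -(res_up lz); apply: res_far.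
    by move: (lt0z x x0) (ge_l x (pre_nu x x0)) zl; clear; lia.
  apply/(move_across [::] _ closedZ far_z) => /=.
  apply/(move_across [:: res z] _ closedZ far_c) => /=.
  case: rz => [->|->]; first exact: move_equal.
  by apply: (move_up closedZ); rewrite lz.
(* Below the first row, let [a] be the node above [z]; [c] can be brought next to
   [z], and [a] too, since the nodes of [T] between [a] and [z] are far from both. *)
have a_nu : (z - l)%N \in nu.
  have [_] := proj2 shn z z_nu; rewrite mem_cat mem_iota => /orP[|//]; move: lz2; clear; lia.
set a := (z - l)%N in a_nu; have def_z : z = (a + l)%N by rewrite subnK.
have la := ge_l a a_nu; have ra : res a = res z + 1 by apply: res_up.
have a_pre : a \in pre.
  move: a_nu; rewrite def_nu mem_cat inE => /or3P[//|/eqP|/ltz]; move: l_gt0 lz; rewrite /a; clear; lia.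
have [X [T def_pre]] : exists X T, pre = X ++ a :: T by case/splitPr: a_pre => X T; exists X, T.
have := pw0; rewrite [in pairwise _ _]def_pre pairwise_cat /=
  => /and3P[/allrelP ltXT pwX /andP[/allP ltT pwT]].
have farT d : d = res z \/ d = res a -> all (far d) (map res T).
  move=> def_d; apply/allP => _ /mapP[x xT ->].
  have ax : (a < x)%N := ltT x xT.
  have xz : (x < z)%N by apply: lt0z; rewrite def_pre mem_cat inE xT !orbT.
  by case: def_d => ->; [rewrite farC|]; apply: res_far; move: ax xz def_z; clear; lia.
(* Interchanging [z] and [a] in [nu] leads to shapes that strictly dominate [nu],
   and these are covered by the inner induction. *)
have SW : Z (rcons (map res ((X ++ T) ++ z :: a :: post)) c).
  rewrite -cats1 def_z -map_swapped.
  apply: (C k (leqnn k) (fun u => Z (u ++ [:: c]))).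
  - exact: closed_suffix.
  - apply: swapped_valid => //.
    + move=> x; rewrite mem_cat => /orP[xX|xT].
        have xa : (x < a)%N by apply: ltXT; rewrite // inE eqxx.
        have := ge_l x (pre_nu x _); rewrite def_pre mem_cat xX => /(_ isT); move: xa; clear; lia.
      have ax : (a < x)%N := ltT x xT.
      have := lt0z x; rewrite def_pre mem_cat inE xT !orbT => /(_ isT); move: ax la; rewrite -def_z; clear; lia.
    + rewrite (sorted_pairwise ltn_trans) pairwise_cat pwX pwT !andbT.
      by apply/allrelP => x y xX yT; apply: ltXT; rewrite // inE yT orbT.
    + rewrite (sorted_pairwise ltn_trans) /= pw2 andbT.
      by apply/allP => x /ltz zx; rewrite /=; move: zx def_z; clear; lia.
  - by rewrite -sz def_nu def_pre !size_cat /= !size_map !size_cat /=; clear; lia.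
  move=> mu shm domm; have [|domn strict] := dominates_swapped domm (nu := nu).
    apply/seq.permP => p; rewrite def_nu def_pre -def_z !count_cat /=.
    by clear; lia.
  have [_ lt_sum] := sumn_dominates (proj1 domn).
  have {}lt_sum : (sumn mu < sumn nu)%N.
    apply: lt_sum; exists (res (a + l)), (a + l).-1; rewrite prednK //; move: l_gt0; clear; lia.
  rewrite cats1; apply: (IH2 (sumn nu) lt2) => // [|A lowA|A mu' lowA shm' domm'].
  - by rewrite (dominates_size domm) -sz def_nu def_pre !size_cat /= !size_map !size_cat /=; clear; lia.
  - have [B lowB domB] := dominates_lowest shm shn domn lowA.
    have [/= le_sum _] := sumn_dominates (proj1 domB).
    exact: leq_ltn_trans le_sum (lt1 B lowB).
  - have [B lowB domB] := dominates_lowest shm shn domn lowA.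
    by apply: (H B) => //; apply: dominates_trans domm' domB.
have SW' : Z ((map res (X ++ T) ++ [:: res z; res a]) ++ c :: map res post).
  rewrite -[map res post]cats0; apply/(move_across _ [::] closedZ far2).
  by move: SW; rewrite -cats1 map_cat !map_cons -!catA.
rewrite def_pre map_cat map_cons -catA cat_cons.
apply/(move_across _ _ closedZ (farT _ (or_intror erefl))).
case: rz => [rz|c_def].
  (* [z] has residue [c]: the letters c + 1, c, c. *)
  rewrite ra rz catA; apply: (move_double closedZ).
  by move: SW'; rewrite map_cat ra rz -!catA.
have {}ra : res a = c by rewrite ra c_def.
have {c_def} rz : res z = c - 1 by rewrite c_def addrK.
(* [z] has residue [c - 1]: the letters c, c - 1, c. The first sequence required is
   the interchanged one; in the second, [c] is added to the nodes before [z] and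
   followed by the nodes from [z] on. *)
rewrite ra rz catA; apply: (move_braid closedZ).
  by move: SW'; rewrite map_cat ra rz -!catA.
have farcT : all (far c) (map res T) by apply: farT; right.
rewrite -catA; apply/(move_across _ _ closedZ farcT).
have -> : map res X ++ c :: map res T ++ c :: c - 1 :: map res post =
    rcons (map res pre) c ++ map res (z :: post).
  by rewrite def_pre map_cat !map_cons ra rz cat_rcons -catA.
have sh_pre : is_shape pre by move: (shn); rewrite def_nu; apply: shape_prefix.
have sz_pre : (size pre + size post).+1 = k by rewrite -sz def_nu size_cat addnS.
have add_pre A : addable pre A -> res A = c -> addable nu A.
  move=> /and3P[lA A_pre Al] rA; apply/and3P; split=> //.
    rewrite def_nu mem_cat inE (negPf A_pre) /=; apply/norP; split.
      apply/eqP => eqA; move: rz; rewrite -eqA rA => /eqP.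
      by rewrite -subr_eq0 opprB addrC subrK oner_eq0.
    by apply/negP => /(map_f res)/(allP far2); rewrite rA /far eqxx.
  by move: Al; rewrite /with_row0 def_nu !mem_cat => /orP[->|->]; rewrite ?orbT.
(* When [c] is not addable to [nu], it is not addable to the shorter shape [pre]. *)
case: cases0 => [lowB|[_ no]]; last first.
  apply: (Q (size pre) _ (fun u => Z (u ++ map res (z :: post)))) => //.
  - by rewrite -sz_pre ltnS leq_addr.
  - exact: closed_suffix.
  - by move=> A mu [aA rA _]; case: (no_lowest no (add_pre A aA rA)).
have [aB rB _] := lowB.
have low_pre : lowest pre c B0.
  split=> // [|x ax rx]; last exact: ub0 (add_pre x ax rx) rx.
  case/and3P: aB => lB Bn; rewrite /addable lB def_nu /with_row0 !mem_cat inE /=.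
  rewrite (contra (@pre_nu B0)) //= => /orP[->|/orP[->|/predU1P[Bz|/ltz]]]; rewrite ?orbT //.
    by move: B0z; rewrite -Bz; clear; lia.
  by move: B0z; clear; lia.
(* Otherwise [c] is placed at [B0]. All letters but the last, [y], form an admissible
   placement [ps] of the length of [nu]. *)
have [M [y def_M]] : exists M y, z :: post = rcons M y by exists (belast z post), (last z post); apply: lastI.
have B0M x : x \in rcons M y -> (B0 < x)%N.
  rewrite -def_M inE => /predU1P[->//|/ltz]; exact: ltn_trans.
have pwM : pairwise ltn (rcons M y) by rewrite -def_M /= pw2 andbT; apply/allP.
have lt_M x : x \in M -> (x < y)%N.
  by move: pwM; rewrite -cats1 pairwise_cat allrel1r => /and3P[/allP ltM _ _] /ltM.
have nu_zM x : x \in rcons M y -> x \in nu.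
  by rewrite -def_M def_nu mem_cat => ->; rewrite orbT.
have lt_preM x x' : x \in pre -> x' \in rcons M y -> (x < x')%N by rewrite -def_M; apply: lt12.
have y_M : y \in rcons M y by rewrite mem_rcons inE eqxx.
pose ps := rcons (map with_res pre) (with_res B0) ++ map with_res M.
have apart_new x : x \in rcons M y ->
    all (apart^~ (with_res x)) (map with_res (iota 0 l) ++
    rcons (map with_res pre) (with_res B0)).
  move=> xM; rewrite all_cat all_rcons !all_map; apply/and3P; split.
  - apply/allP => v; rewrite mem_iota => /andP[_ vl]; apply: apart_with_res.
    by move: vl; clear; lia.
  - by apply: apart_with_res; move: (B0M x xM); clear; lia.
  - by apply/allP => v v0; apply: apart_with_res; move: (lt_preM v x v0 xM); clear; lia.
have val_pre : valid (map with_res pre).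
  apply: valid_sorted => [x /pre_nu/ge_l //|].
  by rewrite (sorted_pairwise ltn_trans).
have M_apart : pairwise apart (map with_res M).
  apply: pairwise_apart; rewrite (sorted_pairwise ltn_trans).
  by move: pwM; rewrite -cats1 pairwise_cat => /and3P[].
have val_ps : valid ps.
  apply: valid_extend => //.
  - exact: valid_rcons val_pre (lowest_may_follow sh_pre low_pre).
  - apply/allP => _ /mapP[x xM ->]; apply: leqW; apply/ge_l/nu_zM.
    by rewrite mem_rcons inE xM orbT.
  - apply/allrelP => q _ q_in /mapP[x xM ->].
    by apply: (allP (apart_new x _) q q_in); rewrite mem_rcons inE xM orbT.
have perm_ps : perm_eq (rcons ps (with_res y)) (map with_res (B0 :: nu)).
  rewrite /ps rcons_cat -(map_rcons with_res M) -def_M -cats1 -catA def_nu.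
  by rewrite !(map_cons, map_cat) perm_catCA.
have lt_ps q : q \in ps -> (q.1 < y)%N.
  rewrite mem_cat mem_rcons inE -orbA => /or3P[/eqP-> | /mapP[x x0 ->] | /mapP[x xM ->]].
  - exact: B0M.
  - exact: lt_preM.
  - exact: lt_M.
have -> : rcons (map res pre) c ++ map res (z :: post) = map snd ps ++ [:: res y].
  by rewrite def_M /ps map_cat !map_rcons -!map_comp /= rB -[rcons (map res M) _]cats1 catA.
apply: (C k (leqnn k) (fun u => Z (u ++ [:: res y]))) => //.
- exact: closed_suffix.
- have := congr1 size def_M; rewrite /= size_rcons => -[szM].
  by rewrite size_cat size_rcons !size_map -szM addSn.
move=> mu shm domm; rewrite cats1.
have cnt_ge d (qs : seq (nat * K)) :
    (forall q, q \in qs -> (q.1 < y)%N) -> count_from d y qs = 0%N.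
  move=> lt_s; apply/eqP; rewrite -leqn0 leqNgt -has_count; apply/hasPn => q /lt_s.
  by rewrite negb_and ltnNge => ->; rewrite orbT.
have cnt_pos x t : x \in t -> (0 < count_from (res x) x (map with_res t))%N.
  by move=> xt; rewrite -has_count has_map; apply/hasP; exists x; rewrite //= eqxx leqnn.
have lt_mu x : x \in mu -> (x < y)%N.
  move=> xm; rewrite ltnNge; apply/negP => yx.
  have := leq_trans (cnt_pos x mu xm) (proj1 domm (res x) x).
  rewrite -has_count => /hasP[q /lt_ps qy /andP[_ xq]].
  by move: qy; rewrite ltnNge (leq_trans yx xq).
have follow : may_follow ps (with_res y).
  apply: may_follow_apart; first exact/leqW/ge_l/nu_zM.
  rewrite /ps catA all_cat apart_new //= all_map.
  by apply/allP => x xM; apply: apart_with_res; move: (lt_M x xM); clear; lia.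
have domA A : addable mu A -> res A = res y -> dominates (A :: mu) (map with_res (B0 :: nu)).
  move=> aA rA; have [le_A eq_A] := dominates_addable shm domm follow aA rA.
  split=> [d R|]; first by rewrite -(count_from_perm d R perm_ps).
  by apply: perm_trans eq_A _; apply: perm_map.
have le_y A : addable mu A -> res A = res y -> (A <= y)%N.
  move=> aA rA; have := proj1 (domA A aA rA) (res A) A.
  rewrite -(count_from_perm _ _ perm_ps); have := cnt_pos A (A :: mu); rewrite inE eqxx => /(_ isT).
  move=> pos /(leq_trans pos); rewrite -has_count => /hasP[q].
  rewrite mem_rcons inE => /predU1P[->|/lt_ps qy] /andP[_ Aq] //.
  exact: leq_trans Aq (ltnW qy).
(* If [y] itself is the lowest addable node of its residue, appending it gives the
   row reading of a shape. If not, the lowest place where it can be added comes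
   strictly before [y], and the outer induction applies. *)
have [lowy|nlowy] := EM (lowest mu (res y) y).
  have [ay _ _] := lowy; rewrite -map_rcons; apply: (H B0) => //.
    rewrite -cats1; apply: (shape_insert shm ay); first by rewrite cats0.
    rewrite (sorted_pairwise ltn_trans) pairwise_cat allrel1r /= andbT.
    rewrite -(sorted_pairwise ltn_trans) (proj1 shm) andbT.
    exact/allP.
  apply: dominates_trans (domA y ay erefl); apply: dominates_refl.
  by rewrite perm_rcons.
apply: (IH1 (B0 + sumn nu)%N (lt1 _ lowB) (sumn mu).+1) => //.
- rewrite (dominates_size domm); have := congr1 size def_M; rewrite /= size_rcons => -[szM].
  by rewrite size_cat size_rcons !size_map -szM addSn.
- move=> A lowA; have [aA rA _] := lowA.
  have [_] := sumn_dominates (proj1 (domA A aA rA)); apply.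
  have Ay : (A < y)%N.
    by rewrite ltn_neqAle le_y // andbT; apply: contra_notN nlowy => /eqP <-; rewrite rA.
  exists (res y), y.-1; rewrite prednK; last by move: Ay; clear; lia.
  rewrite cnt_ge => [|q /(@mapP _ _ with_res (A :: mu))[x]]; last first.
    by rewrite inE => /predU1P[->|/lt_mu xy] ->.
  by apply: cnt_pos; rewrite inE nu_zM // orbT.
- move=> A mu' [aA rA _] shm' domm'; apply: (H B0) => //.
  exact: dominates_trans domm' (domA A aA rA).
Qed.

Theorem sequences_reduce_to_shapes k : sequences_reduce k.
Proof.
apply: sequences_of_extensions => j _; elim/ltn_ind: j => j IH.
exact: extensions_step.
Qed.

End ResidueSequences.

(** * Words in the simple transpositions *)
Section Words.
Variable n : nat.
Implicit Types (p : {perm 'I_n}) (r s : 'I_n.-1) (u v w x y z : seq 'I_n.-1).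

Definition srefl r : {perm 'I_n} := tperm (lo r) (hi r).

Lemma sreflMK r p : (srefl r * (srefl r * p))%g = p.
Proof. by rewrite mulgA tperm2 mul1g. Qed.

Lemma word_perm_cat u v : word_perm (u ++ v) = (word_perm v * word_perm u)%g.
Proof. by elim: u => [|r u IH] /=; rewrite ?mulg1 // IH mulgA. Qed.

Lemma word_perm_rcons u r : word_perm (rcons u r) = (srefl r * word_perm u)%g.
Proof. by rewrite -cats1 word_perm_cat /= mul1g. Qed.

Definition inversions p : {set 'I_n * 'I_n} :=
  [set ij : 'I_n * 'I_n | (ij.1 < ij.2)%N && (p ij.2 < p ij.1)%N].
Definition inversion_number p := #|inversions p|.

Lemma srefl_lt r (i j : 'I_n) : (i < j)%N -> (i, j) != (lo r, hi r) ->
  (srefl r i < srefl r j)%N.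
Proof.
rewrite xpair_eqE -!val_eqE /= => ij ne; rewrite /srefl.
by case: tpermP; case: tpermP; rewrite -?val_eqE /=; move: ij ne => + + *; subst; move=> /=; lia.
Qed.

Lemma sreflK r : involutive (srefl r).
Proof. by move=> k; rewrite /srefl tpermK. Qed.

(** Multiplication by the simple transposition permutes the pairs of positions other
    than its own, and its own pair becomes an inversion. *)
Lemma inversion_number_up p r : (p (lo r) < p (hi r))%N ->
  inversion_number (srefl r * p)%g = (inversion_number p).+1.
Proof.
move=> p_up; pose f (ij : 'I_n * 'I_n) := (srefl r ij.1, srefl r ij.2).
have fK : involutive f by case=> i j; rewrite /f /= !sreflK.
have def_inv : inversions (srefl r * p)%g = (lo r, hi r) |: f @: inversions p.
  apply/setP => ij; rewrite !inE !permM.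
  have [->|ne] := eqVneq ij (lo r, hi r); first by rewrite /srefl tpermL tpermR p_up leqnn.
  rewrite -[in RHS](fK ij) (mem_imset _ _ (inv_inj fK)) inE /=.
  apply/andP/andP => -[lt_ij p_lt]; split=> //.
    by apply: srefl_lt => //; rewrite -surjective_pairing.
  have := srefl_lt (r := r) lt_ij; rewrite !sreflK; apply; apply/eqP => -[eq1 eq2].
  by move: p_lt; rewrite eq1 eq2 ltnNge (ltnW p_up).
rewrite /inversion_number def_inv cardsU1 card_imset; last exact: inv_inj.
case: imsetP => // -[ij + eq_ij]; rewrite inE => /andP[+ _].
rewrite -[ij]fK -eq_ij /f /= /srefl tpermL tpermR /= => /ltnW.
by rewrite ltnn.
Qed.

Lemma inversion_number_down p r : (p (hi r) < p (lo r))%N ->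
  inversion_number p = (inversion_number (srefl r * p)%g).+1.
Proof. by move=> p_dn; rewrite -(@inversion_number_up _ r) ?sreflMK // !permM /srefl tpermL tpermR. Qed.

Lemma lo_hi_total p r : (p (lo r) < p (hi r))%N || (p (hi r) < p (lo r))%N.
Proof. by rewrite -neq_ltn (inj_eq val_inj) (inj_eq perm_inj) lo_neq_hi. Qed.

Lemma inversion_number_le_size u : (inversion_number (word_perm u) <= size u)%N.
Proof.
elim/last_ind: u => [|u r IH].
  rewrite /inversion_number eq_card0 // => ij; rewrite !inE !perm1.
  by apply/negP => /andP[ij1 /ltnW]; rewrite leqNgt ij1.
rewrite word_perm_rcons size_rcons; case/orP: (lo_hi_total (word_perm u) r) => [up|dn].
  by rewrite inversion_number_up.
by apply: leqW; apply: leq_trans IH; rewrite [leqRHS](inversion_number_down dn).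
Qed.

Lemma increasing_between p (i j : 'I_n) : (i < j)%N ->
  (forall r, (i <= r < j)%N -> (p (lo r) < p (hi r))%N) -> (p i < p j)%N.
Proof.
case: j => j; elim: j => // j IH jn /= ij up.
have rn : (j < n.-1)%N by rewrite -ltnS prednK //; apply: leq_trans jn.
pose r := Ordinal rn; have -> : Ordinal jn = hi r by apply: val_inj.
have p_r : (p (lo r) < p (hi r))%N by apply: up; rewrite /= -ltnS ij leqnn.
move: ij; rewrite ltnS leq_eqVlt => /predU1P[ij|ij].
  by have -> : i = lo r by apply: val_inj.
apply: ltn_trans p_r; have -> : lo r = Ordinal (ltnW jn) by apply: val_inj.
by apply: IH => // r' /andP[ir rj]; apply: up; rewrite ir /= (ltn_trans rj).
Qed.

Lemma no_descent p : (forall r, (p (lo r) < p (hi r))%N) -> p = 1%g.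
Proof.
move=> up; have mono : {homo p : i j / (i < j)%N}.
  by move=> i j ij; apply: increasing_between.
suff ge_id (q : {perm 'I_n}) : {homo q : i j / (i < j)%N} -> forall i : 'I_n, (i <= q i)%N.
  apply/permP => i; rewrite perm1; apply/val_inj/eqP; rewrite eqn_leq ge_id // andbT.
  have := ge_id (p^-1)%g _ (p i); rewrite permK; apply=> i' j' ij'.
  rewrite ltnNge leq_eqVlt negb_or; apply/andP; split.
    by apply/eqP => /val_inj /perm_inj eq_ij; rewrite eq_ij ltnn in ij'.
  by apply/negP => /mono; rewrite !permKV => /ltnW; rewrite leqNgt ij'.
move=> q_mono [i]; elim: i => // i IH ilt.
have lt_ii : (Ordinal (ltnW ilt) < Ordinal ilt)%N by [].
exact: leq_ltn_trans (IH (ltnW ilt)) (q_mono _ _ lt_ii).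
Qed.

Lemma exists_reduced p : exists2 u, word_perm u = p & size u = inversion_number p.
Proof.
move def_m: (inversion_number p) => m; elim: m => [|m IH] in p def_m *.
  exists [::] => //; rewrite (no_descent (p := p)) // => r.
  by case/orP: (lo_hi_total p r) => // /inversion_number_down; rewrite def_m.
have [dn|up] := boolP [exists r, (p (hi r) < p (lo r))%N].
  case/existsP: dn => r dn; have [|u wu su] := IH (srefl r * p)%g.
    by apply: succn_inj; rewrite -inversion_number_down.
  by exists (rcons u r); rewrite ?size_rcons ?su // word_perm_rcons wu sreflMK.
move: def_m; rewrite (no_descent (p := p)); last first.
  move=> r; case/orP: (lo_hi_total p r) => // dn.
  by case/existsP: up; exists r.
by have := inversion_number_le_size [::]; case: (inversion_number _).
Qed.

Definition reduced u := size u == inversion_number (word_perm u).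

Lemma reduced_expression_size p u : reduced_expression p u -> size u = inversion_number p.
Proof.
case=> wu min_u; have [v wv sv] := exists_reduced p.
by apply/eqP; rewrite eqn_leq -{1}sv min_u // -wu inversion_number_le_size.
Qed.

Lemma reduced_rcons u r : reduced (rcons u r) ->
  reduced u /\ (word_perm (rcons u r) (hi r) < word_perm (rcons u r) (lo r))%N.
Proof.
rewrite /reduced word_perm_rcons size_rcons => /eqP red_u.
have le_u := inversion_number_le_size u.
case/orP: (lo_hi_total (word_perm u) r) => [up|dn].
  by rewrite !permM /srefl tpermL tpermR up; split=> //; move: red_u; rewrite inversion_number_up // => -[->].
by have := inversion_number_down dn; rewrite -red_u => eq_inv; rewrite eq_inv ltnNge leqnSn in le_u.
Qed.

Inductive braid_step : seq 'I_n.-1 -> seq 'I_n.-1 -> Prop :=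
  | FarStep x r s y : (r.+1 < s)%N || (s.+1 < r)%N ->
      braid_step (x ++ [:: r; s] ++ y) (x ++ [:: s; r] ++ y)
  | BraidUp x r s y : s = r.+1 :> nat ->
      braid_step (x ++ [:: r; s; r] ++ y) (x ++ [:: s; r; s] ++ y)
  | BraidDown x r s y : s = r.+1 :> nat ->
      braid_step (x ++ [:: s; r; s] ++ y) (x ++ [:: r; s; r] ++ y).

Inductive braid_eq : seq 'I_n.-1 -> seq 'I_n.-1 -> Prop :=
  | BraidRefl u : braid_eq u u
  | BraidStep u v w : braid_step u v -> braid_eq v w -> braid_eq u w.

Lemma braid_eq1 u v : braid_step u v -> braid_eq u v.
Proof. by move=> uv; apply: BraidStep uv (BraidRefl _). Qed.

Lemma braid_eq_trans v u w : braid_eq u v -> braid_eq v w -> braid_eq u w.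
Proof. by elim=> // u1 v1 w1 uv _ IH /IH; apply: BraidStep. Qed.

Lemma braid_eq_sym u v : braid_eq u v -> braid_eq v u.
Proof.
elim=> [w|u1 v1 w1 uv _ IH]; first exact: BraidRefl.
apply: braid_eq_trans IH (braid_eq1 _).
by case: uv => x r s y rs; [apply: FarStep; rewrite orbC | apply: BraidDown | apply: BraidUp].
Qed.

Lemma braid_eq_cat u v y : braid_eq u v -> braid_eq (u ++ y) (v ++ y).
Proof.
elim=> [w|u1 v1 w1 uv _ IH]; first exact: BraidRefl.
apply: BraidStep IH.
by case: uv => x r s y' rs; rewrite -!catA; [apply: FarStep | apply: BraidUp | apply: BraidDown].
Qed.

Lemma braid_eq_rcons u v r : braid_eq u v -> braid_eq (rcons u r) (rcons v r).
Proof. by rewrite -!cats1; apply: braid_eq_cat. Qed.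

Lemma srefl_lo r : srefl r (lo r) = hi r.
Proof. exact: tpermL. Qed.
Lemma srefl_hi r : srefl r (hi r) = lo r.
Proof. exact: tpermR. Qed.

Lemma srefl_fix r (k : 'I_n) : k != lo r -> k != hi r -> srefl r k = k.
Proof. by move=> k1 k2; rewrite /srefl tpermD // eq_sym. Qed.

Lemma srefl_far r s : (r.+1 < s)%N || (s.+1 < r)%N ->
  [/\ srefl r (lo s) = lo s, srefl r (hi s) = hi s & (srefl r * srefl s = srefl s * srefl r)%g].
Proof.
move=> rs.
have ne a b : a \in [:: lo r; hi r] -> b \in [:: lo s; hi s] -> b != a.
  rewrite !inE => /orP[]/eqP-> /orP[]/eqP->; rewrite -val_eqE /=; move: rs; clear; lia.
have [l1 l2] : lo s != lo r /\ lo s != hi r by rewrite !ne ?inE ?eqxx ?orbT.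
have [h1 h2] : hi s != lo r /\ hi s != hi r by rewrite !ne ?inE ?eqxx ?orbT.
split; [exact: srefl_fix | exact: srefl_fix|].
apply/permP => k; rewrite !permM.
have fixs b : b \in [:: lo r; hi r] -> srefl s b = b.
  by move=> bs; rewrite srefl_fix // eq_sym ne // !inE eqxx ?orbT.
have [kr|kr] := boolP (k \in [:: lo r; hi r]).
  have kr' : srefl r k \in [:: lo r; hi r].
    by move: kr; rewrite !inE => /orP[]/eqP->; rewrite /srefl ?tpermL ?tpermR eqxx ?orbT.
  by rewrite (fixs k) // fixs.
have fixr b : b \notin [:: lo r; hi r] -> srefl r b = b.
  by rewrite !inE negb_or => /andP[*]; apply: srefl_fix.
rewrite (fixr k) // fixr //; rewrite /srefl; case: tpermP => // _;
by rewrite !inE negb_or ?l1 ?l2 ?h1 ?h2.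
Qed.

Lemma srefl_braid r s : s = r.+1 :> nat ->
  (srefl r * (srefl s * srefl r) = srefl s * (srefl r * srefl s))%g.
Proof.
move=> rs; have def_s : lo s = hi r by apply: val_inj.
have ne : [/\ lo r != hi r, hi r != hi s & lo r != hi s].
  split; rewrite ?lo_neq_hi -?def_s ?lo_neq_hi //; rewrite -val_eqE /= rs.
  by clear; lia.
case: ne => n1 n2 n3; apply/permP => k; rewrite !permM /srefl def_s tperm3 //.
by rewrite (tpermC (hi r)) (tpermC (lo r) (hi r)) tperm3 1?eq_sym // tpermC.
Qed.

(** Matsumoto's theorem. By induction, reduced words with the same product and the
    same last letter are equivalent. Two different last letters r and s are both
    descents, so the longest element of the subgroup they generate can be split off
    at the end, and its two reduced expressions are related by one braid step. *)
Lemma reduced_braid_eq u v : reduced u -> reduced v -> word_perm u = word_perm v ->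
  braid_eq u v.
Proof.
move def_m: (size u) => m; elim: m => [|m IH] in u v def_m *.
  move=> /eqP red_u /eqP red_v eq_uv; have : size v = 0%N by rewrite red_v -eq_uv -red_u.
  by move: def_m => /size0nil-> /size0nil->; apply: BraidRefl.
case/lastP: u def_m => // u r; rewrite size_rcons => -[sz_u] red_ur.
case/lastP: v => [|v s] red_v eq_uv.
  by move/eqP: red_ur; rewrite eq_uv -(eqP red_v) size_rcons.
have sz_v : size v = m.
  apply: succn_inj; rewrite -sz_u -(size_rcons u r) -(size_rcons v s); move/eqP: red_ur => ->.
  by move/eqP: red_v => ->; rewrite eq_uv.
have [red_u dn_r] := reduced_rcons red_ur; have red_v0 := red_v; have [{}red_v dn_s] := reduced_rcons red_v.
move: dn_r dn_s; rewrite eq_uv; set p := word_perm _ => dn_r dn_s.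
have wu : word_perm u = (srefl r * p)%g by rewrite /p -eq_uv word_perm_rcons sreflMK.
have wv : word_perm v = (srefl s * p)%g by rewrite /p word_perm_rcons sreflMK.
have inv_p : inversion_number p = m.+1 by rewrite /p -(eqP red_v0) size_rcons sz_v.
have inv_r : inversion_number (srefl r * p)%g = m by rewrite -wu -(eqP red_u).
have inv_s : inversion_number (srefl s * p)%g = m by rewrite -wv -(eqP red_v).
have link w w' a : reduced w -> size w = m -> word_perm w' = word_perm w ->
    size w' = m -> braid_eq (rcons w a) (rcons w' a).
  move=> red_w sz_w eq_w sz_w'; apply/braid_eq_rcons/IH => //.
  by rewrite /reduced eq_w sz_w' -sz_w.
have [eq_rs|ne_rs] := eqVneq r s.
  by rewrite eq_rs; apply: link; rewrite // wu wv eq_rs.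
have [far_rs|] := boolP ((r.+1 < s)%N || (s.+1 < r)%N).
  have [fix_lo fix_hi comm] := srefl_far far_rs.
  have [z wz sz_z] := exists_reduced (srefl s * (srefl r * p))%g.
  have {}sz_z : (size z).+1 = m.
    by rewrite sz_z -inv_r [RHS](@inversion_number_down _ s) // !permM fix_lo fix_hi.
  apply: braid_eq_trans (link _ (rcons z s) _ red_u sz_u _ _) _.
  - by rewrite word_perm_rcons wz sreflMK wu.
  - by rewrite size_rcons.
  apply: braid_eq_trans (braid_eq_sym (link _ (rcons z r) _ red_v sz_v _ _)).
  - by rewrite -!cats1 -!catA; apply: (braid_eq1 (@FarStep z s r [::] _)); rewrite orbC.
  - by rewrite word_perm_rcons wz wv mulgA comm -mulgA sreflMK.
  - by rewrite size_rcons.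
rewrite negb_or -!leqNgt => near.
have three (a b : 'I_n.-1) : b = a.+1 :> nat ->
    (p (hi a) < p (lo a))%N -> (p (hi b) < p (lo b))%N ->
    exists z, [/\ (size z).+2 = m, word_perm (rcons (rcons z a) b) = (srefl a * p)%g &
      word_perm (rcons (rcons z b) a) = (srefl b * p)%g].
  move=> ab dn_a dn_b; have lo_b : lo b = hi a by apply: val_inj.
  have a_b : lo a != hi b by rewrite -val_eqE /= ab; clear; lia.
  have h_b : hi a != hi b by rewrite -lo_b lo_neq_hi.
  have ha : srefl a (hi b) = hi b by rewrite srefl_fix // eq_sym.
  have hb : srefl b (lo a) = lo a by rewrite srefl_fix // lo_b lo_neq_hi.
  have [z wz sz_z] := exists_reduced (srefl a * (srefl b * (srefl a * p)))%g.
  exists z; rewrite !word_perm_rcons wz; split.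
  - rewrite sz_z; apply: succn_inj; rewrite -inv_p (inversion_number_down dn_a).
    rewrite (@inversion_number_down (srefl a * p)%g b); last first.
      by rewrite !permM ha lo_b srefl_hi (ltn_trans dn_b) // lo_b.
    rewrite (@inversion_number_down (srefl b * (srefl a * p))%g a) // !permM hb -lo_b.
    by rewrite srefl_lo ha srefl_lo -lo_b.
  - by rewrite !sreflMK.
  - have := srefl_braid ab => /(congr1 (fun t => t * p)%g); rewrite -!mulgA => ->.
    by rewrite !sreflMK.
have ne_val : (r : nat) != s by rewrite (inj_eq val_inj).
have [rs|sr] : s = r.+1 :> nat \/ r = s.+1 :> nat.
  by move: near ne_val; clear; lia.
- have [z [sz_z wr ws]] := three r s rs dn_r dn_s.
  apply: braid_eq_trans (link _ (rcons (rcons z r) s) _ red_u sz_u _ _) _; rewrite ?wu ?size_rcons //.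
  apply: braid_eq_trans (braid_eq_sym (link _ (rcons (rcons z s) r) _ red_v sz_v _ _)); rewrite ?wv ?size_rcons //.
  by rewrite -!cats1 -!catA; apply: (braid_eq1 (@BraidUp z r s [::] _)).
- have [z [sz_z ws wr]] := three s r sr dn_s dn_r.
  apply: braid_eq_trans (link _ (rcons (rcons z r) s) _ red_u sz_u _ _) _; rewrite ?wu ?size_rcons //.
  apply: braid_eq_trans (braid_eq_sym (link _ (rcons (rcons z s) r) _ red_v sz_v _ _)); rewrite ?wv ?size_rcons //.
  by rewrite -!cats1 -!catA; apply: (braid_eq1 (@BraidDown z s r [::] _)).
Qed.

(** Cut the word after its longest reduced prefix u: the next letter r is a descent
    of the product of u, so that u is equivalent to a reduced word ending in r. *)
Lemma nonreduced_braid_eq u : ~~ reduced u ->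
  exists x r y, braid_eq u (x ++ [:: r; r] ++ y).
Proof.
elim/last_ind: u => [|u r IH].
  by rewrite /reduced; have := inversion_number_le_size [::]; case: (inversion_number _).
have [red_u|/IH [x [s [y uxy]]] _] := boolP (reduced u); last first.
  by exists x, s, (rcons y r); rewrite -!rcons_cat; apply: braid_eq_rcons.
rewrite /reduced word_perm_rcons size_rcons (eqP red_u).
case/orP: (lo_hi_total (word_perm u) r) => [/inversion_number_up-> /eqP // | dn _].
have [z wz sz_z] := exists_reduced (srefl r * word_perm u)%g.
exists z, r, [::]; have -> : z ++ [:: r; r] ++ [::] = rcons (rcons z r) r by rewrite -!cats1 -catA.
apply: braid_eq_rcons; apply: reduced_braid_eq => //.
  by rewrite /reduced word_perm_rcons wz sreflMK size_rcons sz_z -(inversion_number_down dn).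
by rewrite word_perm_rcons wz sreflMK.
Qed.

(** For a reduced word these are the elements below its product in the Bruhat
    order. *)
Definition subproduct u p := exists2 v, subseq v u & word_perm v = p.

Lemma subproduct_refl u : subproduct u (word_perm u).
Proof. by exists u. Qed.

Lemma subproduct_sub u v p : subseq u v -> subproduct u p -> subproduct v p.
Proof. by move=> uv [w wu wp]; exists w => //; apply: subseq_trans uv. Qed.

Lemma subproduct_cat u v p : subproduct (u ++ v) p <->
  exists p1 p2, [/\ subproduct u p1, subproduct v p2 & p = (p2 * p1)%g].
Proof.
split=> [[w /subseqP[m sz_m ->] <-]|[_ [_ [[w1 w1u <-] [w2 w2v <-] ->]]]]; last first.
  by exists (w1 ++ w2); rewrite ?word_perm_cat // cat_subseq.
have sz1 : size (take (size u) m) = size u by rewrite size_takel // sz_m size_cat leq_addr.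
rewrite -[m](cat_take_drop (size u)) mask_cat // word_perm_cat.
exists (word_perm (mask (take (size u) m) u)), (word_perm (mask (drop (size u) m) v)).
by split=> //; [exists (mask (take (size u) m) u) | exists (mask (drop (size u) m) v)];
  rewrite ?mask_subseq.
Qed.

(** A subword of one side of a braid relation has the same product as a subword of
    the other side; for r s r the subword r r is replaced by the empty one. *)
Lemma subproduct_braid u v p : braid_step u v -> subproduct v p -> subproduct u p.
Proof.
have middle (x m m' y : seq 'I_n.-1) :
    (forall q, subproduct m' q -> subproduct m q) ->
    subproduct (x ++ m' ++ y) p -> subproduct (x ++ m ++ y) p.
  move=> sub_m /subproduct_cat[p1 [q [p1x /subproduct_cat[p2 [p3 [p2m p3y ->]]] ->]]].
  apply/subproduct_cat; exists p1, (p3 * p2)%g; split=> //.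
  by apply/subproduct_cat; exists p2, p3; split=> //; apply: sub_m.
have sub (b : bitseq) (m : seq 'I_n.-1) q : word_perm (mask b m) = q -> subproduct m q.
  by exists (mask b m); rewrite ?mask_subseq.
case=> x r s y rs; apply: middle => q [w /subseqP[b sz_b ->] <-].
- have [_ _ comm] := srefl_far rs.
  case: b sz_b => [|b1 [|b2 [|]]] //= _; case: b1; case: b2.
  + by apply: (sub [:: true; true]); rewrite /= !mul1g; apply: esym comm.
  + exact: (sub [:: false; true]).
  + exact: (sub [:: true; false]).
  + exact: (sub [::]).
- have br := srefl_braid rs.
  case: b sz_b => [|b1 [|b2 [|b3 [|]]]] //= _; case: b1; case: b2; case: b3.
  + by apply: (sub [:: true; true; true]); rewrite /= !mul1g -!mulgA; apply: br.
  + exact: (sub [:: false; true; true]).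
  + by apply: (sub [::]); rewrite /= mul1g tperm2.
  + exact: (sub [:: false; true; false]).
  + exact: (sub [:: true; true; false]).
  + exact: (sub [:: true; false; false]).
  + exact: (sub [:: false; true; false]).
  + exact: (sub [::]).
- have br := srefl_braid rs.
  case: b sz_b => [|b1 [|b2 [|b3 [|]]]] //= _; case: b1; case: b2; case: b3.
  + by apply: (sub [:: true; true; true]); rewrite /= !mul1g -!mulgA; apply: esym br.
  + exact: (sub [:: false; true; true]).
  + by apply: (sub [::]); rewrite /= mul1g tperm2.
  + exact: (sub [:: false; true; false]).
  + exact: (sub [:: true; true; false]).
  + exact: (sub [:: true; false; false]).
  + exact: (sub [:: false; true; false]).
  + exact: (sub [::]).
Qed.

Lemma braid_step_size u v : braid_step u v -> size u = size v.
Proof. by case=> *; rewrite !size_cat. Qed.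

Lemma perm1V : ((1 : {perm 'I_n})^-1)%g = 1%g.
Proof. by apply/permP => k; apply: (@perm_inj _ 1%g); rewrite permKV !perm1. Qed.

Lemma braid_eq_size u v : braid_eq u v -> size u = size v.
Proof. by elim=> // u1 v1 w1 /braid_step_size -> _. Qed.

(** Undo all descents of [p] other than an exchange of [b] and [a] in adjacent
    positions. This never restores the order of [a] and [b], and it ends with a
    permutation whose only descent is that exchange. *)
Lemma reduced_through_one_descent p (a b : 'I_n) : (a < b)%N ->
    ((p^-1)%g b < (p^-1)%g a)%N ->
  exists x y r, [/\ word_perm (x ++ y) = p, reduced (x ++ y),
    word_perm x (lo r) = b, word_perm x (hi r) = a &
    forall s, s != r -> (word_perm x (lo s) < word_perm x (hi s))%N].
Proof.
move=> ab; move def_m: (inversion_number p) => m; elim: m => [|m IH] in p def_m *.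
  move=> ba; have p1 : p = 1%g.
    by apply: no_descent => r; case/orP: (lo_hi_total p r) => // /inversion_number_down; rewrite def_m.
  by move: ba; rewrite p1 perm1V !perm1 ltnNge (ltnW ab).
move=> ba; have [dn|no_dn] :=
    boolP [exists s, (p (hi s) < p (lo s))%N && ~~ ((p (lo s) == b) && (p (hi s) == a))].
  case/existsP: dn => s /andP[dn ne_s].
  have [||x [y [r [wxy red_xy xlo xhi up]]]] := IH (srefl s * p)%g.
  - by apply: succn_inj; rewrite -inversion_number_down.
  - have invE k : ((srefl s * p)^-1)%g k = srefl s ((p^-1)%g k).
      by apply: (@perm_inj _ (srefl s * p)%g); rewrite permKV permM sreflK permKV.
    rewrite !invE; apply: srefl_lt => //.
    apply: contra ne_s => /eqP[<- <-]; by rewrite !permKV !eqxx.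
  exists x, (rcons y s), r; rewrite /reduced -rcons_cat word_perm_rcons wxy sreflMK size_rcons.
  by split=> //; rewrite (eqP red_xy) wxy -inversion_number_down.
have {}no_dn s : (p (hi s) < p (lo s))%N -> p (lo s) = b /\ p (hi s) = a.
  move=> dn; move/existsPn/(_ s): no_dn; rewrite dn /= negbK.
  by case/andP => /eqP ? /eqP ?.
have [r dn_r] : exists r, (p (hi r) < p (lo r))%N.
  apply/existsP; apply: contraTT ba => /existsPn no; rewrite -leqNgt ltnW //.
  have -> : p = 1%g; last by rewrite perm1V !perm1.
  by apply: no_descent => r; case/orP: (lo_hi_total p r) => // dn; case/negP: (no r).
have [x wx sz_x] := exists_reduced p; have [plo phi] := no_dn r dn_r.
exists x, [::], r; rewrite cats0 wx /reduced wx sz_x eqxx plo phi; split=> // s ne_s.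
case/orP: (lo_hi_total p s) => // /no_dn[slo _]; case/eqP: ne_s; apply: val_inj.
by have /(congr1 val) : lo s = lo r by apply: (@perm_inj _ p); rewrite slo plo.
Qed.

End Words.

(** * Local relations modulo an ideal of the blob algebra *)
Section Blob.
Variables (F : fieldType) (e l n : nat) (kap : 'I_l -> 'Z_e).
Local Notation B := (blob F n kap).
Implicit Types (i j : resseq e n) (k m : 'I_n) (r s : 'I_n.-1) (x a b : B).

Definition psi r : B := bgen F kap (GenPsi r).
Definition dot k : B := bgen F kap (GenY k).
Definition idem i : B := bgen F kap (GenE i).

Let BR := blob_relationsP F n kap.
Let K := blob_klr BR.

Lemma idemM i j : idem i * idem j = if i == j then idem i else 0.
Proof. exact: (klr_idem K). Qed.
Lemma idemK i : idem i * idem i = idem i.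
Proof. by rewrite idemM eqxx. Qed.
Lemma idem_sum : \sum_i idem i = 1.
Proof. exact: (klr_sum1 K). Qed.
Lemma idem_first i k : k = 0%N :> nat -> i k \notin codom kap -> idem i = 0.
Proof. exact: (klr_first K). Qed.
Lemma dot_first i k : k = 0%N :> nat -> i k \in codom kap -> dot k * idem i = 0.
Proof. exact: (klr_y_first K). Qed.
Lemma dot_idem k i : dot k * idem i = idem i * dot k.
Proof. exact: (klr_y_e K). Qed.
Lemma psi_idem r i : psi r * idem i = idem (swap r i) * psi r.
Proof. exact: (klr_psi_e K). Qed.
Lemma dot_comm k m : dot k * dot m = dot m * dot k.
Proof. exact: (klr_y_y K). Qed.
Lemma psi_dot r k : k != lo r -> k != hi r -> psi r * dot k = dot k * psi r.
Proof. exact: (klr_psi_y K). Qed.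
Lemma psi_psi r s : (r.+1 < s)%N || (s.+1 < r)%N -> psi r * psi s = psi s * psi r.
Proof. exact: (klr_psi_psi K). Qed.
Lemma psi_dot_hi r i : psi r * dot (hi r) * idem i =
  (dot (lo r) * psi r - (i (lo r) == i (hi r))%:R) * idem i.
Proof. exact: (klr_psi_yhi K). Qed.
Lemma dot_hi_psi r i : dot (hi r) * psi r * idem i =
  (psi r * dot (lo r) - (i (lo r) == i (hi r))%:R) * idem i.
Proof. exact: (klr_yhi_psi K). Qed.
Lemma psi2_eq r i : i (lo r) = i (hi r) -> psi r * psi r * idem i = 0.
Proof. exact: (klr_quad_eq K). Qed.
Lemma psi2_far r i : far (i (lo r)) (i (hi r)) -> psi r * psi r * idem i = idem i.
Proof.
case/and3P=> n0 n1 n2; apply: (klr_quad_far K) => //.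
by apply: contra n2 => /eqP ->; rewrite subrK.
Qed.
Lemma psi2_down r i : i (hi r) = i (lo r) - 1 ->
  psi r * psi r * idem i = (dot (lo r) - dot (hi r)) * idem i.
Proof. exact: (klr_quad_down K). Qed.
Definition braid_coef r s i : F :=
  if (i (hi s) == i (lo r)) && (i (lo r) == i (hi r) - 1) then - 1
  else if (i (hi s) == i (lo r)) && (i (lo r) == i (hi r) + 1) then 1
  else 0.
Lemma scaleE (c : F) x : c *: x = pscalar _ c * x.
Proof. by []. Qed.
Lemma scaleAl (c : F) x a : c *: (x * a) = (c *: x) * a.
Proof. exact: pscalerAl. Qed.
Lemma scaleAr (c : F) x a : c *: (x * a) = x * (c *: a).
Proof. exact: pscalerAr. Qed.
Lemma psi_braid r s i : s = r.+1 :> nat ->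
  psi r * psi s * psi r * idem i =
  psi s * psi r * psi s * idem i + braid_coef r s i *: idem i.
Proof.
move=> rs; have -> : psi r * psi s * psi r * idem i =
    (psi s * psi r * psi s + braid_error (blob_algebra F n kap) r s i) * idem i.
  exact: (klr_braid K).
rewrite mulrDl; congr (_ + _); rewrite /braid_error /braid_coef.
case: ifP => _; first by rewrite scaleN1r mulN1r.
by case: ifP => _; rewrite ?scale1r ?mul1r ?scale0r ?mul0r.
Qed.
Lemma dagger i k m : k = 0%N :> nat -> m = 1%N :> nat -> i k \in codom kap ->
  i m = i k + 1 -> idem i = 0.
Proof. exact: (blob_dagger BR). Qed.
Lemma idem_psi r i : idem i * psi r = psi r * idem (swap r i).
Proof. by rewrite psi_idem swapK. Qed.

(* The relations read in the converse algebra are those with the idempotent on the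
   left. *)
Let K' := klr_converse K.
Lemma idem_psi2_eq r i : i (lo r) = i (hi r) -> idem i * (psi r * psi r) = 0.
Proof. exact: (klr_quad_eq K'). Qed.
Lemma idem_psi2_far r i : far (i (lo r)) (i (hi r)) ->
  idem i * (psi r * psi r) = idem i.
Proof.
case/and3P=> n0 n1 n2; apply: (klr_quad_far K') => //.
by apply: contra n2 => /eqP ->; rewrite subrK.
Qed.
Lemma idem_psi2_up r i : i (hi r) = i (lo r) + 1 ->
  idem i * (psi r * psi r) = idem i * (dot (hi r) - dot (lo r)).
Proof. exact: (klr_quad_up K'). Qed.
Lemma idem_psi2_down r i : i (hi r) = i (lo r) - 1 ->
  idem i * (psi r * psi r) = idem i * (dot (lo r) - dot (hi r)).
Proof. exact: (klr_quad_down K'). Qed.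
Lemma idem_psi_braid r s i : s = r.+1 :> nat ->
  exists c : F, idem i * (psi r * (psi s * psi r)) =
    idem i * (psi s * (psi r * psi s)) + c *: idem i.
Proof.
move=> rs; exists (braid_coef r s i).
have -> : idem i * (psi r * (psi s * psi r)) = idem i * (psi s * (psi r * psi s) +
    braid_error (blob_algebra F n kap) r s i) by exact: (klr_braid K').
rewrite mulrDr; congr (_ + _); rewrite /braid_error /braid_coef.
case: ifP => _; first by rewrite scaleN1r mulrN1.
by case: ifP => _; rewrite ?scale1r ?mulr1 ?scale0r ?mulr0.
Qed.
(** A dot passes from right to left through a crossing up to a scalar multiple of the
    idempotent, that is, up to deleting the crossing. *)
Lemma idem_psi_dot r i m : exists c : F, idem i * (psi r * dot m) =
  idem i * (dot (srefl r m) * psi r) + c *: idem i.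
Proof.
have mul_nat (b : bool) : idem i * b%:R = b%:R *: idem i.
  by case: b; rewrite ?mulr1 ?scale1r ?mulr0 ?scale0r.
have hi_r : idem i * (psi r * dot (hi r)) =
    idem i * (dot (lo r) * psi r - (i (lo r) == i (hi r))%:R) by exact: (klr_yhi_psi K').
have lo_r : idem i * (dot (hi r) * psi r) =
    idem i * (psi r * dot (lo r) - (i (lo r) == i (hi r))%:R) by exact: (klr_psi_yhi K').
have [->|ml] := eqVneq m (lo r).
  exists (i (lo r) == i (hi r))%:R; rewrite srefl_lo lo_r mulrBr mul_nat subrK //.
have [->|mh] := eqVneq m (hi r).
  by exists (- (i (lo r) == i (hi r))%:R); rewrite srefl_hi hi_r mulrBr mul_nat scaleNr.
by exists 0; rewrite srefl_fix // scale0r addr0 psi_dot.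
Qed.

Record ideal (I : B -> Prop) : Prop := Ideal {
  ideal0 : I 0;
  idealD a b : I a -> I b -> I (a + b);
  idealMl x a : I a -> I (x * a);
  idealMr a x : I a -> I (a * x)
}.

Section Ideal.
Variables (I : B -> Prop) (idI : ideal I).

Let I0 := ideal0 idI.
Let ID := idealD idI.
Let IMl := idealMl idI.
Let IMr := idealMr idI.

Lemma idealZ (c : F) a : I a -> I (c *: a).
Proof. by rewrite scaleE; apply: IMl. Qed.
Lemma idealN a : I a -> I (- a).
Proof. by rewrite -scaleN1r; apply: idealZ. Qed.
Lemma idealB a b : I a -> I b -> I (a - b).
Proof. by move=> Ia Ib; apply: ID => //; apply: idealN. Qed.

Lemma ideal_far r i : far (i (lo r)) (i (hi r)) -> I (idem (swap r i)) -> I (idem i).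
Proof.
move=> fr Is; rewrite -(psi2_far fr) -mulrA psi_idem.
by apply: IMl; apply: IMr.
Qed.

Lemma psi_dot_lo r i : psi r * dot (lo r) * idem i =
  dot (hi r) * psi r * idem i + (i (lo r) == i (hi r))%:R * idem i.
Proof. by rewrite dot_hi_psi mulrBl subrK. Qed.

(** Let p be the crossing of two strands of equal residue, e the idempotent and y the
    dot on the left strand, so that p p e = 0, p y p e = p e and
    e = y p e - p e y' with y' the dot on the right strand. If y agrees on e, modulo
    the ideal, with an element z that commutes with p, then
    p e = p (y e - z e) p is in the ideal because p z p e = z p p e = 0; hence so
    is e. *)
Lemma ideal_slide r i (z : B) : i (lo r) = i (hi r) ->
  z * psi r = psi r * z -> I (dot (lo r) * idem i - z * idem i) -> I (idem i).
Proof.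
move=> eq_i comm Iz.
have e_p : idem i * psi r = psi r * idem i by rewrite idem_psi swap_id.
have psi2 : psi r * (psi r * idem i) = 0 by rewrite mulrA psi2_eq.
have Ip : I (psi r * idem i).
  have -> : psi r * idem i = psi r * ((dot (lo r) * idem i - z * idem i) * psi r).
    rewrite mulrBl mulrBr -!mulrA e_p (mulrA _ z) -comm -!mulrA psi2 mulr0 subr0.
    have := congr1 (fun u => psi r * u) (psi_dot_hi r i).
    rewrite eq_i eqxx /= mulrBl mul1r mulrBr !mulrA -!(mulrA _ (dot (hi r))).
    by rewrite dot_idem !mulrA -(mulrA (psi r)) psi2 mul0r => /esym /subr0_eq <-; rewrite -!mulrA.
  by apply: IMl; apply: IMr.
have -> : idem i = dot (lo r) * (psi r * idem i) - psi r * idem i * dot (hi r).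
  by rewrite -[in X in _ - X]mulrA -dot_idem !mulrA psi_dot_hi eq_i eqxx mulrBl mul1r opprB addrCA addrN addr0.
by apply: idealB => //; [apply: IMl | apply: IMr].
Qed.

(** Modulo the ideal, the square of the first crossing vanishes on e; so the dots on
    the strands of residues c + 1 and c agree, and [ideal_slide] applies with the
    former in the role of z. *)
Lemma ideal_double r s i : s = r.+1 :> nat -> i (lo r) = i (hi r) + 1 ->
  i (hi r) = i (hi s) -> I (idem (swap r i)) -> I (idem i).
Proof.
move=> rs i1 i2 Is; have lo_s : lo s = hi r by apply: val_inj.
apply: (@ideal_slide s i (dot (lo r))); first by rewrite lo_s.
  by rewrite psi_dot // -val_eqE /= rs; clear; lia.
rewrite lo_s -mulrBl -opprB mulNr -psi2_down; last by rewrite i1 addrK.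
by apply: idealN => //; rewrite -mulrA psi_idem; apply: IMl; apply: IMr.
Qed.

(** The error term of the braid relation is, up to sign, the idempotent itself. *)
Lemma ideal_braid r s i : s = r.+1 :> nat -> i (lo r) = i (hi s) ->
  i (hi r) = i (lo r) - 1 -> I (idem (swap r i)) -> I (idem (swap s i)) -> I (idem i).
Proof.
move=> rs i1 i2 Ir Is; have br := psi_braid i rs.
have : I (braid_coef r s i *: idem i).
  have -> : braid_coef r s i *: idem i =
      psi r * psi s * psi r * idem i - psi s * psi r * psi s * idem i by rewrite br addrC addKr.
  by apply: idealB => //; rewrite -mulrA psi_idem; apply: IMl; apply: IMr.
rewrite /braid_coef i1 i2 eqxx -i1 subrK eqxx /=.
case: ifP => _; last by rewrite scale1r.
by rewrite scaleN1r => /idealN; rewrite opprK.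
Qed.

(** The first dot vanishes, so [ideal_slide] applies with z = 0. *)
Lemma ideal_equal_first r i : r = 0%N :> nat -> i (lo r) = i (hi r) -> I (idem i).
Proof.
move=> r0 eq_i; have [ik|ik] := boolP (i (lo r) \in codom kap); last first.
  by rewrite (idem_first (k := lo r)) //; apply: I0.
apply: (@ideal_slide r i 0) => //; rewrite ?mul0r ?mulr0 // subr0 dot_first //.
Qed.

(** A dot is conjugated by an invertible crossing. *)
Lemma ideal_dot_far r k i : far (i (lo r)) (i (hi r)) ->
  I (dot (tperm (lo r) (hi r) k) * idem (swap r i)) -> I (dot k * idem i).
Proof.
move=> fr Iy.
have psi_far : psi r * dot (tperm (lo r) (hi r) k) * idem (swap r i) = dot k * psi r * idem (swap r i).
  have ne : (swap r i (lo r) == swap r i (hi r)) = false.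
    by rewrite swap_lo swap_hi eq_sym; apply/negbTE; case/and3P: fr.
  case: tpermP => [->|->|k1 k2]; last by rewrite psi_dot //; apply/eqP.
    by rewrite psi_dot_hi ne subr0.
  by rewrite psi_dot_lo ne mul0r addr0.
have -> : dot k * idem i =
    psi r * (dot (tperm (lo r) (hi r) k) * idem (swap r i)) * psi r.
  by rewrite mulrA psi_far -!mulrA -psi_idem (mulrA (psi r)) psi2_far.
by apply: IMr; apply: IMl.
Qed.

(** For adjacent residues the square of the crossing is a difference of dots. *)
Lemma ideal_dot_step r i : i (hi r) = i (lo r) - 1 ->
  I (dot (lo r) * idem i) -> I (idem (swap r i)) -> I (dot (hi r) * idem i).
Proof.
move=> i_dn Iy Is.
have -> : dot (hi r) * idem i = dot (lo r) * idem i - psi r * psi r * idem i.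
  by rewrite psi2_down // mulrBl opprB addrC subrK.
by apply: idealB => //; rewrite -mulrA psi_idem; apply: IMl; apply: IMr.
Qed.

End Ideal.

Section Sequences.

Definition seq_res (s : seq 'Z_e) : resseq e n := [ffun k : 'I_n => nth 0 s k].

Lemma seq_resE (s : seq 'Z_e) (k : 'I_n) : seq_res s k = nth 0 s k.
Proof. by rewrite ffunE. Qed.

Lemma seq_res_pos (X Y : seq 'Z_e) c d : size (X ++ c :: d :: Y) = n ->
  exists r : 'I_n.-1, [/\ r = size X :> nat, seq_res (X ++ c :: d :: Y) (lo r) = c,
    seq_res (X ++ c :: d :: Y) (hi r) = d &
    swap r (seq_res (X ++ c :: d :: Y)) = seq_res (X ++ d :: c :: Y)].
Proof.
rewrite size_cat /= => sz; have Xn : (size X < n.-1)%N by move: sz; clear; lia.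
have nthX (u : seq 'Z_e) (a b : 'Z_e) : nth 0 (X ++ a :: b :: u) (size X) = a.
  by rewrite nth_cat ltnn subnn.
have nthX1 (u : seq 'Z_e) (a b : 'Z_e) : nth 0 (X ++ a :: b :: u) (size X).+1 = b.
  by rewrite nth_cat ltnNge leqnSn /= subSnn.
exists (Ordinal Xn); split; rewrite ?seq_resE //=.
apply/ffunP => k; rewrite ffunE !seq_resE; case: tpermP => [->|->|kl kh] /=.
- by rewrite nthX nthX1.
- by rewrite nthX nthX1.
have {}kl : (k : nat) <> size X by move=> kX; apply: kl; apply: val_inj.
have {}kh : (k : nat) <> (size X).+1 by move=> kX; apply: kh; apply: val_inj.
rewrite !nth_cat; case: ltnP => // Xk.
by case def_k: (k - size X)%N => [|[|m]] //=; move: def_k kl kh Xk; clear; lia.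
Qed.

(** The residue of the node with code [x]; for a code smaller than [l] it is the
    residue that a node above the first row would have. The default value 0 never
    occurs for positive [l]. *)
Definition code_res (x : nat) : 'Z_e :=
  oapp kap 0 (insub (x %% l)%N) + 1 - (x %/ l)%:R.

Lemma code_res_node (rw : nat) (m : 'I_l) :
  code_res (rw * l + m) = kap m + 1 - rw%:R.
Proof.
have l_gt0 : (0 < l)%N by apply: leq_ltn_trans (ltn_ord m).
rewrite /code_res modnMDl modn_small ?ltn_ord // divnMDl // divn_small ?ltn_ord // addn0.
by rewrite insubT //= => lt_m; congr (kap _ + _ - _); apply: val_inj.
Qed.

Lemma code_res_down (x : nat) : (0 < l)%N -> code_res (x + l) = code_res x - 1.
Proof.
move=> l_gt0; rewrite /code_res modnDr divnDr ?dvdnn // divnn l_gt0.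
by rewrite natrD opprD addrA.
Qed.

(** The moves preserve lengths but are stated for sequences of all lengths, so
    sequences of length other than [n] are admitted trivially. *)
Definition in_ideal (I : B -> Prop) (s : seq 'Z_e) := size s = n -> I (idem (seq_res s)).

Lemma in_ideal_closed (I : B -> Prop) : ideal I -> (0 < l)%N ->
  closed_under_moves l code_res (in_ideal I).
Proof.
move=> idI l_gt0; have I0 := ideal0 idI.
have sz_eq (X Y Y' : seq 'Z_e) : size Y = size Y' -> size (X ++ Y) = n -> size (X ++ Y') = n.
  by rewrite !size_cat => ->.
have first_codom (x : nat) : (l <= x < l + l)%N -> code_res x \in codom kap.
  move=> /andP[lx xl]; have xl' : (x - l < l)%N by move: lx xl; clear; lia.
  have -> : code_res x = kap (Ordinal xl').
    by have := code_res_node 1 (Ordinal xl'); rewrite mul1n /= subnKC // addrK.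
  exact: codom_f.
have pos2 (X Y : seq 'Z_e) (c d d' : 'Z_e) : size (X ++ c :: d :: d' :: Y) = n ->
    exists r s : 'I_n.-1, let i := seq_res (X ++ c :: d :: d' :: Y) in
    [/\ s = r.+1 :> nat, [/\ i (lo r) = c, i (hi r) = d & i (hi s) = d'],
      swap r i = seq_res (X ++ d :: c :: d' :: Y) &
      swap s i = seq_res (X ++ c :: d' :: d :: Y)].
  move=> sz; have [r [def_r lr hr sw]] := seq_res_pos sz.
  have sz' : size (rcons X c ++ d :: d' :: Y) = n by rewrite cat_rcons.
  have [s [def_s _ hs sw']] := seq_res_pos sz'.
  rewrite !cat_rcons in hs sw'; exists r, s; split=> //.
  by rewrite def_s def_r size_rcons.
split=> [X c d Y fr Zs sz|X c Y Zs sz|X c Y Z1 Z2 sz|c Y no_c sz|c Y sz|x Y lx sz].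
- have [r [_ lr hr sw]] := seq_res_pos sz.
  apply: (ideal_far idI (r := r)); rewrite ?lr ?hr ?sw 1?farC //.
  by apply: Zs; apply: sz_eq sz.
- have [r [s [rs [lr hr hs] sw _]]] := pos2 _ _ _ _ _ sz.
  apply: (ideal_double idI rs); rewrite ?lr ?hr ?hs // sw.
  by apply: Zs; apply: sz_eq sz.
- have [r [s [rs [lr hr hs] sw sw']]] := pos2 _ _ _ _ _ sz.
  apply: (ideal_braid idI rs); rewrite ?lr ?hr ?hs // ?sw ?sw'.
    by apply: Z1; apply: sz_eq sz.
  by apply: Z2; apply: sz_eq sz.
- have n_gt0 : (0 < n)%N by rewrite -sz.
  rewrite (idem_first (k := Ordinal n_gt0)) // seq_resE /=; apply/codomP => -[m def_c].
  have := no_c (l + m)%N; rewrite leq_addr ltn_add2l ltn_ord.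
  by have := code_res_node 1 m; rewrite mul1n addrK => -> /(_ isT); rewrite def_c eqxx.
- have [r [r0 lr hr _]] := seq_res_pos (X := [::]) sz.
  by apply: (ideal_equal_first idI r0); rewrite lr hr.
- have [r [r0 lr hr _]] := seq_res_pos (X := [::]) sz.
  rewrite (dagger (k := lo r) (m := hi r)) //= ?r0 //; first by rewrite lr first_codom.
  by rewrite lr hr.
Qed.

End Sequences.

Lemma star0 : star (0 : B) = 0.
Proof. by have := starZ 0 (0 : B); rewrite !scale0r. Qed.
Lemma star1 : star (1 : B) = 1.
Proof. by have := starM (star (1 : B)) 1; rewrite mulr1 !starK mulr1. Qed.

End Blob.

(** * Residues of nearby nodes *)
Section Charges.
Variables (e l n : nat) (khat : 'I_l -> int).
Hypothesis khat_saf : strongly_adjacency_free e n khat.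
Hypotheses (e_gt1 : (1 < e)%N) (l_gt1 : (1 < l)%N).
Local Notation kap := (charge e khat).

Lemma kap_diff (m m' : 'I_l) : m != m' ->
  [/\ kap m != kap m', kap m != kap m' + 1 & kap m' != kap m + 1].
Proof.
move=> /(saf_far khat_saf); rewrite !inE !negb_or => /and3P[n0 n1 n2].
split; first by rewrite -subr_eq0.
  by apply: contra n1 => /eqP ->; rewrite addrC addKr.
by apply: contra n2 => /eqP ->; rewrite opprD addrA subrr add0r.
Qed.

Lemma Zp_lt (z : 'Z_e) : (z < e)%N.
Proof. by apply: leq_trans (ltn_ord z) _; rewrite Zp_cast. Qed.

(** For e = 2 any two elements of Z/e are equal or adjacent, so there would be room for
    a single component only. *)
Lemma Zp_two_neq0 : 1 + 1 != 0 :> 'Z_e.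
Proof.
apply/eqP => e2.
have def_e : e = 2%N.
  have : (2%:R : 'Z_e) = 0%N :> nat by rewrite -[2%:R]/(1 + 1) e2.
  rewrite val_Zp_nat // => e_dvd2; apply/eqP; rewrite eqn_leq e_gt1 andbT leqNgt.
  by apply/negP => e_gt2; rewrite modn_small in e_dvd2.
have Z01 (z : 'Z_e) : z = 0 \/ z = 1.
  have : (z < 2)%N by apply: leq_trans (Zp_lt z) _; rewrite def_e.
  by move: (natr_Zp z); case: (nat_of_ord z) => [|[|k]] // <- _; [left | right].
pose m0 := Ordinal (ltnW l_gt1); pose m1 := Ordinal l_gt1.
have [//|d0 d1 d2] := kap_diff (m := m0) (m' := m1).
move: d0 d1 d2.
by case: (Z01 (kap m0)) => ->; case: (Z01 (kap m1)) => ->; rewrite ?eqxx ?add0r ?e2 ?eqxx.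
Qed.

(** The residues increase with the component and no two of them are adjacent, so an
    equality could only come from wrapping around at e. Then kap m is at least e - 2
    and kap m' at most 1, which forces m' to be the first component and m the last,
    and these are excluded by the condition on the ends. *)
Lemma kap_no_wrap (m m' : 'I_l) : (m' < m)%N -> kap m' != kap m + 1 + 1.
Proof.
move=> lt_m; apply/eqP => eq_k.
have vlt := saf_incr khat_saf lt_m.
have valD (z : 'Z_e) k : z + k%:R = ((z + k) %% e)%N :> nat.
  by rewrite -[z in LHS]natr_Zp -natrD val_Zp_nat.
have eq_v : kap m' = ((kap m + 2) %% e)%N :> nat by rewrite eq_k -addrA -[1 + 1]/(2%:R) valD.
have small (a b : 'I_l) : (a < b)%N -> kap b <> (kap a).+1 :> nat.
  move=> ab eq_ab; have [|_ _ /eqP[]] := kap_diff (m := a) (m' := b).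
    by apply: contraTneq ab => ->; rewrite ltnn.
  by apply: ord_inj; rewrite (valD _ 1%N) modn_small ?addn1 -?eq_ab // Zp_lt.
have l_gt0 := ltnW l_gt1.
have lt_last : (l.-1 < l)%N by rewrite prednK.
have wrap : (e <= kap m + 2)%N.
  rewrite leqNgt; apply/negP => no_wrap; move: eq_v vlt; rewrite modn_small // => ->.
  by rewrite ltnNge leq_addr.
have {}eq_v : (kap m' + e = kap m + 2)%N.
  rewrite eq_v -{1}(subnK wrap) modnDr modn_small ?subnK //.
  by have := Zp_lt (kap m); move: wrap e_gt1; clear; lia.
have m'0 : m' = 0%N :> nat.
  apply/eqP; rewrite -leqn0 leqNgt; apply/negP => m'_gt0.
  have lt0 := saf_incr khat_saf (m := Ordinal l_gt0) m'_gt0.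
  apply: (small (Ordinal l_gt0) m') => //.
  by move: lt0 eq_v (Zp_lt (kap m)); clear; lia.
have mlast : m.+1 = l.
  apply/eqP; rewrite eqn_leq ltn_ord /= leqNgt; apply/negP => m_lt.
  have m_lt' : (m < l.-1)%N by move: m_lt; clear; lia.
  have lt1 := saf_incr khat_saf (m' := Ordinal lt_last) m_lt'.
  apply: (small m (Ordinal lt_last)) => //.
  by move: lt1 eq_v (Zp_lt (kap (Ordinal lt_last))); clear; lia.
by case/negP: (saf_ends khat_saf m'0 mlast); rewrite eq_k -addrA.
Qed.

Lemma far_shift (c d t : 'Z_e) : far (c + t) (d + t) = far c d.
Proof. by rewrite /far !(addrAC _ t) !(inj_eq (addIr t)). Qed.

(** Nodes at distance less than [l] are in the same row, in different columns, or [y]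
    is one row below [x] in an earlier column. In the second case the residue of [y]
    is shifted by -1, and [kap_no_wrap] excludes the remaining coincidence. *)
Lemma code_res_far x y : (x < y < x + l)%N -> far (code_res kap x) (code_res kap y).
Proof.
have l_gt0 := ltnW l_gt1; case/andP=> xy yx.
have codeE z : exists m : 'I_l, z = (z %/ l * l + m)%N.
  have ml : (z %% l < l)%N by rewrite ltn_mod.
  by exists (Ordinal ml); rewrite /= -divn_eq.
have row_ge := leq_div2r l (ltnW xy).
have : (y %/ l <= x %/ l + 1)%N.
  by have := leq_div2r l (ltnW yx); rewrite divnDr ?dvdnn // divnn l_gt0.
have [m def_x] := codeE x; have [m' def_y] := codeE y.
move: (x %/ l)%N (y %/ l)%N def_x def_y row_ge => r r' def_x def_y row_ge row_le.
rewrite def_x def_y !code_res_node -!(addrA (kap _)); rewrite def_x def_y in xy yx.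
have [rr|rr] : r' = r \/ r' = r.+1 by move: row_ge row_le; clear; lia.
- have [|d0 d1 d2] := kap_diff (m := m) (m' := m').
    by move: xy; rewrite rr ltn_add2l -val_eqE ltn_neqAle => /andP[].
  by rewrite rr far_shift /far d0 d1 d2.
have lt_m : (m' < m)%N by move: yx; rewrite rr; clear; lia.
have [|d0 d1 d2] := kap_diff (m := m) (m' := m').
  by rewrite eq_sym; apply: contraTneq lt_m => ->; rewrite ltnn.
have d3 := kap_no_wrap lt_m.
have -> : 1 - r'%:R = - 1 + (1 - r%:R) :> 'Z_e by rewrite rr -natr1 opprD addrA addrC.
rewrite (addrA (kap m')) far_shift.
rewrite /far subrK d0 /=; apply/andP; split.
  by apply: contra d2 => /eqP ->; rewrite subrK.
by apply: contra d3 => /eqP <-; rewrite subrK.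
Qed.
End Charges.

(** * Multipartitions and tableaux in terms of codes *)
Section Codes.
Variables (l n : nat).
Hypothesis l_gt0 : (0 < l)%N.
Implicit Types (g : box l n) (lam mu : par l n) (t v : tableau l n).

Definition node_code (g : node l) := (g.1.+1 * l + g.2)%N.
Definition code g := node_code (node_of g).
Definition codes lam := map code (node_seq lam).

Lemma code_row_lt (r r' : nat) (m m' : 'I_l) : (r < r')%N ->
  (node_code (r, m) < node_code (r', m'))%N.
Proof.
move=> rr; apply: (@leq_trans (r'.+1 * l)); last exact: leq_addr.
apply: (@leq_trans (r.+2 * l)); first by rewrite [leqRHS]mulSnr ltn_add2l.
by rewrite leq_mul2r ltnS rr orbT.
Qed.

Lemma node_lt_code (g g' : node l) : node_lt g g' = (node_code g' < node_code g)%N.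
Proof.
case: g g' => [r m] [r' m']; rewrite /node_lt /=.
case: (ltngtP r' r) => [rr|rr|->] /=.
- by rewrite code_row_lt.
- by rewrite ltnNge ltnW ?code_row_lt.
- by rewrite /node_code ltn_add2l.
Qed.

Lemma code_divn g : (code g %/ l = g.1.+1)%N.
Proof. by rewrite /code /node_code /= divnMDl // divn_small ?ltn_ord // addn0. Qed.
Lemma code_modn g : (code g %% l = g.2)%N.
Proof. by rewrite /code /node_code /= modnMDl modn_small ?ltn_ord. Qed.
Lemma code_inj : injective code.
Proof.
move=> g g' eq_c; have /= := congr1 (divn^~ l) eq_c; have /= := congr1 (modn^~ l) eq_c.
rewrite !code_divn !code_modn; case: g g' {eq_c} => [r m] [r' m'] /= /val_inj -> [].
by move=> /val_inj ->.
Qed.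
Lemma code_ge g : (l <= code g)%N.
Proof. by rewrite /code /node_code mulSn -addnA leq_addr. Qed.

Lemma codes_nth lam (k : 'I_n) : nth 0%N (codes lam) k = code (initial_tab lam k).
Proof.
rewrite (initial_tabE _ (initial_tab lam k)) (nth_map (initial_tab lam k)) //.
by rewrite (eqP (size_node_seq lam)).
Qed.

Lemma size_codes lam : size (codes lam) = n.
Proof. by rewrite size_map (eqP (size_node_seq lam)). Qed.

Lemma mem_codes lam g : (code g \in codes lam) = (g.1 < val lam g.2)%N.
Proof. by rewrite (mem_map code_inj) mem_sort mem_enum inE. Qed.

Lemma codes_sorted lam : sorted ltn (codes lam).
Proof.
apply/(sortedP 0%N) => k; rewrite size_codes => kn.
have := codes_nth lam (Ordinal (ltnW kn)); have := codes_nth lam (Ordinal kn).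
by move=> /= -> ->; rewrite -node_lt_code; apply: initial_tab_decr => /=.
Qed.

Lemma codes_ltn lam (j k : 'I_n) :
  (code (initial_tab lam j) < code (initial_tab lam k))%N = (j < k)%N.
Proof.
have mono (i i' : 'I_n) : (i < i')%N -> (code (initial_tab lam i) < code (initial_tab lam i'))%N.
  by move=> /(initial_tab_decr lam); rewrite node_lt_code.
case: (ltngtP j k) => [/mono //|/mono /ltnW|/val_inj ->]; last exact: ltnn.
by rewrite leqNgt => /negbTE.
Qed.

Lemma codes_shape lam : is_shape l (codes lam).
Proof.
split=> [|x]; first exact: codes_sorted.
case/mapP=> g; rewrite mem_sort mem_enum inE => g_lam ->; split; first exact: code_ge.
rewrite /with_row0 mem_cat mem_iota add0n; case: (posnP g.1) => [g0|g_gt0].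
  by rewrite /code /node_code /= g0 mul1n addnC addnK ltn_ord.
have lt_n : (g.1.-1 < n)%N by rewrite prednK // ltnW.
apply/orP; right; have -> : (code g - l)%N = code (Ordinal lt_n, g.2).
  by rewrite /code /node_code /= prednK // mulSn -addnA addKn.
by rewrite mem_codes /= prednK // ltnW.
Qed.

Lemma diagram_inj : injective (@diagram l n).
Proof.
move=> lam mu eq_d; apply/val_inj/ffunP => m.
have le (a b : par l n) : diagram a = diagram b -> (val a m <= val b m)%N.
  move=> eq_ab; rewrite leqNgt; apply/negP => lt_ab.
  have lt_n : (val b m < n)%N by apply: leq_trans lt_ab _; rewrite -ltnS ltn_ord.
  have := in_setT (Ordinal lt_n, m); have /setP/(_ (Ordinal lt_n, m)) := eq_ab.
  by rewrite !inE /= lt_ab ltnn.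
by apply: val_inj; apply/eqP; rewrite eqn_leq !le.
Qed.

Lemma card_codes (P : pred nat) lam :
  #|[set g in diagram lam | P (code g)]| = count P (codes lam).
Proof.
rewrite /codes count_map (seq.permP (permEl (perm_sort _ _))) cardE -size_filter.
apply/perm_size/uniq_perm; [exact: enum_uniq | exact: filter_uniq (enum_uniq _) |] => g.
by rewrite mem_enum [RHS]mem_filter mem_enum !inE andbC.
Qed.

Lemma card_above lam (g0 : node l) :
  #|[set g in diagram lam | node_lt g0 (node_of g)]| =
  count (fun x => x < node_code g0)%N (codes lam).
Proof.
rewrite -card_codes; congr #|pred_of_set _|.
by apply/setP => g; rewrite !inE node_lt_code.
Qed.

Lemma set_le_codes lam mu :
  (forall c, count (fun x => c <= x)%N (codes mu) <= count (fun x => c <= x)%N (codes lam))%N ->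
  par_le lam mu.
Proof.
move=> le_c g0.
have countE a : count (fun x => x < node_code g0)%N (codes a) =
    (n - count (fun x => node_code g0 <= x) (codes a))%N.
  rewrite -(size_codes a) -(count_predC (fun x => node_code g0 <= x)%N) addKn.
  by apply: eq_count => x /=; rewrite ltnNge.
by rewrite !card_above !countE leq_sub2l.
Qed.

(** Membership of a node can be recovered from the counting functions as the
    difference of two consecutive values. *)
Lemma par_le_anti lam mu : par_le lam mu -> par_le mu lam -> lam = mu.
Proof.
move=> le1 le2; apply/diagram_inj/setP => g.
have eq_count c : (l <= c)%N ->
    count (fun x => x < c)%N (codes lam) = count (fun x => x < c)%N (codes mu).
  move=> lc; have c_m : (c %% l < l)%N by rewrite ltn_mod.
  have -> : c = node_code ((c %/ l).-1, Ordinal c_m).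
    by rewrite /node_code /= prednK ?divn_gt0 // -divn_eq.
  by rewrite -!card_above; apply/eqP; rewrite eqn_leq le1 le2.
have memE a : (g \in diagram a) =
    (count (fun x => x < (code g).+1) (codes a) - count (fun x => x < code g) (codes a))%N :> nat.
  rewrite inE -mem_codes -count_uniq_mem; last exact: sorted_uniq ltn_trans ltnn _ (codes_sorted a).
  suff -> : count (fun x => x < (code g).+1)%N (codes a) =
      (count (fun x => x < code g)%N (codes a) + count_mem (code g) (codes a))%N by rewrite addKn.
  elim: (codes a) => //= x s ->; rewrite ltnS.
  by case: (ltngtP x (code g)) => _ /=; clear; lia.
have := memE mu; rewrite -!eq_count ?code_ge // -?memE; last by apply: leqW; apply: code_ge.
by case: (g \in _); case: (g \in _).
Qed.

Lemma par_le_trans lam mu nu : par_le lam mu -> par_le mu nu -> par_le lam nu.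
Proof. by move=> le1 le2 g0; apply: leq_trans (le1 g0) (le2 g0). Qed.

Lemma par_lt_trans lam mu nu : par_lt lam mu -> par_lt mu nu -> par_lt lam nu.
Proof.
case=> le1 ne1 [le2 ne2]; split; first exact: par_le_trans le1 le2.
by move=> eq_ln; apply: ne1; apply: par_le_anti le1 _; rewrite eq_ln.
Qed.

Lemma shape_column (mu : seq nat) (r r' : nat) (m : 'I_l) : is_shape l mu ->
  (r' <= r)%N -> node_code (r, m) \in mu -> node_code (r', m) \in mu.
Proof.
case=> _ down; elim: r => [|r IH] le_r; first by move: le_r; rewrite leqn0 => /eqP->.
move: le_r; rewrite leq_eqVlt => /predU1P[-> //|le_r] /down[_].
have -> : (node_code (r.+1, m) - l)%N = node_code (r, m).
  by rewrite /node_code /= mulSn -addnA addKn.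
rewrite /with_row0 mem_cat mem_iota add0n => /orP[|]; last exact: IH.
by rewrite ltnNge /node_code mulSn -addnA leq_addr.
Qed.

Lemma card_ord_lt k : (k <= n)%N -> #|[set r : 'I_n | (r < k)%N]| = k.
Proof.
move=> kn; rewrite -sum1_card (eq_bigl (fun r : 'I_n => (r < k)%N)) => [|r]; last by rewrite inE.
by rewrite (big_ord_narrow kn) sum1_card card_ord.
Qed.

(** A column of a shape is closed upwards, hence an initial segment determined by its
    length. *)
Lemma par_of_shape (mu : seq nat) : is_shape l mu -> size mu = n -> exists lam, codes lam = mu.
Proof.
move=> shm sz; have uniq_mu : uniq mu by apply: sorted_uniq (proj1 shm); [exact: ltn_trans | exact: ltnn].
pose D := [set g : box l n | code g \in mu].
have mu_code x : x \in mu -> exists g : box l n, x = code g.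
  move=> x_mu; have [lx _] := proj2 shm x x_mu.
  have ml : (x %% l < l)%N by rewrite ltn_mod.
  have def_x : x = node_code ((x %/ l).-1, Ordinal ml).
    by rewrite /node_code /= prednK ?divn_gt0 // -divn_eq.
  move: (Ordinal ml) (x %/ l).-1 def_x => m r def_x; have rn : (r < n)%N.
    rewrite -sz -[r.+1](size_iota 0) -(size_map (fun r' => node_code (r', m))).
    apply: uniq_leq_size => [|_ /mapP[r' r'_r ->]].
      rewrite map_inj_uniq ?iota_uniq // => r1 r2 /eqP.
      by rewrite eqn_add2r eqn_pmul2r // => /eqP[].
    by apply: (@shape_column _ r) => //; [rewrite mem_iota in r'_r | rewrite -def_x].
  by exists (Ordinal rn, m).
have perm_D : perm_eq (map code (enum D)) mu.
  apply: uniq_perm => // [|x]; first by rewrite (map_inj_uniq code_inj) enum_uniq.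
  apply/mapP/idP => [[g + ->]|x_mu]; first by rewrite mem_enum inE.
  by have [g def_x] := mu_code x x_mu; exists g; rewrite // mem_enum inE -def_x.
pose col m := [set r : 'I_n | (r, m) \in D].
have col_lt m : (#|col m| < n.+1)%N by rewrite ltnS -[leqRHS](card_ord n) max_card.
pose a := [ffun m : 'I_l => Ordinal (col_lt m)].
have mem_col (g : box l n) : (g \in D) = (g.1 < #|col g.2|)%N.
  case: g => r m /=; apply/idP/idP => rm.
    rewrite -[X in (X <= _)%N](card_ord_lt (k := r.+1)); last exact: ltn_ord.
    apply/subset_leq_card/subsetP => r'; rewrite !inE ltnS => r'r.
    by apply: (@shape_column _ r) => //; move: rm; rewrite inE.
  apply: contraLR rm => rm; rewrite -leqNgt -[leqRHS](card_ord_lt (k := r)); last exact: ltnW.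
  apply/subset_leq_card/subsetP => r'; rewrite [_ \in col m]inE inE => r'm.
  rewrite ltnNge; apply: contra rm => rr'; rewrite inE.
  by apply: (@shape_column _ r') => //; move: r'm; rewrite inE.
have sum_a : (\sum_m a m == n)%N.
  have card_D : #|D| = n by rewrite cardE -(size_map code) (perm_size perm_D).
  apply/eqP; rewrite -[RHS]card_D -sum1_card.
  rewrite (eq_bigr (fun m => \sum_(r | (r, m) \in D) 1)%N) => [|m _]; last first.
    by rewrite ffunE /= -sum1_card; apply: eq_bigl => r; rewrite inE.
  rewrite (exchange_big_dep xpredT) //= pair_big_dep /=.
  by apply: eq_bigl => -[r m].
exists (exist _ a sum_a); apply: (irr_sorted_eq ltn_trans ltnn (codes_sorted _) (proj1 shm)).
have mem_lam g : (code g \in codes (exist _ a sum_a)) = (code g \in mu).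
  by rewrite mem_codes /= ffunE /= -mem_col inE.
move=> x; apply/idP/idP => [x_lam|x_mu].
  by case/mapP: (x_lam) => g _ def_x; rewrite def_x -mem_lam -def_x.
by have [g def_x] := mu_code x x_mu; rewrite def_x mem_lam -def_x.
Qed.

Lemma initial_tab_inj lam : injective (initial_tab lam).
Proof. by have := initial_tab_Tab lam; rewrite inE => /andP[/injectiveP]. Qed.

Lemma dperm_unique lam t (p : {perm 'I_n}) : t \in Tab lam ->
  (forall k, t k = initial_tab lam (p k)) -> dperm lam t = p.
Proof.
move=> tT def_t; apply/permP => k; apply: (@initial_tab_inj lam).
by rewrite -dpermP.
Qed.

(** The inverse of [dperm lam]. *)
Definition perm_tab lam (p : {perm 'I_n}) : tableau l n :=
  [ffun k => initial_tab lam (p k)].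

Lemma perm_tabE lam p k : perm_tab lam p k = initial_tab lam (p k).
Proof. by rewrite ffunE. Qed.

Lemma perm_tab_Tab lam p : perm_tab lam p \in Tab lam.
Proof.
have := initial_tab_Tab lam; rewrite !inE => /andP[_ /eqP im_lam]; apply/andP; split.
  by apply/injectiveP => j k; rewrite !perm_tabE => /initial_tab_inj /perm_inj.
rewrite -im_lam; apply/eqP/setP => g; apply/imsetP/imsetP => -[k _ ->].
  by exists (p k); rewrite // perm_tabE.
by exists ((p^-1)%g k); rewrite // perm_tabE permKV.
Qed.

Lemma dperm_perm_tab lam p : dperm lam (perm_tab lam p) = p.
Proof. by apply: dperm_unique (perm_tab_Tab _ _) _ => k; rewrite perm_tabE. Qed.

Lemma perm_tab_dperm lam t : t \in Tab lam -> perm_tab lam (dperm lam t) = t.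
Proof. by move=> tT; apply/ffunP => k; rewrite perm_tabE -dpermP. Qed.

Definition count_first (P : pred 'I_n) (p : {perm 'I_n}) (k : nat) :=
  #|[set j : 'I_n | (j < k)%N && P (p j)]|.

Lemma count_firstS P p (j : 'I_n) :
  count_first P p j.+1 = (count_first P p j + P (p j))%N.
Proof.
rewrite /count_first; case Pj: (P (p j)); last first.
  rewrite addn0; congr #|pred_of_set _|; apply/setP => i; rewrite !inE ltnS leq_eqVlt.
  by case: eqP => //= /val_inj ->; rewrite Pj andbF.
rewrite addnC (_ : [set i : 'I_n | _] = j |: [set i : 'I_n | (i < j)%N && P (p i)]).
  by rewrite cardsU1 inE ltnn.
apply/setP => i; rewrite !inE ltnS leq_eqVlt -(inj_eq val_inj).
by case: eqP => //= /val_inj ->; rewrite Pj.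
Qed.

Lemma count_first_srefl P p (r : 'I_n.-1) k : k != r.+1 ->
  count_first P (srefl r * p)%g k = count_first P p k.
Proof.
move=> kr; rewrite /count_first -(card_imset _ (inv_inj (sreflK r))).
congr #|pred_of_set _|; apply/setP => j; rewrite -{1}[j](sreflK r) (mem_imset _ _ (inv_inj (sreflK r))).
rewrite !inE permM sreflK; congr andb.
by rewrite /srefl; case: tpermP => // ->; move: kr; rewrite /=; clear; lia.
Qed.

(** Counting values in initial segments detects the Bruhat order. Induct on the word:
    its last letter r changes only the count over the first r + 1 positions. In the
    reduced word r exchanges two increasing values, which cannot increase that count
    as [P] is closed downwards. If the subword uses the last letter too, the required
    inequality follows from those for the first r and the first r + 2 positions. *)
Lemma subproduct_count (P : pred 'I_n) u q : (forall i j : 'I_n, (i < j)%N -> P j -> P i) ->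
  reduced u -> subproduct u q -> forall k, (count_first P (word_perm u) k <= count_first P q k)%N.
Proof.
move=> Pdown; elim/last_ind: u q => [|u r IH] q.
  by move=> _ [w]; rewrite subseq0 => /eqP-> <-.
move=> red_ur; have [red_u dn] := reduced_rcons red_ur.
move: dn; rewrite word_perm_rcons; set p := word_perm u.
rewrite !permM srefl_hi srefl_lo -cats1 => up /subproduct_cat[p1 [p2 [p1u [w w_r <-] ->]]] k.
have {}IH := IH p1 red_u p1u; rewrite -/p in IH.
have [def_k|k_r] := eqVneq k r.+1; last first.
  rewrite count_first_srefl //; apply: leq_trans (IH k) _.
  suff [->|->] : w = [::] \/ w = [:: r] by rewrite ?mul1g ?count_first_srefl //= mul1g count_first_srefl.
  by move: w_r => /subseqP[[|[] [|]] //= _ ->]; auto.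
have C_r (p' : {perm 'I_n}) : count_first P p' r.+1 = (count_first P p' r + P (p' (lo r)))%N.
  exact: (count_firstS P p' (lo r)).
have C_r1 (p' : {perm 'I_n}) : count_first P p' r.+2 =
    (count_first P p' r + P (p' (lo r)) + P (p' (hi r)))%N.
  by rewrite -C_r; apply: (count_firstS P p' (hi r)).
have st_r (p' : {perm 'I_n}) : count_first P (srefl r * p')%g r.+1 = (count_first P p' r + P (p' (hi r)))%N.
  by rewrite C_r permM srefl_lo count_first_srefl // neq_ltn ltnS leqnn.
have le_P : (P (p (hi r)) <= P (p (lo r)))%N.
  by case Ph: (P (p (hi r))) => //; rewrite (Pdown _ _ up Ph).
rewrite def_k st_r; have le0 := IH r; have le2 := IH r.+2; rewrite !C_r1 in le2.
have le1 := IH r.+1; rewrite !C_r in le1.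
have [->|->] : w = [::] \/ w = [:: r] by move: w_r => /subseqP[[|[] [|]] //= _ ->]; auto.
  by rewrite mul1g C_r; apply: leq_trans le1; rewrite leq_add2l.
rewrite /= mul1g -/(srefl r) st_r; move: le_P le0 le2.
by case: (P (p (hi r))); case: (P (p (lo r))); case: (P (p1 (hi r))); case: (P (p1 (lo r))); clear; lia.
Qed.

(** The nodes beyond a given one form an initial segment of the reading order, which
    is the set [P] in [subproduct_count]. *)
Lemma tab_le_subproduct lam u q : reduced u -> subproduct u q ->
  tab_le (perm_tab lam (word_perm u)) (perm_tab lam q).
Proof.
move=> red_u u_q k g0.
pose P (j : 'I_n) := node_lt g0 (node_of (initial_tab lam j)).
have Pdown (i j : 'I_n) : (i < j)%N -> P j -> P i.
  by rewrite /P !node_lt_code -(codes_ltn lam) => ij; apply: ltn_trans.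
have cardE p : #|[set g in initial_part (perm_tab lam p) k | node_lt g0 (node_of g)]| =
    count_first P p k.
  have inj_p : injective (perm_tab lam p).
    by have := perm_tab_Tab lam p; rewrite inE => /andP[/injectiveP].
  rewrite /count_first -(card_imset _ inj_p); congr #|pred_of_set _|; apply/setP => g.
  rewrite !inE; apply/andP/imsetP => [[/imsetP[j jk ->] Pg]|[j + ->]].
    by exists j => //; move: jk Pg; rewrite !inE perm_tabE /P => ->.
  rewrite inE => /andP[jk Pj]; split; last by rewrite perm_tabE.
  by apply: imset_f; rewrite inE.
by rewrite !cardE; apply: subproduct_count.
Qed.

Lemma initial_tab_at lam (x : nat) : x \in codes lam ->
  exists2 k, code (initial_tab lam k) = x & nth 0%N (codes lam) k = x.
Proof.
move=> x_lam; have kn : (index x (codes lam) < n)%N by rewrite -(size_codes lam) index_mem.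
have nth_x : nth 0%N (codes lam) (Ordinal kn) = x by apply: nth_index.
by exists (Ordinal kn); rewrite // -codes_nth.
Qed.

(** It suffices to compare the entries of vertically adjacent nodes. *)
Lemma perm_tab_Std lam (p : {perm 'I_n}) :
  (forall i j : 'I_n, code (initial_tab lam j) = (code (initial_tab lam i) + l)%N ->
     ((p^-1)%g i < (p^-1)%g j)%N) ->
  perm_tab lam p \in Std lam.
Proof.
move=> step; rewrite inE perm_tab_Tab /=.
apply/forallP => i; apply/forallP => j; apply/implyP; rewrite !perm_tabE.
rewrite -{3}[i](permK p) -{3}[j](permK p); move: (p i) (p j) => {}i {}j /andP[/eqP eq_m lt_r].
have [d def_d] : exists d, (initial_tab lam j).1 = ((initial_tab lam i).1 + d.+1)%N :> nat.
  by exists ((initial_tab lam j).1 - (initial_tab lam i).1).-1; move: lt_r; clear; lia.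
elim: d => [|d IH] in j eq_m {lt_r} def_d *.
  by apply: step; rewrite /code /node_code /= def_d eq_m addn1 [in RHS]mulSn; clear; lia.
have lt_n : ((initial_tab lam i).1 + d.+1 < n)%N.
  by have := ltn_ord (initial_tab lam j).1; rewrite def_d; clear; lia.
have code_j : code (initial_tab lam j) = (code (Ordinal lt_n, (initial_tab lam j).2) + l)%N.
  by rewrite /code /node_code /= def_d [in LHS]addnS mulSn; clear; lia.
have j'_lam : code (Ordinal lt_n, (initial_tab lam j).2) \in codes lam.
  have : code (initial_tab lam j) \in codes lam.
    by rewrite -codes_nth mem_nth // size_codes.
  by rewrite !mem_codes /= def_d; clear; lia.
have [j' code_j' _] := initial_tab_at j'_lam.
have j'E := code_inj code_j'.
apply: (@ltn_trans ((p^-1)%g j')); last by apply: step; rewrite code_j code_j'.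
by apply: IH; rewrite j'E.
Qed.

Lemma initial_tab_Std lam : initial_tab lam \in Std lam.
Proof.
have -> : initial_tab lam = perm_tab lam 1%g by apply/ffunP => k; rewrite perm_tabE perm1.
apply: perm_tab_Std => i j eq_c; rewrite perm1V !perm1.
by rewrite -(codes_ltn lam) eq_c -{1}[code _]addn0 ltn_add2l.
Qed.

End Codes.

(** * Straightening modulo higher shapes *)

(* [I] is any ideal containing the idempotents of the shapes strictly above [lam]. *)
Section Straightening.
Variables (F : fieldType) (e l n : nat) (khat : 'I_l -> int).
Hypotheses (e_gt1 : (1 < e)%N) (l_gt1 : (1 < l)%N).
Hypothesis khat_saf : strongly_adjacency_free e n khat.
Local Notation kap := (charge e khat).
Local Notation B := (blob F n kap).
Local Notation res := (code_res kap).
Local Notation psi := (psi F kap).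
Local Notation dot := (dot F kap).
Local Notation idem := (idem F kap).

Let l_gt0 : (0 < l)%N := ltnW l_gt1.
Let two : 1 + 1 != 0 :> 'Z_e := Zp_two_neq0 khat_saf e_gt1 l_gt1.
Let res_down x : res (x + l) = res x - 1 := code_res_down kap x l_gt0.
Let res_far x z := @code_res_far e l n khat khat_saf e_gt1 l_gt1 x z.

Variable lam : par l n.
Variable I : B -> Prop.
Hypothesis idI : ideal I.
Local Notation i0 := (res_seq kap (initial_tab lam)).
Hypothesis above_I : forall mu, par_lt lam mu -> I (idem (res_seq kap (initial_tab mu))).

Let I0 := ideal0 idI.
Let ID := idealD idI.
Let IMl := idealMl idI.
Let IMr := idealMr idI.

Lemma res_code (g : box l n) : Defs.res kap g = res (code g).
Proof. by rewrite /code /node_code code_res_node. Qed.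

Lemma res_seq_codes mu : res_seq kap (initial_tab mu) = seq_res n (map res (codes mu)).
Proof.
apply/ffunP => k; rewrite /res_seq ffunE seq_resE (nth_map 0%N) ?size_codes //.
by rewrite codes_nth res_code.
Qed.

(** The shapes dominating the placement [swapped] are strictly above [lam]: at the
    threshold [a + l] the placement has one node of the residue of [a + l] fewer than
    [lam]. *)
Lemma swapped_in_ideal X a Y :
    (forall x, x \in X -> (l <= x < a + l)%N && (x != a)) -> (l <= a)%N ->
    sorted ltn X -> sorted ltn (a :: Y) ->
    perm_eq (X ++ (a + l)%N :: a :: Y) (codes lam) ->
  I (idem (seq_res n (map res (X ++ (a + l)%N :: a :: Y)))).
Proof.
move=> HX la sX sY pm.
suff : in_ideal I (map snd (swapped l res X a Y)).
  rewrite map_swapped; apply; by rewrite size_map (perm_size pm) size_codes.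
have closedZ := in_ideal_closed idI l_gt0 (kap := kap).
apply: (sequences_reduce_to_shapes l_gt0 two res_down res_far closedZ) => //.
  exact: swapped_valid.
move=> mu shm domm; have [domn strict] := dominates_swapped l_gt0 domm pm.
have sz_mu : size mu = n.
  by have := dominates_size domn; rewrite size_map size_codes.
have [mu' def_mu] := par_of_shape l_gt0 shm sz_mu.
rewrite -def_mu => _; rewrite -res_seq_codes; apply: above_I; split; last first.
  by move=> eq_lam; move: strict; rewrite eq_lam def_mu ltnn.
apply: set_le_codes => // c; rewrite def_mu.
have countE s : count (fun x => c <= x)%N s = (\sum_d count_from d c (map (with_res res) s))%N.
  elim: s => [|x s IH]; first by rewrite big1.
  rewrite (eq_bigr _ (fun d _ => count_from_cons_res _ d c x s)) big_split /= -IH; congr addn.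
  by rewrite (bigD1 (res x)) //= eqxx big1 ?addn0 // => d xd; rewrite eq_sym (negPf xd).
by rewrite !countE; apply: leq_sum => d _; apply: (proj1 domn).
Qed.

Definition dot_in (k : nat) (s : seq 'Z_e) := size s = n ->
  forall k' : 'I_n, k' = k :> nat -> I (dot k' * idem (seq_res n s)).

Lemma dot_in_left (X Y : seq 'Z_e) (c d : 'Z_e) : far c d ->
  dot_in (size X) (X ++ c :: d :: Y) -> dot_in (size X).+1 (X ++ d :: c :: Y).
Proof.
move=> fr Zd sz k def_k; have [r [def_r lr hr sw]] := seq_res_pos sz.
have -> : k = hi r by apply: ord_inj; rewrite def_k /= def_r.
apply: (ideal_dot_far idI (r := r)); first by rewrite lr hr farC.
by rewrite tpermR sw; apply: Zd => //; move: sz; rewrite !size_cat.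
Qed.

Lemma dot_in_other (X Y : seq 'Z_e) (c d : 'Z_e) k : far c d ->
  ((size X).+1 < k)%N -> dot_in k (X ++ c :: d :: Y) -> dot_in k (X ++ d :: c :: Y).
Proof.
move=> fr lt_k Zd sz k' def_k; have [r [def_r lr hr sw]] := seq_res_pos sz.
apply: (ideal_dot_far idI (r := r)); first by rewrite lr hr farC.
rewrite tpermD ?sw; first by apply: Zd => //; move: sz; rewrite !size_cat.
  by rewrite -val_eqE /= def_k def_r; move: lt_k; clear; lia.
by rewrite -val_eqE /= def_k def_r; move: lt_k; clear; lia.
Qed.

Lemma dot_in_left_block (X T Y : seq 'Z_e) (c : 'Z_e) : all (far c) T ->
  dot_in (size X) (X ++ c :: T ++ Y) -> dot_in (size X + size T)%N (X ++ T ++ c :: Y).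
Proof.
elim: T X => [|d T IH] X /=; first by rewrite addn0.
move=> /andP[fr farT] Zd; rewrite addnS -addSn -(size_rcons X d) -cat_rcons.
by apply: IH => //; rewrite cat_rcons size_rcons; apply: dot_in_left.
Qed.

Lemma dot_in_other_block (X T Y : seq 'Z_e) (c : 'Z_e) k : all (far c) T ->
  (size X + size T < k)%N -> dot_in k (X ++ T ++ c :: Y) -> dot_in k (X ++ c :: T ++ Y).
Proof.
elim: T X => [//|d T IH] X /= /andP[fr farT] lt_k Zd.
apply: dot_in_other; rewrite 1?farC //; first by move: lt_k; clear; lia.
rewrite -cat_rcons; apply: IH => //; last by rewrite cat_rcons.
by move: lt_k; rewrite size_rcons; clear; lia.
Qed.

(** Induct along the columns. For a node [x] in the first row, its strand can be moved
    to the front together with the dot, where dots vanish. Otherwise the strand of the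
    node [a] above is brought next to [x]: the dot on [x] differs from the dot on [a]
    by the square of their crossing, which is in [I] by [swapped_in_ideal]. *)
Lemma dot_in_codes N1 x N2 : codes lam = N1 ++ x :: N2 ->
  dot_in (size N1) (map res (codes lam)).
Proof.
move def_m: (size N1) => m; elim/ltn_ind: m => m IH in N1 x N2 def_m *; move=> def_lam.
have [srt down] := codes_shape l_gt0 lam.
have pw : pairwise ltn (N1 ++ x :: N2) by rewrite -sorted_pairwise -?def_lam //; apply: ltn_trans.
have : pairwise ltn (N1 ++ x :: N2) := pw.
rewrite pairwise_cat /= => /and3P[/allrelP lt12 pw1 /andP[/allP ltx2 pw2]].
have lt1x z : z \in N1 -> (z < x)%N by move=> z1; apply: lt12; rewrite // inE eqxx.
have [lx] : (l <= x)%N /\ (x - l)%N \in with_row0 l (codes lam).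
  by apply: down; rewrite def_lam mem_cat inE eqxx orbT.
have ge_l z : z \in N1 -> (l <= z)%N.
  by move=> z1; have [] := down z; rewrite // def_lam mem_cat z1.
rewrite /with_row0 mem_cat mem_iota add0n => /orP[xl|].
  rewrite def_lam map_cat map_cons -[map res N1]cat0s -catA.
  rewrite -def_m -(size_map res N1) -[size _]add0n; apply: dot_in_left_block.
    apply/allP => _ /mapP[z z1 ->]; rewrite farC; apply: res_far; rewrite (lt1x z z1) /=.
    by move: (ge_l z z1) xl; clear; lia.
  move=> sz k k0; rewrite dot_first ?seq_resE ?k0 //=.
  have lt_xl : (x - l < l)%N by [].
  have -> : res x = kap (Ordinal lt_xl); last exact: codom_f.
  by have := code_res_node kap 1 (Ordinal lt_xl); rewrite mul1n /= subnKC // addrK.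
set a := (x - l)%N => a_lam; have def_x : x = (a + l)%N by rewrite subnK.
have a1 : a \in N1.
  move: a_lam; rewrite def_lam mem_cat inE => /or3P[//|/eqP|/ltx2 /=].
    by move: l_gt0 lx; rewrite /a; clear; lia.
  by move: l_gt0 lx; rewrite /a; clear; lia.
have la := ge_l a a1.
have [X [T def_N1]] : exists X T, N1 = X ++ a :: T by case/splitPr: a1 => X T; exists X, T.
have : pairwise ltn (X ++ a :: T) by rewrite -def_N1.
rewrite pairwise_cat /= => /and3P[/allrelP ltXT pwX /andP[/allP ltT pwT]].
have farT : all (far (res a)) (map res T).
  apply/allP => _ /mapP[z zT ->]; apply: res_far; rewrite [(a < z)%N]ltT //= -def_x.
  by apply: lt1x; rewrite def_N1 mem_cat inE zT !orbT.
have dot_a : dot_in (size X) (map res (codes lam)).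
  apply: (IH _ _ X a (T ++ x :: N2)) => //; last by rewrite def_lam def_N1 -catA.
  by rewrite -def_m def_N1 size_cat /= -[X in (X < _)%N]addn0 ltn_add2l.
rewrite def_lam def_N1 map_cat map_cat !map_cons -catA cat_cons.
rewrite -def_m def_N1 size_cat /=.
apply: dot_in_other_block => //; first by rewrite !size_map addnS.
rewrite catA -map_cat; set XT := map res (X ++ T).
have sz_XT : size XT = (size X + size T)%N by rewrite size_map size_cat.
move=> sz k def_k; have [r [def_r lr hr sw]] := seq_res_pos sz.
have -> : k = hi r by apply: ord_inj; rewrite def_k /= def_r sz_XT addnS.
apply: (ideal_dot_step idI (r := r)).
- by rewrite lr hr def_x res_down.
- have : dot_in (size X + size (map res T))%N (map res X ++ map res T ++ res a :: res x :: map res N2).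
    rewrite -(size_map res X); apply: dot_in_left_block => //.
    by rewrite size_map; move: dot_a; rewrite def_lam def_N1 !map_cat !map_cons -!catA.
  rewrite catA -map_cat; apply=> //.
  by rewrite /= def_r sz_XT size_map.
- rewrite sw /XT -map_cons -map_cons -map_cat def_x; apply: swapped_in_ideal => //.
  + move=> z; rewrite mem_cat => /orP[zX|zT].
      have za : (z < a)%N by apply: ltXT; rewrite // inE eqxx.
      have := ge_l z; rewrite def_N1 mem_cat zX => /(_ isT).
      by move: za; clear; lia.
    have az := ltT z zT; have zx : (z < x)%N by apply: lt1x; rewrite def_N1 mem_cat inE zT !orbT.
    by move: az zx la; rewrite /= -def_x; clear; lia.
  + rewrite (sorted_pairwise ltn_trans) pairwise_cat pwX pwT !andbT.
    by apply/allrelP => z z' zX z'T; apply: ltXT; rewrite // inE z'T orbT.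
  + rewrite (sorted_pairwise ltn_trans) /= pw2 andbT.
    by apply/allP => z /ltx2 /=; rewrite def_x; clear; lia.
  + apply/seq.permP => p; rewrite def_lam def_N1 -def_x !count_cat /=.
    by clear; lia.
Qed.

Lemma dot_in_ideal (k : 'I_n) : I (dot k * idem i0).
Proof.
rewrite res_seq_codes; have kn : (k < size (codes lam))%N by rewrite size_codes.
have def_lam := esym (cat_take_drop k (codes lam)); rewrite (drop_nth 0%N) // in def_lam.
apply: (dot_in_codes def_lam); first by rewrite size_map size_codes.
by rewrite size_takel // ltnW.
Qed.

Variable red : {perm 'I_n} -> seq 'I_n.-1.
Hypothesis red_reduced : forall w, reduced_expression w (red w).

Lemma word_perm_red p : word_perm (red p) = p.
Proof. by case: (red_reduced p). Qed.

Lemma reduced_red p : reduced (red p).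
Proof. by rewrite /reduced word_perm_red (reduced_expression_size (red_reduced p)). Qed.

Definition psiw (w : seq 'I_n.-1) : B := \prod_(r <- w) psi r.

Lemma psiw_cons r w : psiw (r :: w) = psi r * psiw w.
Proof. exact: big_cons. Qed.
Lemma psiw_cat u w : psiw (u ++ w) = psiw u * psiw w.
Proof. exact: big_cat. Qed.
Lemma psiw_nil : psiw [::] = 1.
Proof. exact: big_nil. Qed.

Definition perm_res (i : resseq e n) (p : {perm 'I_n}) : resseq e n :=
  [ffun k => i (p k)].

Lemma idem_psiw i w : idem i * psiw w = psiw w * idem (perm_res i (word_perm w)).
Proof.
elim: w i => [|r w IH] i.
  rewrite psiw_nil mulr1 mul1r; congr idem.
  by apply/ffunP => k; rewrite ffunE perm1.
rewrite psiw_cons mulrA idem_psi -!mulrA IH; congr (_ * (_ * idem _)).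
by apply/ffunP => k; rewrite !ffunE permM.
Qed.

Definition basis_elt (t : tableau l n) : B := idem i0 * psiw (red (dperm lam t)).

(** Congruence modulo [I] to a combination of the [basis_elt v] with [P v]. Keeping
    track of [P] is what gives the triangularity. *)
Definition spanned (P : tableau l n -> Prop) (x : B) :=
  exists c : tableau l n -> F,
    I (x - \sum_(v in Std lam | `[< P v >]) c v *: basis_elt v).

Lemma spanned_ideal P x : I x -> spanned P x.
Proof.
move=> Ix; exists (fun _ => 0); rewrite big1 ?subr0 // => v _.
by rewrite scale0r.
Qed.

Lemma spannedD P x z : spanned P x -> spanned P z -> spanned P (x + z).
Proof.
move=> [c Ic] [d Id]; exists (fun v => c v + d v).
rewrite (eq_bigr (fun v => c v *: basis_elt v + d v *: basis_elt v)) => [|v _]; last exact: scalerDl.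
by rewrite big_split opprD addrACA; apply: ID.
Qed.

Lemma spannedZ P a x : spanned P x -> spanned P (a *: x).
Proof.
move=> [c Ic]; exists (fun v => a * c v).
rewrite (eq_bigr (fun v => a *: (c v *: basis_elt v))) => [|v _]; last by rewrite scalerA.
by rewrite -scaler_sumr -scalerBr; apply: idealZ.
Qed.

Lemma spannedN P x : spanned P x -> spanned P (- x).
Proof. by rewrite -scaleN1r; apply: spannedZ. Qed.

Lemma spanned_sum P (T : Type) (s : seq T) (Q : pred T) (f : T -> B) :
  (forall j, Q j -> spanned P (f j)) -> spanned P (\sum_(j <- s | Q j) f j).
Proof.
move=> spf; elim/big_ind: _ => //; last exact: spannedD.
exact: spanned_ideal.
Qed.

Lemma spanned_basis P v : v \in Std lam -> P v -> spanned P (basis_elt v).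
Proof.
move=> v_std Pv; exists (fun v' => (v' == v)%:R).
rewrite (bigD1 v) /=; last by rewrite v_std; apply/asboolP.
rewrite eqxx scale1r big1 ?addr0 ?subrr // => v' /andP[_ /negPf ->].
by rewrite scale0r.
Qed.

Lemma spanned_mono P P' x : (forall v, v \in Std lam -> P v -> P' v) ->
  spanned P x -> spanned P' x.
Proof.
move=> PP' [c Ic]; rewrite -(subrK (\sum_(v in Std lam | `[< P v >]) c v *: basis_elt v) x).
apply: spannedD; first exact: spanned_ideal.
apply: spanned_sum => v /andP[v_std /asboolP Pv]; apply/spannedZ/spanned_basis => //.
exact: PP'.
Qed.

(** The dot moves to the left through the crossings of [u]; each of them may leave a
    term in which it is deleted, and at the front the dot is killed by
    [dot_in_ideal]. *)
Lemma spanned_dot P u m z :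
  (forall u', subseq u' u -> (size u' < size u)%N -> spanned P (idem i0 * psiw (u' ++ z))) ->
  spanned P (idem i0 * psiw u * dot m * psiw z).
Proof.
elim/last_ind: u m z => [|u r IH] m z H.
  rewrite psiw_nil mulr1 -dot_idem; apply: spanned_ideal.
  by apply: IMr; apply: dot_in_ideal.
have [c eq_c] := idem_psi_dot F kap r (perm_res i0 (word_perm u)) m.
have -> : idem i0 * psiw (rcons u r) * dot m * psiw z =
    idem i0 * psiw u * dot (srefl r m) * psiw (r :: z) + c *: (idem i0 * psiw (u ++ z)).
  rewrite -cats1 !psiw_cat !psiw_cons psiw_nil mulr1 !mulrA !idem_psiw.
  rewrite -!mulrA (mulrA (psi r)) (mulrA (idem _)) eq_c mulrDl mulrDr -!mulrA; congr (_ + _).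
  by rewrite scaleAr.
apply: spannedD.
  apply: IH => u' sub_u lt_u; rewrite -cat_rcons; apply: H.
    by rewrite -!cats1; apply: cat_subseq.
  by rewrite !size_rcons ltnS.
apply/spannedZ/H; first exact: subseq_rcons.
by rewrite size_rcons.
Qed.

Definition below w (t : tableau l n) := subproduct w (dperm lam t).

Lemma below_sub u w x : subseq u w -> spanned (below u) x -> spanned (below w) x.
Proof. by move=> uw; apply: spanned_mono => v _; apply: subproduct_sub. Qed.

(** A braid step costs at most a multiple of the word with the three letters
    deleted. *)
Lemma psiw_braid_step u v : braid_step u v ->
  idem i0 * psiw u = idem i0 * psiw v \/
  exists c u', [/\ subseq u' u, (size u' < size u)%N &
    idem i0 * psiw u = idem i0 * psiw v + c *: (idem i0 * psiw u')].
Proof.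
have split3 x m z : idem i0 * psiw (x ++ m ++ z) =
    psiw x * (idem (perm_res i0 (word_perm x)) * psiw m) * psiw z.
  by rewrite !psiw_cat !mulrA idem_psiw.
have psi2 r s : psiw [:: r; s] = psi r * psi s by rewrite !psiw_cons psiw_nil mulr1.
have psi3 r s t : psiw [:: r; s; t] = psi r * (psi s * psi t).
  by rewrite !psiw_cons psiw_nil mulr1.
have sub3 (x m z : seq 'I_n.-1) : m != [::] ->
    subseq (x ++ z) (x ++ m ++ z) /\ (size (x ++ z) < size (x ++ m ++ z))%N.
  move=> m0; split; first by rewrite cat_subseq // suffix_subseq.
  by rewrite !size_cat; case: m m0 => //= r m _; clear; lia.
have braid (x m m' z : seq 'I_n.-1) c j : m != [::] -> j = perm_res i0 (word_perm x) ->
    idem j * psiw m = idem j * psiw m' + c *: idem j ->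
    idem i0 * psiw (x ++ m ++ z) = idem i0 * psiw (x ++ m' ++ z) + c *: (idem i0 * psiw (x ++ z)).
  move=> m0 def_j eq_m; rewrite !split3 -def_j eq_m mulrDr mulrDl; congr (_ + _).
  by rewrite psiw_cat mulrA idem_psiw def_j scaleAl scaleAr.
case=> x r s z rs.
- by left; rewrite !split3 !psi2 (psi_psi F kap rs).
- right; have [c eq_c] := idem_psi_braid F kap (perm_res i0 (word_perm x)) rs.
  have [sub lt] := sub3 x [:: r; s; r] z isT.
  exists c, (x ++ z); split=> //; apply: braid erefl _ => //.
  by rewrite !psi3.
- right; have [c eq_c] := idem_psi_braid F kap (perm_res i0 (word_perm x)) rs.
  have [sub lt] := sub3 x [:: s; r; s] z isT.
  exists (- c), (x ++ z); split=> //; apply: braid erefl _ => //.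
  by rewrite !psi3 eq_c scaleNr addrK.
Qed.

Lemma spanned_braid_eq u v : braid_eq u v ->
  (forall w, (size w < size u)%N -> spanned (below w) (idem i0 * psiw w)) ->
  spanned (below v) (idem i0 * psiw v) -> spanned (below u) (idem i0 * psiw u).
Proof.
elim=> // u1 v1 w1 uv _ IH H spw.
have {IH}spv : spanned (below v1) (idem i0 * psiw v1).
  by apply: IH => // w lt_w; apply: H; rewrite (braid_step_size uv).
have {}spv : spanned (below u1) (idem i0 * psiw v1).
  by apply: spanned_mono spv => t _; apply: subproduct_braid.
case: (psiw_braid_step uv) => [->|[c [u' [sub_u lt_u ->]]]] //.
by apply: spannedD => //; apply/spannedZ/(below_sub sub_u)/H.
Qed.

(** The square of a crossing on an idempotent is zero, the idempotent, or a difference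
    of two dots, and dots are removed by [spanned_dot]. *)
Lemma spanned_square x r z :
  (forall w, (size w < size (x ++ [:: r; r] ++ z))%N -> spanned (below w) (idem i0 * psiw w)) ->
  spanned (below (x ++ [:: r; r] ++ z)) (idem i0 * psiw (x ++ [:: r; r] ++ z)).
Proof.
move=> H; set j := perm_res i0 (word_perm x).
have -> : idem i0 * psiw (x ++ [:: r; r] ++ z) = psiw x * (idem j * (psi r * psi r)) * psiw z.
  by rewrite !psiw_cat !psiw_cons psiw_nil mulr1 !mulrA idem_psiw -!mulrA.
have short u' : subseq u' x -> spanned (below (x ++ [:: r; r] ++ z)) (idem i0 * psiw (u' ++ z)).
  move=> sub_u; apply: (@below_sub (u' ++ z)).
    by apply: cat_subseq => //; apply: suffix_subseq.
  by apply: H; rewrite !size_cat /= -addnS leq_add // (size_subseq sub_u).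
have with_dot m : spanned (below (x ++ [:: r; r] ++ z)) (psiw x * (idem j * dot m) * psiw z).
  have -> : psiw x * (idem j * dot m) * psiw z = idem i0 * psiw x * dot m * psiw z.
    by rewrite idem_psiw !mulrA.
  by apply: spanned_dot => u' sub_u _; apply: short.
have [eq_j|ne_j] := eqVneq (j (lo r)) (j (hi r)).
  by rewrite idem_psi2_eq // mulr0 mul0r; apply: spanned_ideal.
have [fr|] := boolP (far (j (lo r)) (j (hi r))).
  by rewrite idem_psi2_far // -idem_psiw -mulrA -psiw_cat; apply: short.
rewrite /far ne_j /= negb_and !negbK => /orP[]/eqP eq_j.
  have j_dn : j (hi r) = j (lo r) - 1 by rewrite eq_j addrK.
  rewrite idem_psi2_down // mulrBr mulrBr mulrBl.
  by apply: spannedD; [|apply: spannedN]; apply: with_dot.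
rewrite idem_psi2_up // mulrBr mulrBr mulrBl.
by apply: spannedD; [|apply: spannedN]; apply: with_dot.
Qed.

(** Two vertically adjacent nodes of a nonstandard tableau have entries in the wrong
    order. By [reduced_through_one_descent] a reduced word passes through an
    arrangement of the nodes in which only these two, in adjacent positions, are out
    of order; its idempotent is in [I] by [swapped_in_ideal]. *)
Lemma nonstandard_in_ideal (p : {perm 'I_n}) : perm_tab lam p \notin Std lam ->
  exists2 w, reduced w & word_perm w = p /\ I (idem i0 * psiw w).
Proof.
move=> nonstd; have [i [j [code_j lt_p]]] : exists i j : 'I_n,
    code (initial_tab lam j) = (code (initial_tab lam i) + l)%N /\ ((p^-1)%g j < (p^-1)%g i)%N.
  apply: contrapT => none; case/negP: nonstd; apply: (perm_tab_Std l_gt0) => i j code_j.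
  rewrite ltnNge leq_eqVlt negb_or; apply/andP; split; last first.
    by apply/negP => lt_p; apply: none; exists i, j.
  apply/eqP => /val_inj /perm_inj eq_ij; move: code_j; rewrite eq_ij.
  by move: l_gt0; clear; lia.
have ij : (i < j)%N by rewrite -(codes_ltn lam) code_j -[ltnLHS]addn0 ltn_add2l.
have [x [z [r [wxz red_xz x_lo x_hi up]]]] := reduced_through_one_descent ij lt_p.
exists (x ++ z) => //; split=> //; rewrite psiw_cat mulrA idem_psiw -mulrA.
apply: IMl; apply: IMr; set q := word_perm x in x_lo x_hi up *.
pose f k := code (initial_tab lam (q k)); pose L := map f (enum 'I_n).
have size_L : size L = n by rewrite size_map size_enum_ord.
have nth_L (k : 'I_n) : nth 0%N L k = f k.
  by rewrite (nth_map k) ?size_enum_ord ?nth_ord_enum.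
have f_lt (k k' : 'I_n) : (k < k')%N -> ((k' <= r) || (r < k))%N -> (f k < f k')%N.
  move=> kk' side; rewrite /f codes_ltn; apply: increasing_between => // s /andP[ks sk'].
  by apply: up; apply: contraTneq side => eq_s; move: ks sk'; rewrite eq_s; clear; lia.
set a := code (initial_tab lam i) in code_j.
have f_lo : f (lo r) = (a + l)%N by rewrite /f x_lo.
have f_hi : f (hi r) = a by rewrite /f x_hi.
have def_L : L = take r L ++ (a + l)%N :: a :: drop r.+2 L.
  have lt1 := hi_subproof r; have lt0 := ltnW lt1.
  rewrite -[LHS](cat_take_drop r) (drop_nth 0%N) ?size_L // (drop_nth 0%N) ?size_L //.
  by rewrite -f_lo -f_hi -!nth_L.
have -> : perm_res i0 q = seq_res n (map res L).
  apply/ffunP => k; rewrite ffunE res_seq_codes !seq_resE.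
  by rewrite !(nth_map 0%N) ?size_L ?size_codes // nth_L codes_nth.
rewrite def_L; apply: swapped_in_ideal.
- move=> c /(nthP 0%N)[k]; rewrite size_take size_L; have rn := ltnW (hi_subproof r).
  rewrite rn => kr; have kn := ltn_trans kr rn; rewrite nth_take // => <-.
  rewrite (nth_L (Ordinal kn)) -f_lo f_lt ?leqnn //= /f code_ge /=.
  apply/eqP => /(code_inj l_gt0) /initial_tab_inj eq_i.
  have /(congr1 val) /= := perm_inj (etrans eq_i (esym x_hi)).
  by move: kr; clear; lia.
- exact: code_ge.
- apply/(sortedP 0%N) => k; rewrite size_take size_L; have rn := ltnW (hi_subproof r).
  rewrite rn => kr; have kn := ltn_trans kr rn; rewrite !nth_take // 1?ltnW //.
  rewrite (nth_L (Ordinal kn)) (nth_L (Ordinal (ltnW kn))); apply: f_lt => //=.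
  by rewrite ltnW.
- have -> : a :: drop r.+2 L = drop r.+1 L.
    rewrite [RHS](drop_nth 0%N) ?size_L; last exact: hi_subproof.
    by rewrite -f_hi -nth_L.
  apply/(sortedP 0%N) => k; rewrite size_drop size_L ltn_subRL => kn.
  rewrite !nth_drop; have kn' : (r.+1 + k < n)%N by move: kn; clear; lia.
  rewrite (nth_L (Ordinal kn)) (nth_L (Ordinal kn')); apply: f_lt; rewrite /=; clear; lia.
- rewrite -def_L; apply: uniq_perm.
  + rewrite map_inj_uniq ?enum_uniq // => k k' /(code_inj l_gt0) /initial_tab_inj; exact: perm_inj.
  + exact: sorted_uniq ltn_trans ltnn _ (codes_sorted lam).
  move=> c; apply/mapP/idP => [[k _ ->]|/initial_tab_at[k <- _]].
    by rewrite /f -codes_nth mem_nth // size_codes.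
  by exists ((q^-1)%g k); rewrite ?mem_enum // /f permKV.
Qed.

(** Induct on the length. A word that is not reduced is braid equivalent to one with a
    square, and all correction terms are shorter. A reduced word can be replaced by any
    other reduced word of its permutation: the chosen one if the tableau is standard,
    the one of [nonstandard_in_ideal] if not. *)
Lemma spanned_word w : spanned (below w) (idem i0 * psiw w).
Proof.
move def_m: (size w) => m; elim/ltn_ind: m => m IH in w def_m *.
have {}IH w' : (size w' < size w)%N -> spanned (below w') (idem i0 * psiw w').
  by rewrite def_m => /IH; apply.
have [red_w|] := boolP (reduced w); last first.
  case/nonreduced_braid_eq => x [r [z wxz]].
  apply: (spanned_braid_eq wxz) => //; apply: spanned_square => w' lt_w'.
  by apply: IH; rewrite (braid_eq_size wxz).
have [w_std|w_std] := boolP (perm_tab lam (word_perm w) \in Std lam).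
  apply: (spanned_braid_eq (v := red (word_perm w))) => //.
    by apply: reduced_braid_eq; rewrite ?reduced_red ?word_perm_red.
  have eq_d := dperm_perm_tab lam (word_perm w).
  rewrite -{2}eq_d -/(basis_elt _); apply: spanned_basis => //.
  rewrite /below eq_d -{2}(word_perm_red (word_perm w)); exact: subproduct_refl.
have [w' red_w' [eq_w Iw]] := nonstandard_in_ideal w_std.
apply: (spanned_braid_eq (v := w')) => //; first exact: reduced_braid_eq.
exact: spanned_ideal.
Qed.

(** Sliding the dot through psi_d(t) leaves proper subwords of the reduced word of
    d(t). Their products are different from d(t), as that word has minimal length, and
    lie below it. *)
Lemma spanned_basis_dot t m : t \in Std lam -> spanned (tab_lt t) (basis_elt t * dot m).
Proof.
move=> t_std; have tT : t \in Tab lam by move: t_std; rewrite inE => /andP[].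
rewrite -[_ * dot m]mulr1 -psiw_nil; apply: spanned_dot => u sub_u lt_u.
rewrite cats0; apply: spanned_mono (spanned_word u) => v v_std [u' sub_u' eq_v].
have vT : v \in Tab lam by move: v_std; rewrite inE => /andP[].
have below_v : subproduct (red (dperm lam t)) (dperm lam v).
  by exists u' => //; apply: subseq_trans sub_u' sub_u.
split; last first.
  move=> eq_tv; have [_ /(_ u')] := red_reduced (dperm lam t).
  rewrite eq_v eq_tv => /(_ erefl); rewrite leqNgt -eq_tv.
  by rewrite (leq_ltn_trans (size_subseq sub_u') lt_u).
rewrite -(perm_tab_dperm tT) -(perm_tab_dperm vT) -{1}(word_perm_red (dperm lam t)).
by apply: tab_le_subproduct => //; apply: reduced_red.
Qed.

Lemma spanned_mulr_basis x :
    (forall v, v \in Std lam -> spanned (fun _ => True) (basis_elt v * x)) ->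
  forall z, spanned (fun _ => True) z -> spanned (fun _ => True) (z * x).
Proof.
move=> on_basis z [c Iz]; set S := \sum_(v in Std lam | _) _ in Iz; rewrite -(subrK S z) mulrDl.
apply: spannedD; first by apply/spanned_ideal/IMr.
rewrite mulr_suml; apply: spanned_sum => v /andP[v_std _].
by rewrite -scaleAl; apply/spannedZ/on_basis.
Qed.

(** By induction on an expression of [x] in the generators: crossings extend the word,
    dots are [spanned_basis_dot], and idempotents act by 0 or 1. *)
Lemma spanned_mulr x z : spanned (fun _ => True) z -> spanned (fun _ => True) (z * x).
Proof.
have weaken P u : spanned P u -> spanned (fun _ => True) u by apply: spanned_mono.
rewrite -[x](@repK _ _ (@blob_relations F e l n kap)).
elim: (rep x) z => {x} [g|a|t IH|t IHt u IHu|t IHt u IHu] z spz.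
- apply: spanned_mulr_basis spz => v v_std; case: g => [r|m|j].
  + have -> : basis_elt v * psi r = idem i0 * psiw (rcons (red (dperm lam v)) r).
      by rewrite -cats1 psiw_cat psiw_cons psiw_nil mulr1 mulrA.
    exact: weaken (spanned_word _).
  + exact: weaken (spanned_basis_dot m v_std).
  + have -> : basis_elt v * idem j =
        (perm_res i0 (word_perm (red (dperm lam v))) == j)%:R *: basis_elt v.
      rewrite /basis_elt idem_psiw -mulrA idemM.
      by case: eqP => _; rewrite ?scale1r // mulr0 scale0r.
    by apply/spannedZ/spanned_basis.
- have -> : z * cls (@blob_relations F e l n kap) (TScalar a) = a *: z.
    by rewrite scaleE; apply/esym/pscalarC.
  exact: spannedZ.
- have -> : cls (@blob_relations F e l n kap) (TOpp t) = - cls _ t.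
    by apply: Defs.lift_inj => A g h; rewrite liftN !lift_cls.
  have -> : z * - cls (@blob_relations F e l n kap) t = - (z * cls _ t) by apply: mulrN.
  by apply/spannedN/IH.
- have -> : cls (@blob_relations F e l n kap) (TAdd t u) = cls _ t + cls _ u.
    by apply: Defs.lift_inj => A g h; rewrite liftD !lift_cls.
  have -> : z * (cls (@blob_relations F e l n kap) t + cls _ u) = z * cls _ t + z * cls _ u.
    exact: mulrDr.
  by apply: spannedD; [apply: IHt | apply: IHu].
- have -> : cls (@blob_relations F e l n kap) (TMul t u) = cls _ t * cls _ u.
    by apply: Defs.lift_inj => A g h; rewrite liftM !lift_cls.
  have -> : z * (cls (@blob_relations F e l n kap) t * cls _ u) = z * cls _ t * cls _ u.
    exact: mulrA.
  by apply/IHu/IHt.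
Qed.

End Straightening.

(** * The span of the higher shapes *)
Section Cellular.
Variables (F : fieldType) (e l n : nat) (khat : 'I_l -> int).
Hypotheses (e_gt1 : (1 < e)%N) (l_gt1 : (1 < l)%N).
Hypothesis khat_saf : strongly_adjacency_free e n khat.
Variable red : {perm 'I_n} -> seq 'I_n.-1.
Hypothesis red_reduced : forall w : {perm 'I_n}, reduced_expression w (red w).
Local Notation kap := (charge e khat).
Local Notation B := (blob F n kap).
Local Notation above := (@in_span_above F e l n kap red).
Local Notation m_ := (@mst F e l n kap red).

Lemma star_mst mu a b : star (m_ mu a b) = m_ mu b a.
Proof. by rewrite /mst !starM starK star_gen mulrA. Qed.

Lemma mst_basis mu a b : m_ mu a b =
  star (psi_perm kap red (dperm mu a)) * basis_elt F e khat mu red b.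
Proof. by rewrite /mst -mulrA. Qed.

Lemma above0 lam : above lam 0.
Proof.
exists (fun _ _ _ => 0); rewrite big1 // => mu _; rewrite big1 // => a _.
by rewrite big1 // => b _; rewrite scale0r.
Qed.

Lemma aboveD lam x z : above lam x -> above lam z -> above lam (x + z).
Proof.
move=> [c ->] [d ->]; exists (fun mu a b => c mu a b + d mu a b).
rewrite -big_split; apply: eq_bigr => mu _; rewrite -big_split; apply: eq_bigr => a _.
by rewrite -big_split; apply: eq_bigr => b _; rewrite scalerDl.
Qed.

Lemma aboveZ lam k x : above lam x -> above lam (k *: x).
Proof.
move=> [c ->]; exists (fun mu a b => k * c mu a b).
rewrite scaler_sumr; apply: eq_bigr => mu _; rewrite scaler_sumr; apply: eq_bigr => a _.
by rewrite scaler_sumr; apply: eq_bigr => b _; rewrite scalerA.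
Qed.

Lemma above_sum lam (T : Type) (s : seq T) (P : pred T) (f : T -> B) :
  (forall j, P j -> above lam (f j)) -> above lam (\sum_(j <- s | P j) f j).
Proof. by move=> Pf; elim/big_ind: _ => //; [apply: above0 | apply: aboveD]. Qed.

Lemma above_mst lam mu a b : par_lt lam mu -> a \in Std mu -> b \in Std mu ->
  above lam (m_ mu a b).
Proof.
move=> lt_mu a_std b_std.
exists (fun mu' a' b' => [&& mu' == mu, a' == a & b' == b]%:R).
rewrite (bigD1 mu) /=; last exact/asboolP.
rewrite (bigD1 a) //= (bigD1 b) //= !eqxx scale1r.
rewrite big1 => [|b' /andP[_ /negPf ->]]; last by rewrite scale0r.
rewrite addr0 big1 => [|a' /andP[_ /negPf ->]]; last by rewrite big1 // => b' _; rewrite scale0r.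
rewrite addr0 big1 ?addr0 // => mu' /andP[_ /negPf ->].
by rewrite big1 // => a' _; rewrite big1 // => b' _; rewrite scale0r.
Qed.

Lemma above_ind lam (Q : B -> Prop) :
  Q 0 -> (forall x z, Q x -> Q z -> Q (x + z)) -> (forall k x, Q x -> Q (k *: x)) ->
  (forall mu a b, par_lt lam mu -> a \in Std mu -> b \in Std mu -> Q (m_ mu a b)) ->
  forall x, above lam x -> Q x.
Proof.
move=> Q0 QD QZ Qm _ [c ->]; elim/big_ind: _ => // mu /asboolP lt_mu.
elim/big_ind: _ => // a a_std; elim/big_ind: _ => // b b_std.
exact/QZ/Qm.
Qed.

Lemma above_mono lam mu x : par_lt lam mu -> above mu x -> above lam x.
Proof.
move=> lt_mu; apply: (above_ind (Q := above lam)) => [|z t|k z|nu a b lt_nu].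
- exact: above0.
- exact: aboveD.
- exact: aboveZ.
- by apply: above_mst => //; apply: (par_lt_trans (ltnW l_gt1) lt_mu lt_nu).
Qed.

Lemma above_star lam x : above lam x -> above lam (star x).
Proof.
apply: (above_ind (Q := fun x => above lam (star x))) =>
  [|z t ab_z ab_t|k z ab_z|mu a b lt_mu a_std b_std].
- by rewrite star0; apply: above0.
- by rewrite starD; apply: aboveD.
- by rewrite starZ; apply: aboveZ.
- by rewrite star_mst; apply: above_mst.
Qed.

Lemma mst_initial mu :
  m_ mu (initial_tab mu) (initial_tab mu) = idem F kap (res_seq kap (initial_tab mu)).
Proof.
have d1 : dperm mu (initial_tab mu) = 1%g.
  by apply: dperm_unique (initial_tab_Tab mu) _ => k; rewrite perm1.
have red1 : red 1%g = [::].
  by apply/size0nil/eqP; rewrite -leqn0; case: (red_reduced 1%g) => _ /(_ [::]); apply.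
rewrite /mst d1 /psi_perm red1 big_nil mulr1.
by rewrite star1 mul1r.
Qed.

Lemma above_idem lam mu : par_lt lam mu -> above lam (idem F kap (res_seq kap (initial_tab mu))).
Proof.
by move=> lt_mu; rewrite -mst_initial; apply: above_mst; rewrite ?initial_tab_Std // ltnW.
Qed.

(** Induct on the number of shapes above [lam]. For a shape [mu] above [lam], the span
    of the shapes above [mu] is an ideal by induction; modulo it [spanned_mulr] rewrites
    m_ab x, with a fixed, as a combination of m_av. Left multiplication follows by the
    anti-involution, which exchanges m_ab and m_ba. *)
Lemma above_ideal lam : ideal (above lam).
Proof.
move def_m: #|[set mu | `[< par_lt lam mu >]]| => m.
elim/ltn_ind: m => m IH in lam def_m *.
have {}IH mu : par_lt lam mu -> ideal (above mu).
  move=> lt_mu; apply: (IH _ _ mu erefl); rewrite -def_m; apply/proper_card/properP; split.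
    apply/subsetP => nu; rewrite !inE => /asboolP lt_nu; apply/asboolP.
    exact: (par_lt_trans (ltnW l_gt1) lt_mu lt_nu).
  by exists mu; rewrite inE; [apply/asboolP | apply/negP => /asboolP []].
have mulr_mst mu a b x : par_lt lam mu -> a \in Std mu -> b \in Std mu ->
    above lam (m_ mu a b * x).
  move=> lt_mu a_std b_std; have idI := IH mu lt_mu.
  have [c] : spanned mu (above mu) red (fun _ => True) (basis_elt F e khat mu red b * x).
    apply: (spanned_mulr e_gt1 l_gt1 khat_saf idI) => //; first by move=> nu; apply: above_idem.
    exact: spanned_basis.
  move=> /(idealMl idI (star (psi_perm kap red (dperm mu a)))) /(above_mono lt_mu).
  set S := \sum_(v in Std mu | _) _; rewrite mulrBr mulrA -mst_basis => ab.
  rewrite -(subrK (star (psi_perm kap red (dperm mu a)) * S) (_ * x)).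
  apply: aboveD => //; rewrite mulr_sumr; apply: above_sum => v /andP[v_std _].
  by rewrite -scaleAr -mst_basis; apply/aboveZ/above_mst.
have mulr_above a x : above lam a -> above lam (a * x).
  apply: (above_ind (Q := fun a => above lam (a * x))) =>
    [|z t ab_z ab_t|k z ab_z|mu s t lt_mu s_std t_std].
  - by rewrite mul0r; apply: above0.
  - by rewrite mulrDl; apply: aboveD.
  - by rewrite -scaleAl; apply: aboveZ.
  - exact: mulr_mst.
split=> //; [exact: above0 | by move=> a b; apply: aboveD |].
move=> x a /above_star ab; rewrite -[x * a]starK starM; apply/above_star.
exact: mulr_above.
Qed.

End Cellular.

(** * The Jucys-Murphy elements *)
Section JucysMurphy.
Variables (F : fieldType) (e l n : nat) (q : F) (kap : 'I_l -> 'Z_e).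
Hypothesis q_neq0 : q != 0.
Local Notation B := (blob F n kap).
Local Notation idem := (idem F kap).
Local Notation dot := (dot F kap).

Implicit Types (i j : resseq e n) (k m : 'I_n).

Definition jm (k : 'I_n) : B :=
  \sum_(i : resseq e n) q ^+ i k *: ((1 - dot k) * idem i).

Lemma to_blob_calL k : to_blob (calL q kap k) = jm k.
Proof.
have toZ a x : to_blob (a *: x : cycKLR F n kap) = a *: (to_blob x : B).
  exact: (lift_scale (R := @klr_relations F e l n kap) (A := blob_algebra F n kap)).
rewrite /calL /jm; transitivity (\sum_(i : resseq e n)
    to_blob (q ^+ i k *: ((1 - rgen F kap (GenY k)) * rgen F kap (GenE i))) : B).
  apply: (big_morph (@to_blob F e l n kap)) => [x z|].
    exact: (liftD (R := @klr_relations F e l n kap) (A := blob_algebra F n kap)).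
  by have := toZ 0 0; rewrite !scale0r.
apply: eq_bigr => i _; rewrite toZ; congr (_ *: _).
rewrite /to_blob rmorphM rmorphB rmorph1.
by congr ((_ - _) * _); exact: to_blob_gen.
Qed.

Lemma one_sub_dot_idem k i : (1 - dot k) * idem i = idem i * (1 - dot k).
Proof. by rewrite mulrBl mulrBr mul1r mulr1 dot_idem. Qed.

Lemma idem_jm i k : idem i * jm k = q ^+ i k *: (idem i * (1 - dot k)).
Proof.
rewrite /jm mulr_sumr (bigD1 i) //= big1 => [|j ji].
  by rewrite addr0 -scaleAr one_sub_dot_idem mulrA idemK.
by rewrite -scaleAr one_sub_dot_idem mulrA idemM eq_sym (negPf ji) mul0r scaler0.
Qed.

Lemma jm_comm k m : jm k * jm m = jm m * jm k.
Proof.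
have jmM a b i : idem i * (jm a * jm b) =
    (q ^+ i a * q ^+ i b) *: (idem i * ((1 - dot a) * (1 - dot b))).
  rewrite mulrA idem_jm -one_sub_dot_idem -scaleAl -mulrA idem_jm -scaleAr scalerA.
  by rewrite mulrA one_sub_dot_idem mulrA.
rewrite -[LHS]mul1r -[RHS]mul1r -(idem_sum F n kap).
rewrite [LHS]mulr_suml [RHS]mulr_suml.
have comm : (1 - dot k) * (1 - dot m) = (1 - dot m) * (1 - dot k).
  exact: commrB (commr1 _) (commr_sym (commrB (commr1 _) (dot_comm F kap m k))).
by apply: eq_bigr => i _; rewrite !jmM (mulrC (q ^+ _)) comm.
Qed.

Lemma jm_star k : star (jm k) = jm k.
Proof.
rewrite /jm (big_morph (@star F e l n kap) (@starD F e l n kap) (star0 F n kap)).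
apply: eq_bigr => i _; rewrite starZ starM starD starN star1 !star_gen.
by rewrite one_sub_dot_idem.
Qed.

(** The isomorphism sends y_k e(i) to (1 - q^(- i_k) L_k) e(i), so that L_k is recovered
    on each idempotent e(i), and these sum to 1. *)
Lemma BK_calL (f : {rmorphism cycKLR F n kap -> hecke n q kap}) :
  BK_isomorphism f -> forall k, f (calL q kap k) = hgen q kap (HeckeL k).
Proof.
case=> fZ _ _ fy k; rewrite /calL rmorph_sum.
rewrite (eq_bigr (fun i => hgen q kap (HeckeL k) * f (rgen F kap (GenE i)))) => [|i _].
  rewrite -mulr_sumr -rmorph_sum.
  have -> : \sum_(i : resseq e n) rgen F kap (GenE i) = 1 :> cycKLR F n kap.
    exact: (klr_sum1 (cycKLR_relations F n kap)).
  by rewrite rmorph1 mulr1.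
rewrite fZ rmorphM rmorphB rmorph1 mulrBl mul1r fy mulrBl mul1r opprB addrC subrK.
rewrite -[_ *: hgen _ _ _ * _]pscalerAl scalerA mulfV ?scale1r // expf_neq0 //.
Qed.

End JucysMurphy.

Theorem theorem40 (F : fieldType) (e l n : nat) (q : F) (khat : 'I_l -> int)
  (red : {perm 'I_n} -> seq 'I_n.-1)
  (e_gt1 : (1 < e)%N) (l_gt1 : (1 < l)%N) (n_gt1 : (1 < n)%N)
  (q_root : e.-primitive_root q)
  (khat_saf : strongly_adjacency_free e n khat)
  (red_reduced : forall w : {perm 'I_n}, reduced_expression w (red w)) :
  let kap := charge e khat in
  let JM := fun i : 'I_n => to_blob (calL q kap i) in
  (forall f : {rmorphism cycKLR F n kap -> hecke n q kap},
     BK_isomorphism f -> forall i : 'I_n, f (calL q kap i) = hgen q kap (HeckeL i))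
  /\
  [/\ forall i j : 'I_n, JM i * JM j = JM j * JM i,
      forall i : 'I_n, star (JM i) = JM i
    & forall (lam : par l n) (s t : tableau l n) (i : 'I_n),
        s \in Std lam -> t \in Std lam ->
        exists r : tableau l n -> F,
          in_span_above kap red lam
            (mst kap red lam s t * JM i
             - (q ^+ res kap (t i) *: mst kap red lam s t
                + \sum_(v in Std lam | `[< tab_lt t v >])
                    r v *: mst kap red lam s v))].
Proof.
move=> kap JM; have q_neq0 : q != 0.
  apply/eqP => q0; have := prim_expr_order q_root.
  by rewrite q0 expr0n; case: (e) e_gt1 => //= e' _ /esym/eqP; rewrite oner_eq0.
have JM_E i : JM i = jm q kap i by apply: to_blob_calL.
split; first by move=> f f_BK i; apply: (BK_calL q_neq0 f_BK).
split=> [i j|i|lam s t i s_std t_std].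
- by rewrite !JM_E jm_comm.
- by rewrite JM_E jm_star.
have idI := above_ideal F e_gt1 l_gt1 khat_saf red_reduced lam.
have above_I mu := @above_idem F e l n khat l_gt1 red red_reduced lam mu.
have [c] := spanned_basis_dot e_gt1 l_gt1 khat_saf idI above_I red_reduced i t_std.
have tT : t \in Tab lam by move: t_std; rewrite inE => /andP[].
set S := \sum_(v in Std lam | _) _ => above_S.
exists (fun v => - (q ^+ res kap (t i) * c v)); rewrite JM_E.
pose sp : blob F n kap := star (psi_perm kap red (dperm lam s)).
have jm_t : basis_elt F e khat lam red t * jm q kap i =
    q ^+ res kap (t i) *: (basis_elt F e khat lam red t -
                           basis_elt F e khat lam red t * dot F kap i).
  have res_t : perm_res (res_seq kap (initial_tab lam)) (dperm lam t) i = res kap (t i).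
    by rewrite /perm_res /res_seq ffunE ffunE -dpermP.
  rewrite /basis_elt idem_psiw (word_perm_red red_reduced) -mulrA idem_jm res_t.
  by rewrite -scaleAr mulrBr mulr1 mulrBr mulrA.
have -> : mst kap red lam s t * jm q kap i - (q ^+ res kap (t i) *: mst kap red lam s t
    + \sum_(v in Std lam | `[< tab_lt t v >]) - (q ^+ res kap (t i) * c v) *: mst kap red lam s v) =
    - q ^+ res kap (t i) *: (sp * (basis_elt F e khat lam red t * dot F kap i - S)).
  have -> : \sum_(v in Std lam | `[< tab_lt t v >])
      - (q ^+ res kap (t i) * c v) *: mst kap red lam s v = - q ^+ res kap (t i) *: (sp * S).
    rewrite mulr_sumr scaler_sumr; apply: eq_bigr => v _.
    by rewrite mst_basis -scaleAr scalerA mulNr.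
  rewrite mst_basis -/sp -mulrA jm_t -scaleAr !mulrBr !scalerBr !scaleNr !opprD !opprK.
  by rewrite addrACA subrr add0r.
apply: aboveZ; exact: (idealMl idI).
Qed.
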